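(* Let $N$ be a non-negative integer, $X>0$ and $x\in(0,X]$. Then the modified Bessel function $K_{i\tau}(x)$ has the following asymptotic expansion as $\tau\to+\infty$, which is an identity with explicit remainder for $\tau>0$: $$K_{i\tau}(x)=\sqrt{\frac{2\pi}{\tau}}\;e^{-\pi\tau/2}\left[\cos\left(\tau\log\left(\frac{2\tau}{ex}\right)-\frac{\pi}{4}\right)+R_N(\tau)\right],$$ where the remainder term $R_N(\tau)$ (which also depends on $x$) is given explicitly by $$R_N(\tau)=\mathrm{Re}\left[\exp\left(i\left(\tau\log\left(\frac{2\tau}{ex}\right)-\frac{\pi}{4}\right)\right)\left[r(\tau)+\bigl(1+r(\tau)\bigr)\left[\sum_{m=1}^{N}\frac{(x/2)^{2m}}{m!\,(1-i\tau)_m}+\frac{x^{2i\tau}}{2^N(1-i\tau)_N}\int_0^x(x^2-y^2)^{N-i\tau}I_{N+1}(y)\frac{dy}{y^N}\right]\right]\right]$$ and $$r(\tau)=\exp\left(\int_0^\infty e^{-i\tau t}\left[\frac12-\frac1t+\frac1{e^t-1}\right]\frac{dt}{t}\right)-1 .$$ Moreover, for every $\tau_0>0$ and every $\tau\ge\tau_0$, the remainder satisfies $$|R_N(\tau)|\le\frac1\tau\left[\frac{e^{1/(6\tau_0)}}{6}+\left(\tau_0+\frac{e^{1/(6\tau_0)}}{6}\right)\left[\exp\left(\frac{X^2}{4\tau_0}\right)+\left(\frac{X^2}{2\tau_0}\right)^N\left[\frac{I_N(X)}{X^N}-\frac{1}{2^N N!}\right]\right]\right].$$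
   Context: $K_{\nu}$ is the modified Bessel function of the second kind (Macdonald function), so $K_{i\tau}(x)=\int_0^\infty e^{-x\cosh t}\cos(\tau t)\,dt$ for $x>0$, $\tau\in\mathbb{R}$. $I_\nu(x)=\sum_{k=0}^\infty \frac{(x/2)^{2k+\nu}}{k!\,\Gamma(k+\nu+1)}$ is the modified Bessel function of the first kind. $(a)_n=a(a+1)\cdots(a+n-1)$, $(a)_0=1$, is the Pochhammer symbol. In the exponent, $e$ is the base of natural logarithms; powers of positive reals are $u^{z}=\exp(z\log u)$ with real $\log u$. The integral defining $r(\tau)$ is understood as an improper integral $\lim_{T\to\infty}\int_0^T$. *)

(* Defs.v *)
From Stdlib Require Export Reals Factorial.
From Coquelicot Require Export Coquelicot.

Open Scope R_scope.

Definition Cexp (z : C) : C :=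
  (exp (Re z) * cos (Im z), exp (Re z) * sin (Im z)).

(* Meaningful for [0 < u] only; as [ln 0 = 0] in Stdlib, [Rcpow 0 z = 1]. *)
Definition Rcpow (u : R) (z : C) : C := Cexp (z * RtoC (ln u))%C.

Fixpoint pochhammer (a : C) (n : nat) : C :=
  match n with
  | O => RtoC 1
  | S k => (pochhammer a k * (a + RtoC (INR k)))%C
  end.

Definition CRInt (f : R -> C) (a b : R) : C :=
  RInt (V := C_R_CompleteNormedModule) f a b.

(* The limit of [CRInt f a T] as [T -> +oo], not necessarily absolutely
   convergent. *)
Definition CRInt_infty (f : R -> C) (a : R) : C :=
  RInt_gen (V := C_R_CompleteNormedModule) f
    (at_point a) (Rbar_locally p_infty).

(* Euler's integral: Gamma for [0 < s]. *)
Definition Gamma (s : R) : R :=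
  RInt_gen (fun t => Rpower t (s - 1) * exp (- t))
    (at_right 0) (Rbar_locally p_infty).

(* I_n for integer order only, so that the powers are those of [pow]. *)
Definition besselI (n : nat) (x : R) : R :=
  Series (fun k : nat =>
    (x / 2) ^ (2 * k + n) / (INR (fact k) * Gamma (INR k + INR n + 1))).

(* K_{i tau}(x), for real [tau] and [0 < x]. *)
Definition besselK_imag (tau x : R) : R :=
  RInt_gen (fun t => exp (- x * cosh t) * cos (tau * t))
    (at_point 0) (Rbar_locally p_infty).

(* Dividing by 0 at [t = 0] is harmless: a Riemann integral ignores the value
   of the integrand at a single point. *)
Definition r_tau (tau : R) : C :=
  (Cexp (CRInt_infty (fun t : R =>
     Cexp (- (Ci * RtoC tau * RtoC t)) *
     RtoC ((1 / 2 - 1 / t + 1 / (exp t - 1)) / t)) 0) - RtoC 1)%C.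

Definition phase (tau x : R) : R :=
  tau * ln (2 * tau / (exp 1 * x)) - PI / 4.

(* For [N = 0] the sum from 1 to [N] is empty.  The values of the integrand at
   [y = 0] and [y = x] are irrelevant, as above. *)
Definition R_rem (N : nat) (x tau : R) : R :=
  let a : C := (RtoC 1 - Ci * RtoC tau)%C in
  let Sm : C :=
    sum_n_m (G := C_AbelianMonoid)
      (fun m : nat =>
         (RtoC ((x / 2) ^ (2 * m)) / (RtoC (INR (fact m)) * pochhammer a m))%C)
      1 N in
  let J : C :=
    CRInt (fun y : R =>
      (Rcpow (x ^ 2 - y ^ 2) (RtoC (INR N) - Ci * RtoC tau) *
       RtoC (besselI (N + 1) y / y ^ N))%C) 0 x in
  let Tm : C :=
    (Rcpow x (RtoC 2 * Ci * RtoC tau) / (RtoC (2 ^ N) * pochhammer a N) * J)%C in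
  Re (Cexp (Ci * RtoC (phase tau x)) *
      (r_tau tau + (RtoC 1 + r_tau tau) * (Sm + Tm)))%C.

(* Main.v *)
Require Import Defs.
From Stdlib Require Import Reals Lra Lia.
From Coquelicot Require Import Coquelicot.
Open Scope R_scope.

(* Put z = i tau, a = x / 2 and S = sum_m a^(2m) / (m! (1 - z)_m).

   Series. K_z(x) is the real part of the integral of exp(zt - a e^t - a e^(-t))
   over t > 0.  Expanding exp(- a e^(-t)) gives
   sum_m (-a)^m / m! * int_0^oo exp((z - m) t - a e^t) dt,
   and, p_c(v) = sum_j (-v)^j / (j! (z + c + j)) being v^(-z-c) times a lower
   incomplete gamma function, each of these integrals is
   Gamma(z) a^(m-z) (-1)^m / (1-z)_m - p_(-m)(a).  The p_(-m) contribute a double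
   sum whose (m,j) and (j,m) terms are opposite conjugates, hence nothing to the
   real part, and K_z(x) = Re (Gamma(z) a^(-z) S).

   Binet. For g(t) = (1/2 - 1/t + 1/(e^t - 1)) / t and mu(w) = int_0^oo e^(-wt) g(t) dt
   one has (1 - e^(-t)) g(t) = int_0^1 (1/2 - u) e^(-ut) du, so
   mu(w) - mu(w+1) = (w + 1/2) log((w+1)/w) - 1.  Summing over w = z, z+1, ... and
   using Stirling's formula for n! identifies Gamma(z), as the limit of
   n! n^z / (z)_(n+1), with sqrt(2 pi) z^(z - 1/2) e^(-z) e^(mu(z)).

   Remainder. Integration by parts turns the integral with (x^2 - y^2)^(N - z) into
   the (N+1)-st term of S plus the same integral for N + 1, so the integral is the
   tail of S.  Finally |mu(z)| <= 1 / (6 tau), because g decreases from 1/12 to 0,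
   and |S - 1| <= exp(x^2 / (4 tau)) - 1 <= tau0 / tau * (exp(X^2 / (4 tau0)) - 1),
   by |(1 - z)_m| >= tau^m and convexity of exp; the bracket with I_N(X) only adds
   a nonnegative amount. *)

(** * Complex-valued functions of a real variable *)

(** On Re z = 0 Binet's integral converges only conditionally, its kernel decaying like 1 / (2t),
    and Euler's integral for Gamma(z) diverges by oscillation at 0. Dominated convergence and Fubini
    on a half-line are therefore avoided. The integrals for mu and K are cut at a finite T,
    approximated uniformly in T by quantities with known limits, and passed to the limit by
    [Ctends_approx]; the one exchange of integrations takes place on a bounded rectangle, by
    differentiating in T.

    Gamma(i tau) thus has no integral to start from. The substitution u = e^t turns u^z into
    exp(zt), of modulus 1, and the series p_c continues the lower incomplete gamma function to Re =
    0 and beyond; Gamma(z) is the limit of exp(zt) p_0(e^t). Gauss's product is the common ground on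
    which this limit meets Binet's integral, and comparing the two requires the constant in
    Stirling's formula.

    The hypothesis tau > 0 keeps every denominator z + c + j at modulus at least tau, so that the
    series of p_c converges uniformly in c. *)

Notation is_derive_C := (is_derive (K := R_AbsRing) (V := C_R_NormedModule)).
Notation is_RInt_C := (is_RInt (V := C_R_NormedModule)).

(** Fixes the type [C], so that the complex operations apply to the pair; [Cpair s tau] is used for
    s + i tau. *)
Definition Cpair (a b : R) : C := (a, b).

Lemma C_eq (z w : C) : Re z = Re w -> Im z = Im w -> z = w.
Proof. destruct z, w; unfold Re, Im; simpl; congruence. Qed.

Lemma norm_C (z : C) : norm (V := C_R_NormedModule) z = Cmod z.
Proof. symmetry; apply Cmod_norm. Qed.

Lemma is_derive_C_intro (f : R -> C) (x : R) (l : C) :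
  is_derive (fun t => Re (f t)) x (Re l) ->
  is_derive (fun t => Im (f t)) x (Im l) -> is_derive_C f x l.
Proof.
  intros H1 H2.
  apply (is_derive_ext (V := C_R_NormedModule) (fun t => (Re (f t), Im (f t)))).
  { intros t; destruct (f t); reflexivity. }
  unfold is_derive in *.
  apply (filterdiff_ext_lin (V := C_R_NormedModule) _ (fun y : R => (y * Re l, y * Im l))).
  - apply (filterdiff_comp_2 (T := AbsRing_NormedModule R_AbsRing) (U := R_NormedModule)
      (V := R_NormedModule) (W := C_R_NormedModule)
      (fun t => Re (f t)) (fun t => Im (f t)) (fun u v => (u, v)) _ _ (fun u v => (u, v)) H1 H2).
    apply filterdiff_linear.
    split; [intros [a b] [c d]; reflexivity | intros k [a b]; reflexivity | ].
    exists 1; split; [lra|]. intros [a b]; simpl. rewrite Rmult_1_l. apply Rle_refl.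
  - intros y; destruct l; reflexivity.
Qed.

Lemma is_derive_Re (f : R -> C) (x : R) (l : C) :
  is_derive_C f x l -> is_derive (fun t => Re (f t)) x (Re l).
Proof.
  intros H.
  apply (filterdiff_ext_lin (V := R_NormedModule) _ (fun y : R => Re (scal (V := C_R_NormedModule) y l))).
  - apply (filterdiff_comp' (U := AbsRing_NormedModule R_AbsRing) (V := C_R_NormedModule) (W := R_NormedModule)
       f (fun z : C => Re z) x (fun y : R => scal (V := C_R_NormedModule) y l) (fun z : C => Re z)).
    + exact H.
    + apply filterdiff_linear.
      apply (is_linear_fst (U := R_NormedModule) (V := R_NormedModule)).
  - intros y; destruct l; reflexivity.
Qed.

Lemma is_derive_Im (f : R -> C) (x : R) (l : C) :
  is_derive_C f x l -> is_derive (fun t => Im (f t)) x (Im l).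
Proof.
  intros H.
  apply (filterdiff_ext_lin (V := R_NormedModule) _ (fun y : R => Im (scal (V := C_R_NormedModule) y l))).
  - apply (filterdiff_comp' (U := AbsRing_NormedModule R_AbsRing) (V := C_R_NormedModule) (W := R_NormedModule)
       f (fun z : C => Im z) x (fun y : R => scal (V := C_R_NormedModule) y l) (fun z : C => Im z)).
    + exact H.
    + apply filterdiff_linear.
      apply (is_linear_snd (U := R_NormedModule) (V := R_NormedModule)).
  - intros y; destruct l; reflexivity.
Qed.

Lemma is_derive_eq (f : R -> R) (x l l' : R) : is_derive f x l -> l = l' -> is_derive f x l'.
Proof. intros H <-; exact H. Qed.

Lemma is_derive_C_eq (f : R -> C) (x : R) (l l' : C) :
  is_derive_C f x l -> l = l' -> is_derive_C f x l'.
Proof. intros H <-; exact H. Qed.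

Lemma is_derive_R_mult (f g : R -> R) (x df dg : R) :
  is_derive f x df -> is_derive g x dg ->
  is_derive (fun t => f t * g t) x (df * g x + f x * dg).
Proof.
  intros Hf Hg. apply is_derive_Reals.
  apply (derivable_pt_lim_mult f g); apply is_derive_Reals; assumption.
Qed.

Lemma is_derive_R_comp (h f : R -> R) (x dh df : R) :
  is_derive h (f x) dh -> is_derive f x df -> is_derive (fun t => h (f t)) x (dh * df).
Proof.
  intros Hf Hg. apply is_derive_Reals.
  apply (derivable_pt_lim_comp f h); apply is_derive_Reals; assumption.
Qed.

Lemma is_derive_C_mult (f g : R -> C) (x : R) (df dg : C) :
  is_derive_C f x df -> is_derive_C g x dg ->
  is_derive_C (fun t => f t * g t)%C x (df * g x + f x * dg)%C.
Proof.
  intros Hf Hg.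
  pose proof (is_derive_Re _ _ _ Hf). pose proof (is_derive_Im _ _ _ Hf).
  pose proof (is_derive_Re _ _ _ Hg). pose proof (is_derive_Im _ _ _ Hg).
  apply is_derive_C_intro.
  - apply (is_derive_ext (fun t => Re (f t) * Re (g t) - Im (f t) * Im (g t))); [reflexivity|].
    replace (Re _) with ((Re df * Re (g x) + Re (f x) * Re dg) - (Im df * Im (g x) + Im (f x) * Im dg))
      by (unfold Re, Im; simpl; ring).
    apply (is_derive_minus (V := R_NormedModule)); apply is_derive_Reals;
    apply (derivable_pt_lim_mult (fun t => _ (f t)) (fun t => _ (g t))); apply is_derive_Reals; assumption.
  - apply (is_derive_ext (fun t => Re (f t) * Im (g t) + Im (f t) * Re (g t))); [reflexivity|].
    replace (Im _) with ((Re df * Im (g x) + Re (f x) * Im dg) + (Im df * Re (g x) + Im (f x) * Re dg))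
      by (unfold Re, Im; simpl; ring).
    apply (is_derive_plus (V := R_NormedModule)); apply is_derive_Reals;
    apply (derivable_pt_lim_mult (fun t => _ (f t)) (fun t => _ (g t))); apply is_derive_Reals; assumption.
Qed.

Lemma is_derive_C_plus (f g : R -> C) (x : R) (df dg : C) :
  is_derive_C f x df -> is_derive_C g x dg ->
  is_derive_C (fun t => f t + g t)%C x (df + dg)%C.
Proof. intros; apply (is_derive_plus (V := C_R_NormedModule)); assumption. Qed.

Lemma is_derive_C_const (c : C) (x : R) : is_derive_C (fun _ => c) x (RtoC 0).
Proof. apply (is_derive_const (V := C_R_NormedModule)). Qed.

Lemma is_derive_C_RtoC (f : R -> R) (x l : R) :
  is_derive f x l -> is_derive_C (fun t => RtoC (f t)) x (RtoC l).
Proof.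
  intros H; apply is_derive_C_intro; simpl; [exact H|].
  apply (is_derive_const (V := R_NormedModule)).
Qed.

Lemma is_derive_C_minus (f g : R -> C) (x : R) (df dg : C) :
  is_derive_C f x df -> is_derive_C g x dg ->
  is_derive_C (fun t => f t - g t)%C x (df - dg)%C.
Proof. intros; apply (is_derive_minus (V := C_R_NormedModule)); assumption. Qed.

Lemma is_derive_C_comp (f : R -> C) (h : R -> R) (x dh : R) (df : C) :
  is_derive_C f (h x) df -> is_derive h x dh ->
  is_derive_C (fun t => f (h t)) x (RtoC dh * df)%C.
Proof.
  intros Hf Hh. rewrite <- scal_R_Cmult.
  apply (is_derive_comp (V := C_R_NormedModule)); assumption.
Qed.

Lemma is_derive_Cexp (f : R -> C) (x : R) (df : C) :
  is_derive_C f x df -> is_derive_C (fun t => Cexp (f t)) x (df * Cexp (f x))%C.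
Proof.
  intros Hf.
  pose proof (is_derive_Re _ _ _ Hf) as H1. pose proof (is_derive_Im _ _ _ Hf) as H2.
  assert (He := is_derive_R_comp exp _ x _ _ (proj2 (is_derive_Reals _ _ _) (derivable_pt_lim_exp _)) H1).
  assert (Hc := is_derive_R_comp cos _ x _ _ (proj2 (is_derive_Reals _ _ _) (derivable_pt_lim_cos _)) H2).
  assert (Hs := is_derive_R_comp sin _ x _ _ (proj2 (is_derive_Reals _ _ _) (derivable_pt_lim_sin _)) H2).
  apply is_derive_C_intro.
  - apply (is_derive_ext (fun t => exp (Re (f t)) * cos (Im (f t)))); [reflexivity|].
    eapply is_derive_eq; [exact (is_derive_R_mult _ _ _ _ _ He Hc)|]. unfold Cexp, Re, Im; simpl; ring.
  - apply (is_derive_ext (fun t => exp (Re (f t)) * sin (Im (f t)))); [reflexivity|].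
    eapply is_derive_eq; [exact (is_derive_R_mult _ _ _ _ _ He Hs)|]. unfold Cexp, Re, Im; simpl; ring.
Qed.

(** * The complex exponential and the modulus *)

Lemma Cexp_plus (z w : C) : Cexp (z + w) = (Cexp z * Cexp w)%C.
Proof.
  destruct z as [a b], w as [c d]; unfold Cexp, Cmult; simpl.
  rewrite exp_plus, cos_plus, sin_plus. f_equal; ring.
Qed.

Lemma Cexp_0 : Cexp (RtoC 0) = RtoC 1.
Proof. unfold Cexp; simpl. rewrite exp_0, cos_0, sin_0. apply C_eq; simpl; ring. Qed.

Lemma Cmod_Cexp (z : C) : Cmod (Cexp z) = exp (Re z).
Proof.
  unfold Cmod, Cexp; simpl fst; simpl snd.
  replace ((exp (Re z) * cos (Im z)) ^ 2 + (exp (Re z) * sin (Im z)) ^ 2)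
    with (exp (Re z) ^ 2 * ((sin (Im z))² + (cos (Im z))²)) by (unfold Rsqr; ring).
  rewrite sin2_cos2, Rmult_1_r. apply sqrt_pow2. left; apply exp_pos.
Qed.

Lemma Cexp_neq_0 (z : C) : Cexp z <> RtoC 0.
Proof. apply Cmod_gt_0. rewrite Cmod_Cexp. apply exp_pos. Qed.

Lemma Cexp_opp (z : C) : Cexp (- z) = (/ Cexp z)%C.
Proof.
  assert (H : (Cexp (- z) * Cexp z = RtoC 1)%C).
  { rewrite <- Cexp_plus. replace (- z + z)%C with (RtoC 0) by ring. apply Cexp_0. }
  rewrite <- (Cmult_1_l (/ Cexp z)%C), <- H. field. apply Cexp_neq_0.
Qed.

Lemma Cexp_minus (z w : C) : Cexp (z - w) = (Cexp z / Cexp w)%C.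
Proof. unfold Cminus. rewrite Cexp_plus, Cexp_opp. reflexivity. Qed.

Lemma Cexp_RtoC (x : R) : Cexp (RtoC x) = RtoC (exp x).
Proof. unfold Cexp; simpl. rewrite cos_0, sin_0. apply C_eq; simpl; ring. Qed.

Lemma Cmod_le_Rabs (z : C) : Cmod z <= Rabs (Re z) + Rabs (Im z).
Proof.
  replace z with (RtoC (Re z) + Ci * RtoC (Im z))%C at 1 by (apply C_eq; simpl; ring).
  eapply Rle_trans; [apply Cmod_triangle|].
  rewrite Cmod_mult, Cmod_Ci, !Cmod_R. lra.
Qed.

Lemma im_le_Cmod (z : C) : Rabs (Im z) <= Cmod z.
Proof. eapply Rle_trans; [|apply Rmax_Cmod]. apply Rmax_r. Qed.

(** Stated by components, so that theorems on real limits apply to each of them directly;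
    [Ctends_filterlim] and [Ctends_Cmod] lead back to the topology of [C]. *)
Definition Ctends {T : Type} (f : T -> C) (F : (T -> Prop) -> Prop) (l : C) : Prop :=
  filterlim (fun t => Re (f t)) F (locally (Re l)) /\
  filterlim (fun t => Im (f t)) F (locally (Im l)).

Section Limits.
Context {T : Type} (F : (T -> Prop) -> Prop) {FF : Filter F}.

Lemma filterlim_R_of_abs (f g : T -> R) (l : R) :
  F (fun t => Rabs (f t - l) <= g t) -> filterlim g F (locally 0) -> filterlim f F (locally l).
Proof.
  intros H Hg. apply filterlim_locally. intros eps.
  pose proof (proj1 (filterlim_locally (F := F) g 0) Hg eps) as H1.
  generalize (filter_and _ _ H H1). apply filter_imp. intros t [Ha Hb].
  change (Rabs (f t - l) < eps). change (Rabs (g t - 0) < eps) in Hb.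
  pose proof (Rle_abs (g t - 0)). lra.
Qed.

Lemma Ctends_of_Cmod (f : T -> C) (g : T -> R) (l : C) :
  F (fun t => Cmod (f t - l) <= g t) -> filterlim g F (locally 0) -> Ctends f F l.
Proof.
  intros H Hg; split.
  - apply filterlim_R_of_abs with (2 := Hg). revert H. apply filter_imp. intros t Ht.
    eapply Rle_trans; [|exact Ht]. apply (re_le_Cmod (f t - l)).
  - apply filterlim_R_of_abs with (2 := Hg). revert H. apply filter_imp. intros t Ht.
    eapply Rle_trans; [|exact Ht]. apply (im_le_Cmod (f t - l)).
Qed.

Lemma Rlim_plus (f g : T -> R) (a b : R) :
  filterlim f F (locally a) -> filterlim g F (locally b) ->
  filterlim (fun t => f t + g t) F (locally (a + b)).
Proof.
  intros Hf Hg. eapply filterlim_comp_2; [exact Hf | exact Hg |].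
  apply (filterlim_plus (K := R_AbsRing) (V := R_NormedModule)).
Qed.

Lemma Rlim_opp (f : T -> R) (a : R) :
  filterlim f F (locally a) -> filterlim (fun t => - f t) F (locally (- a)).
Proof.
  intros Hf. eapply filterlim_comp; [exact Hf |].
  apply (filterlim_opp (K := R_AbsRing) (V := R_NormedModule)).
Qed.

Lemma Rlim_minus (f g : T -> R) (a b : R) :
  filterlim f F (locally a) -> filterlim g F (locally b) ->
  filterlim (fun t => f t - g t) F (locally (a - b)).
Proof. intros; apply Rlim_plus; [assumption|]. apply Rlim_opp; assumption. Qed.

Lemma Rlim_mult (f g : T -> R) (a b : R) :
  filterlim f F (locally a) -> filterlim g F (locally b) ->
  filterlim (fun t => f t * g t) F (locally (a * b)).
Proof.
  intros Hf Hg. eapply filterlim_comp_2; [exact Hf | exact Hg |].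
  apply (filterlim_mult (K := R_AbsRing)).
Qed.

Lemma Rlim_comp (h : R -> R) (k : T -> R) (a : R) :
  filterlim k F (locally a) -> continuous h a -> filterlim (fun t => h (k t)) F (locally (h a)).
Proof. intros Hk Hh. eapply filterlim_comp; [exact Hk | exact Hh]. Qed.

Lemma Ctends_const (c : C) : Ctends (fun _ => c) F c.
Proof. split; apply filterlim_const. Qed.

Lemma Ctends_plus (f g : T -> C) (a b : C) :
  Ctends f F a -> Ctends g F b -> Ctends (fun t => f t + g t)%C F (a + b)%C.
Proof. intros [] []; split; simpl; apply Rlim_plus; assumption. Qed.

Lemma Ctends_minus (f g : T -> C) (a b : C) :
  Ctends f F a -> Ctends g F b -> Ctends (fun t => f t - g t)%C F (a - b)%C.
Proof. intros [] []; split; simpl; apply Rlim_minus; assumption. Qed.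

Lemma Ctends_mult (f g : T -> C) (a b : C) :
  Ctends f F a -> Ctends g F b -> Ctends (fun t => f t * g t)%C F (a * b)%C.
Proof.
  intros [] []; split; simpl; [apply Rlim_minus | apply Rlim_plus]; apply Rlim_mult; assumption.
Qed.

Lemma Ctends_RtoC (f : T -> R) (a : R) :
  filterlim f F (locally a) -> Ctends (fun t => RtoC (f t)) F (RtoC a).
Proof. intros; split; simpl; [assumption | apply filterlim_const]. Qed.

Lemma Ctends_Cexp (f : T -> C) (a : C) :
  Ctends f F a -> Ctends (fun t => Cexp (f t)) F (Cexp a).
Proof.
  intros [H1 H2]; split; simpl; apply Rlim_mult;
  [ apply (Rlim_comp exp) | apply (Rlim_comp cos)
  | apply (Rlim_comp exp) | apply (Rlim_comp sin) ]; try assumption;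
  apply continuity_pt_filterlim; 
  first [ apply derivable_continuous_pt, derivable_pt_exp
        | apply continuity_cos | apply continuity_sin ].
Qed.

Lemma Ctends_ext_loc (f g : T -> C) (a : C) :
  F (fun t => f t = g t) -> Ctends f F a -> Ctends g F a.
Proof.
  intros H [H1 H2]; split.
  - refine (filterlim_ext_loc _ _ _ H1). revert H; apply filter_imp; intros; congruence.
  - refine (filterlim_ext_loc _ _ _ H2). revert H; apply filter_imp; intros; congruence.
Qed.

Lemma Ctends_ext (f g : T -> C) (a : C) :
  (forall t, f t = g t) -> Ctends f F a -> Ctends g F a.
Proof. intros H; apply Ctends_ext_loc, filter_forall, H. Qed.

Lemma Ctends_Cmod (f : T -> C) (a : C) :
  Ctends f F a -> filterlim (fun t => Cmod (f t - a)) F (locally 0).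
Proof.
  intros [H1 H2].
  apply filterlim_R_of_abs with (g := fun t => Rabs (Re (f t) - Re a) + Rabs (Im (f t) - Im a)).
  - apply filter_forall. intros t. rewrite Rminus_0_r, Rabs_pos_eq by apply Cmod_ge_0.
    apply (Cmod_le_Rabs (f t - a)).
  - replace 0 with (Rabs (Re a - Re a) + Rabs (Im a - Im a)) by (rewrite !Rminus_diag, Rabs_R0; ring).
    apply Rlim_plus; apply (Rlim_comp Rabs); try apply (continuous_abs (K := R_AbsRing));
    apply Rlim_minus; try assumption; apply filterlim_const.
Qed.

Lemma Ctends_filterlim (f : T -> C) (a : C) :
  Ctends f F a -> filterlim f F (locally (T := C_R_NormedModule) a).
Proof.
  intros [H1 H2]. apply filterlim_locally. intros eps.
  generalize (filter_and _ _ (proj1 (filterlim_locally _ _) H1 eps) (proj1 (filterlim_locally _ _) H2 eps)).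
  apply filter_imp. intros t [A B]. split; assumption.
Qed.
End Limits.

Lemma Ctends_unique {T : Type} (F : (T -> Prop) -> Prop) {FF : ProperFilter F} (f : T -> C) (a b : C) :
  Ctends f F a -> Ctends f F b -> a = b.
Proof.
  intros [H1 H2] [H3 H4]. apply C_eq.
  - exact (filterlim_locally_unique (F := F) (K := R_AbsRing) (V := R_NormedModule) _ _ _ H1 H3).
  - exact (filterlim_locally_unique (F := F) (K := R_AbsRing) (V := R_NormedModule) _ _ _ H2 H4).
Qed.

Lemma Ctends_Cmod_le {T : Type} (F : (T -> Prop) -> Prop) {FF : ProperFilter F} (f : T -> C) (a b : C) (M : R) :
  Ctends f F a -> F (fun t => Cmod (f t - b) <= M) -> Cmod (a - b) <= M.
Proof.
  intros Ha Hb.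
  apply Rnot_lt_le. intros Hlt.
  assert (He : 0 < Cmod (a - b) - M) by lra.
  pose proof (proj1 (filterlim_locally (F := F) _ 0) (Ctends_Cmod F f a Ha) (mkposreal _ He)) as H1.
  destruct (filter_ex _ (filter_and _ _ Hb H1)) as [t [A B]].
  change (Rabs (Cmod (f t - a) - 0) < Cmod (a - b) - M) in B.
  rewrite Rminus_0_r, Rabs_pos_eq in B by apply Cmod_ge_0.
  assert (Cmod (a - b) <= Cmod (f t - a) + Cmod (f t - b)).
  { replace (a - b)%C with (- (f t - a) + (f t - b))%C by ring.
    rewrite <- (Cmod_opp (f t - a)). apply Cmod_triangle. }
  lra.
Qed.

(** * Integrals of complex-valued functions *)

Lemma is_RInt_C_intro (f : R -> C) (a b : R) (l : C) :
  is_RInt (fun t => Re (f t)) a b (Re l) -> is_RInt (fun t => Im (f t)) a b (Im l) ->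
  is_RInt_C f a b l.
Proof.
  intros H1 H2. destruct l as [l1 l2].
  apply (is_RInt_fct_extend_pair (U := R_NormedModule) (V := R_NormedModule) f); assumption.
Qed.

Lemma is_RInt_Re (f : R -> C) (a b : R) (l : C) :
  is_RInt_C f a b l -> is_RInt (fun t => Re (f t)) a b (Re l).
Proof. apply (is_RInt_fct_extend_fst (U := R_NormedModule) (V := R_NormedModule)). Qed.

Lemma is_RInt_Im (f : R -> C) (a b : R) (l : C) :
  is_RInt_C f a b l -> is_RInt (fun t => Im (f t)) a b (Im l).
Proof. apply (is_RInt_fct_extend_snd (U := R_NormedModule) (V := R_NormedModule)). Qed.

Lemma is_RInt_C_mult (c : C) (f : R -> C) (a b : R) (l : C) :
  is_RInt_C f a b l -> is_RInt_C (fun t => c * f t)%C a b (c * l)%C.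
Proof.
  intros H. pose proof (is_RInt_Re _ _ _ _ H) as H1. pose proof (is_RInt_Im _ _ _ _ H) as H2.
  apply is_RInt_C_intro; simpl.
  - apply (is_RInt_minus (V := R_NormedModule)); apply (is_RInt_scal (V := R_NormedModule)); assumption.
  - apply (is_RInt_plus (V := R_NormedModule)); apply (is_RInt_scal (V := R_NormedModule)); assumption.
Qed.

Lemma is_RInt_C_plus (f g : R -> C) (a b : R) (l m : C) :
  is_RInt_C f a b l -> is_RInt_C g a b m -> is_RInt_C (fun t => f t + g t)%C a b (l + m)%C.
Proof. apply (is_RInt_plus (V := C_R_NormedModule)). Qed.

Lemma is_RInt_C_minus (f g : R -> C) (a b : R) (l m : C) :
  is_RInt_C f a b l -> is_RInt_C g a b m -> is_RInt_C (fun t => f t - g t)%C a b (l - m)%C.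
Proof. apply (is_RInt_minus (V := C_R_NormedModule)). Qed.

Lemma Cmod_RInt_le (f : R -> C) (g : R -> R) (a b : R) (l : C) (m : R) :
  a <= b -> (forall t, a <= t <= b -> Cmod (f t) <= g t) ->
  is_RInt_C f a b l -> is_RInt g a b m -> Cmod l <= m.
Proof.
  intros Hab H Hf Hg. rewrite <- norm_C.
  apply (norm_RInt_le (V := C_R_NormedModule) f g a b l m Hab); [|exact Hf|exact Hg].
  intros t Ht; rewrite norm_C; apply H, Ht.
Qed.

Lemma is_RInt_C_derive (f df : R -> C) (a b : R) :
  (forall x, Rmin a b <= x <= Rmax a b -> is_derive_C f x (df x)) ->
  (forall x, Rmin a b <= x <= Rmax a b -> continuous (U := C_R_NormedModule) df x) ->
  is_RInt_C df a b (f b - f a)%C.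
Proof. apply (is_RInt_derive (V := C_R_CompleteNormedModule)). Qed.

Lemma RInt_C_unique (f : R -> C) (a b : R) (l m : C) :
  is_RInt_C f a b l -> is_RInt_C f a b m -> l = m.
Proof.
  intros H1 H2.
  rewrite <- (is_RInt_unique (V := C_R_CompleteNormedModule) f a b l H1).
  apply (is_RInt_unique (V := C_R_CompleteNormedModule) f a b m H2).
Qed.

Lemma CRInt_eq (f : R -> C) (a b : R) (l : C) : is_RInt_C f a b l -> CRInt f a b = l.
Proof. apply (is_RInt_unique (V := C_R_CompleteNormedModule)). Qed.

Lemma is_RInt_gen_intro {V : NormedModule R_AbsRing} (f : R -> V) (I : R -> V) (a : R) (l : V) :
  (forall T, a < T -> is_RInt f a T (I T)) ->
  filterlim I (Rbar_locally p_infty) (locally l) ->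
  is_RInt_gen f (at_point a) (Rbar_locally p_infty) l.
Proof.
  intros H Hl P HP. specialize (Hl P HP). destruct Hl as [M HM].
  exists (fun x => x = a) (fun T => Rmax a M < T).
  - reflexivity.
  - exists (Rmax a M). auto.
  - intros x y -> Hy. exists (I y). split.
    + apply H. eapply Rle_lt_trans; [apply Rmax_l|exact Hy].
    + apply HM. eapply Rle_lt_trans; [apply Rmax_r|exact Hy].
Qed.

Lemma is_RInt_C_ext (f g : R -> C) (a b : R) (l : C) :
  a <= b -> (forall t, a < t < b -> f t = g t) -> is_RInt_C f a b l -> is_RInt_C g a b l.
Proof.
  intros Hab H. apply (is_RInt_ext (V := C_R_NormedModule)). intros t Ht.
  rewrite Rmin_left, Rmax_right in Ht by exact Hab. apply H, Ht.
Qed.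

Lemma is_RInt_R_ext (f g : R -> R) (a b l : R) :
  a <= b -> (forall t, a < t < b -> f t = g t) -> is_RInt f a b l -> is_RInt g a b l.
Proof.
  intros Hab H. apply (is_RInt_ext (V := R_NormedModule)). intros t Ht.
  rewrite Rmin_left, Rmax_right in Ht by exact Hab. apply H, Ht.
Qed.

Lemma is_RInt_R_derive (f df : R -> R) (a b : R) :
  a <= b -> (forall x, a <= x <= b -> is_derive f x (df x)) ->
  (forall x, a <= x <= b -> continuous df x) -> is_RInt df a b (f b - f a).
Proof.
  intros Hab H1 H2. apply (is_RInt_derive (V := R_CompleteNormedModule)); rewrite Rmin_left, Rmax_right by exact Hab; assumption.
Qed.

Lemma Ctends_opp {T : Type} (F : (T -> Prop) -> Prop) {FF : Filter F} (f : T -> C) (a : C) :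
  Ctends f F a -> Ctends (fun t => - f t)%C F (- a)%C.
Proof. intros []; split; simpl; apply (Rlim_opp F); assumption. Qed.

Lemma Ctends_inv {T : Type} (F : (T -> Prop) -> Prop) {FF : Filter F} (f : T -> C) (a : C) :
  a <> RtoC 0 -> Ctends f F a -> Ctends (fun t => / f t)%C F (/ a)%C.
Proof.
  intros Ha [H1 H2].
  assert (Hn : Re a ^ 2 + Im a ^ 2 <> 0).
  { intros E. apply Ha. apply C_eq; simpl; nra. }
  assert (Hd : filterlim (fun t => / (Re (f t) * Re (f t) + Im (f t) * Im (f t))) F
     (locally (/ (Re a * Re a + Im a * Im a)))).
  { apply (Rlim_comp F Rinv (fun t => Re (f t) * Re (f t) + Im (f t) * Im (f t))).
    - apply (Rlim_plus F); apply (Rlim_mult F); assumption.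
    - apply continuity_pt_filterlim.
      apply (continuity_pt_inv (fun x => x)); [apply derivable_continuous_pt, derivable_pt_id|].
      intros E; apply Hn; simpl; rewrite !Rmult_1_r; exact E. }
  split.
  - apply (filterlim_ext (fun t : T => Re (f t) * / (Re (f t) * Re (f t) + Im (f t) * Im (f t)))).
    + intros t. unfold Cinv, Re, Im; simpl. rewrite !Rmult_1_r. reflexivity.
    + replace (Re (/ a)) with (Re a * / (Re a * Re a + Im a * Im a))
        by (unfold Cinv, Re, Im; simpl; rewrite !Rmult_1_r; reflexivity).
      apply (Rlim_mult F); assumption.
  - apply (filterlim_ext (fun t : T => (- Im (f t)) * / (Re (f t) * Re (f t) + Im (f t) * Im (f t)))).
    + intros t. unfold Cinv, Re, Im; simpl. rewrite !Rmult_1_r. reflexivity.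
    + replace (Im (/ a)) with ((- Im a) * / (Re a * Re a + Im a * Im a))
        by (unfold Cinv, Re, Im; simpl; rewrite !Rmult_1_r; reflexivity).
      apply (Rlim_mult F); [|assumption]. apply (Rlim_opp F); assumption.
Qed.

Lemma Ctends_comp {T U : Type} (F : (T -> Prop) -> Prop) (G : (U -> Prop) -> Prop) 
  (h : T -> U) (f : U -> C) (a : C) :
  filterlim h F G -> Ctends f G a -> Ctends (fun t => f (h t)) F a.
Proof.
  intros Hh [H1 H2]; split;
  [exact (filterlim_comp _ _ _ h (fun u => Re (f u)) F G _ Hh H1) | exact (filterlim_comp _ _ _ h (fun u => Im (f u)) F G _ Hh H2)].
Qed.

(** Differentiation under the integral sign. It takes the place of Fubini's theorem in
    [mu_diff_RInt]: two functions of the upper limit with equal derivatives are compared instead of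
    two double integrals. *)
Lemma is_derive_RInt_param_C (f df : R -> R -> C) (a b : R) :
  (forall x u, is_derive_C (fun x => f x u) x (df x u)) ->
  (forall x u, Ctends (fun z : R * R => df (fst z) (snd z)) (locally (x, u)) (df x u)) ->
  (forall x u, Ctends (f x) (locally u) (f x u)) ->
  exists If, (forall x, is_RInt_C (f x) a b (If x)) /\
    forall x l, is_RInt_C (df x) a b l -> is_derive_C If x l.
Proof.
  intros Hd H2 Hc.
  assert (Hex : forall x, ex_RInt (fun u => Re (f x u)) a b /\ ex_RInt (fun u => Im (f x u)) a b).
  { intros x; split; apply (ex_RInt_continuous (V := R_CompleteNormedModule)); intros u _; apply (Hc x u). }
  exists (fun x => (RInt (fun u => Re (f x u)) a b, RInt (fun u => Im (f x u)) a b)). split.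
  - intros x. apply is_RInt_C_intro.
    + exact (RInt_correct (V := R_CompleteNormedModule) (fun u => Re (f x u)) a b (proj1 (Hex x))).
    + exact (RInt_correct (V := R_CompleteNormedModule) (fun u => Im (f x u)) a b (proj2 (Hex x))).
  - intros x l Hl.
    assert (DR : forall x u, Derive (fun x => Re (f x u)) x = Re (df x u))
      by (intros; apply is_derive_unique; exact (is_derive_Re _ _ _ (Hd x0 u))).
    assert (DI : forall x u, Derive (fun x => Im (f x u)) x = Im (df x u))
      by (intros; apply is_derive_unique; exact (is_derive_Im _ _ _ (Hd x0 u))).
    apply is_derive_C_intro; simpl.
    + replace (Re l) with (RInt (fun u => Derive (fun x => Re (f x u)) x) a b).
      * apply (is_derive_RInt_param (fun x u => Re (f x u))).
        -- apply filter_forall. intros y u _. eexists; exact (is_derive_Re _ _ _ (Hd y u)).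
        -- intros u _. apply (continuity_2d_pt_ext (fun x u => Re (df x u))); [intros; symmetry; apply DR|].
           apply continuity_2d_pt_filterlim. apply (H2 x u).
        -- apply filter_forall. intros y; exact (proj1 (Hex y)).
      * apply (is_RInt_unique (V := R_CompleteNormedModule)).
        apply (is_RInt_ext (V := R_NormedModule) (fun u => Re (df x u))); [intros; symmetry; apply DR|].
        apply is_RInt_Re, Hl.
    + replace (Im l) with (RInt (fun u => Derive (fun x => Im (f x u)) x) a b).
      * apply (is_derive_RInt_param (fun x u => Im (f x u))).
        -- apply filter_forall. intros y u _. eexists; exact (is_derive_Im _ _ _ (Hd y u)).
        -- intros u _. apply (continuity_2d_pt_ext (fun x u => Im (df x u))); [intros; symmetry; apply DI|].
           apply continuity_2d_pt_filterlim. apply (H2 x u).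
        -- apply filter_forall. intros y; exact (proj2 (Hex y)).
      * apply (is_RInt_unique (V := R_CompleteNormedModule)).
        apply (is_RInt_ext (V := R_NormedModule) (fun u => Im (df x u))); [intros; symmetry; apply DI|].
        apply is_RInt_Im, Hl.
Qed.

(** * Binet's kernel *)

Lemma nonneg_of_derive (f df : R -> R) :
  f 0 = 0 -> (forall t, 0 <= t -> is_derive f t (df t)) -> (forall t, 0 <= t -> 0 <= df t) ->
  forall t, 0 <= t -> 0 <= f t.
Proof.
  intros H0 Hd Hp t Ht.
  destruct (MVT_gen f 0 t df) as [c [Hc E]].
  - intros x Hx. apply Hd. rewrite Rmin_left in Hx by lra. lra.
  - intros x Hx. apply continuity_pt_filterlim.
    apply (ex_derive_continuous (V := R_NormedModule)). exists (df x). apply Hd.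
    rewrite Rmin_left in Hx by lra; lra.
  - rewrite Rmin_left in Hc by lra. assert (0 <= df c * (t - 0)) by (apply Rmult_le_pos; [apply Hp|]; lra).
    lra.
Qed.

(** One step of repeated differentiation: the function is checked to vanish at 0 and to have
    derivative [g], and the nonnegativity of [g] is left as the goal. *)
Ltac derive_chain g := apply nonneg_of_derive with (df := g); cbv beta;
  [ try rewrite Ropp_0; rewrite ?exp_0; try field | intros t Ht; auto_derive; [now auto | field] | ].

Lemma exp_le_mono (x y : R) : x <= y -> exp x <= exp y.
Proof. intros [H| ->]; [left; apply exp_increasing, H | right; reflexivity]. Qed.

Lemma exp_ge_1 (t : R) : 0 <= t -> 1 <= exp t.
Proof. intros. pose proof (exp_ineq1_le t); lra. Qed.

Definition binet_kernel (t : R) : R := (1 / 2 - 1 / t + 1 / (exp t - 1)) / t.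

(** (t - 2) e^t + t + 2, the numerator of the kernel in [binet_kernel_eq], has Taylor coefficients
    (n - 2) / n! for n >= 3 and 0 below; t^3 / 6 is its first term. *)
Lemma binet_num_ge (t : R) : 0 <= t -> 0 <= (t - 2) * exp t + t + 2 - t ^ 3 / 6.
Proof.
  revert t. derive_chain (fun t => (t - 1) * exp t + 1 - t ^ 2 / 2).
  derive_chain (fun t => t * exp t - t). intros t Ht.
  pose proof (exp_ge_1 t Ht). nra.
Qed.

Lemma binet_num_le (t : R) : 0 <= t -> 0 <= t ^ 2 * (exp t - 1) - 6 * ((t - 2) * exp t + t + 2).
Proof.
  revert t. derive_chain (fun t => t ^ 2 * exp t + 2 * t * (exp t - 1) - 6 * ((t - 1) * exp t + 1)).
  derive_chain (fun t => exp t * (t ^ 2 - 2 * t + 2) - 2).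
  derive_chain (fun t => exp t * t ^ 2). intros t Ht.
  pose proof (exp_pos t). nra.
Qed.

(** Up to a positive factor this is the negative of the derivative of the kernel. The coefficient of
    t^(2n) is (2n - 4) / (2n)! for n >= 2, and those of 1 and t^2 cancel. *)
Lemma sinh_cosh_ineq (t : R) : 0 <= t ->
  0 <= t * (exp t - exp (- t)) / 2 + t ^ 2 - 4 * ((exp t + exp (- t)) / 2) + 4.
Proof.
  revert t.
  derive_chain (fun t => t * ((exp t + exp (- t)) / 2) - 3 * ((exp t - exp (- t)) / 2) + 2 * t).
  derive_chain (fun t => t * ((exp t - exp (- t)) / 2) - 2 * ((exp t + exp (- t)) / 2) + 2).
  derive_chain (fun t => t * ((exp t + exp (- t)) / 2) - (exp t - exp (- t)) / 2).
  derive_chain (fun t => t * ((exp t - exp (- t)) / 2)).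
  intros t Ht. apply Rmult_le_pos; [exact Ht|].
  assert (exp (- t) <= exp t) by (destruct Ht as [Ht| <-]; [left; apply exp_increasing; lra | rewrite Ropp_0; lra]).
  lra.
Qed.

Lemma exp_gt_1 (t : R) : 0 < t -> 0 < exp t - 1.
Proof. intros. pose proof (exp_ineq1 t ltac:(lra)). lra. Qed.

Lemma binet_kernel_eq (t : R) : 0 < t ->
  binet_kernel t = ((t - 2) * exp t + t + 2) / (2 * t ^ 2 * (exp t - 1)).
Proof. intros H. pose proof (exp_gt_1 t H). unfold binet_kernel. field. split; lra. Qed.

Lemma binet_kernel_le (t : R) : 0 < t -> binet_kernel t <= / 12.
Proof.
  intros H. pose proof (exp_gt_1 t H). rewrite binet_kernel_eq by exact H.
  pose proof (binet_num_le t ltac:(lra)).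
  assert (0 < t ^ 2) by nra. assert (0 < t ^ 2 * (exp t - 1)) by (apply Rmult_lt_0_compat; assumption).
  apply Rle_div_l; [nra|]. nra.
Qed.

(** Serves twice: it makes the kernel positive, and with [binet_kernel_le] it squeezes the kernel to
    its limit 1/12 at 0. *)
Lemma binet_kernel_ge (t : R) : 0 < t -> exp (- t) / 12 <= binet_kernel t.
Proof.
  intros H. pose proof (exp_gt_1 t H). rewrite binet_kernel_eq by exact H.
  pose proof (binet_num_ge t ltac:(lra)).
  assert (0 < t ^ 2) by nra. assert (0 < t ^ 2 * (exp t - 1)) by (apply Rmult_lt_0_compat; assumption).
  apply (Rle_div_r (exp (- t) / 12)); [nra|].
  assert (exp (- t) * (exp t - 1) <= t).
  { rewrite Rmult_minus_distr_l, <- exp_plus, Rplus_opp_l, exp_0.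
    pose proof (exp_ineq1_le (- t)). lra. }
  assert (t ^ 2 * (exp (- t) * (exp t - 1)) <= t ^ 3) by nra.
  replace (exp (- t) / 12 * (2 * t ^ 2 * (exp t - 1)))
    with (t ^ 2 * (exp (- t) * (exp t - 1)) / 6) by field. lra.
Qed.

Lemma binet_kernel_pos (t : R) : 0 < t -> 0 < binet_kernel t.
Proof. intros H. pose proof (binet_kernel_ge t H). pose proof (exp_pos (- t)). lra. Qed.

Definition binet_kernel' (t : R) : R :=
  (- (t * (exp t - exp (- t)) / 2 + t ^ 2 - 4 * ((exp t + exp (- t)) / 2) + 4))
    * (exp t / (t ^ 3 * (exp t - 1) ^ 2)).

Lemma binet_kernel_derive (t : R) : 0 < t -> is_derive binet_kernel t (binet_kernel' t).
Proof.
  intros H. pose proof (exp_gt_1 t H). unfold binet_kernel, binet_kernel'.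
  auto_derive; [repeat split; lra|].
  rewrite exp_Ropp. field. pose proof (exp_pos t). repeat split; lra.
Qed.

Lemma binet_kernel'_le (t : R) : 0 < t -> binet_kernel' t <= 0.
Proof.
  intros H. pose proof (sinh_cosh_ineq t ltac:(lra)). pose proof (exp_gt_1 t H).
  unfold binet_kernel'. rewrite Ropp_mult_distr_l_reverse.
  assert (0 <= exp t / (t ^ 3 * (exp t - 1) ^ 2)).
  { apply Rdiv_le_0_compat; [left; apply exp_pos|]. apply Rmult_lt_0_compat; apply pow_lt; lra. }
  nra.
Qed.

Lemma binet_kernel'_continuous (t : R) : 0 < t -> continuous binet_kernel' t.
Proof.
  intros H. pose proof (exp_gt_1 t H).
  apply (ex_derive_continuous (V := R_NormedModule)). unfold binet_kernel'.
  auto_derive. repeat split. apply Rgt_not_eq.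
  apply Rmult_lt_0_compat; [|apply Rmult_lt_0_compat]; try nra; pose proof (Rmult_lt_0_compat _ _ H H); nra.
Qed.

(** * Binet's integral on the imaginary axis *)

(** The exchange of two limits (Moore and Osgood). The approximation by [h n] makes [f] Cauchy along
    [F], so that the existence of its limit is a conclusion; this is how conditionally convergent
    improper integrals are obtained. *)
Lemma Ctends_approx {T : Type} (F : (T -> Prop) -> Prop) {FF : ProperFilter F}
  (f : T -> C) (h : nat -> T -> C) (L : nat -> C) (e : nat -> R) :
  (forall n, F (fun t => Cmod (f t - h n t) <= e n)) -> (forall n, Ctends (h n) F (L n)) ->
  is_lim_seq e 0 ->
  exists l, Ctends f F l /\ forall n, Cmod (l - L n) <= e n.
Proof.
  intros Hf Hh He.
  assert (HC : exists l, Ctends f F l).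
  { assert (Hc : forall eps : posreal, exists P, F P /\ forall u v, P u -> P v -> Cmod (f u - f v) < eps).
    { intros eps.
      assert (H4 : 0 < eps / 4) by (destruct eps; simpl; lra).
      destruct (proj1 (filterlim_locally e 0) He (mkposreal _ H4)) as [n Hn].
      specialize (Hn n (Nat.le_refl n)). change (Rabs (e n - 0) < eps / 4) in Hn.
      pose proof (Rle_abs (e n - 0)).
      pose proof (proj1 (filterlim_locally (F := F) _ 0) (Ctends_Cmod F _ _ (Hh n)) (mkposreal _ H4)) as H1.
      eexists; split; [exact (filter_and _ _ (Hf n) H1)|].
      intros u v [A1 B1] [A2 B2].
      change (Rabs (Cmod (h n u - L n) - 0) < eps / 4) in B1.
      change (Rabs (Cmod (h n v - L n) - 0) < eps / 4) in B2.
      rewrite Rminus_0_r, Rabs_pos_eq in B1, B2 by apply Cmod_ge_0.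
      replace (f u - f v)%C with (((f u - h n u) + (h n u - L n)) - ((f v - h n v) + (h n v - L n)))%C by ring.
      eapply Rle_lt_trans; [apply Cmod_triangle|]. rewrite Cmod_opp.
      pose proof (Cmod_triangle (f u - h n u) (h n u - L n)).
      pose proof (Cmod_triangle (f v - h n v) (h n v - L n)).
      lra. }
    assert (HR : exists a, filterlim (fun t => Re (f t)) F (locally (a : R_CompleteNormedModule))).
    { apply (filterlim_locally_cauchy (U := R_CompleteNormedModule)). intros eps. destruct (Hc eps) as [P [HP HQ]].
      exists P; split; [exact HP|]. intros u v Hu Hv.
      eapply Rle_lt_trans; [|exact (HQ v u Hv Hu)]. apply (re_le_Cmod (f v - f u)). }
    assert (HI : exists a, filterlim (fun t => Im (f t)) F (locally (a : R_CompleteNormedModule))).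
    { apply (filterlim_locally_cauchy (U := R_CompleteNormedModule)). intros eps. destruct (Hc eps) as [P [HP HQ]].
      exists P; split; [exact HP|]. intros u v Hu Hv.
      eapply Rle_lt_trans; [|exact (HQ v u Hv Hu)]. apply (im_le_Cmod (f v - f u)). }
    destruct HR as [a Ha], HI as [b Hb]. exists (a, b). split; assumption. }
  destruct HC as [l Hl]. exists l; split; [exact Hl|].
  intros n. replace (l - L n)%C with ((l - L n) - RtoC 0)%C by ring.
  apply (Ctends_Cmod_le F (fun t => f t - h n t)%C).
  - apply Ctends_minus; [apply filter_filter | assumption | apply Hh].
  - generalize (Hf n). apply filter_imp. intros t Ht.
    replace (f t - h n t - RtoC 0)%C with (f t - h n t)%C by ring. exact Ht.
Qed.

Lemma continuous_C_intro (f : R -> C) (x : R) :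
  Ctends f (locally x) (f x) -> continuous (U := C_R_NormedModule) f x.
Proof. intros H. apply Ctends_filterlim; [apply locally_filter | exact H]. Qed.

Lemma Ctends_of_derive (f : R -> C) (x : R) (l : C) : is_derive_C f x l -> Ctends f (locally x) (f x).
Proof.
  intros H; split.
  - apply (ex_derive_continuous (V := R_NormedModule)). eexists; apply (is_derive_Re _ _ _ H).
  - apply (ex_derive_continuous (V := R_NormedModule)). eexists; apply (is_derive_Im _ _ _ H).
Qed.

Lemma is_derive_Cexp_lin (c : C) (x : R) :
  is_derive_C (fun t => Cexp (c * RtoC t)) x (c * Cexp (c * RtoC x))%C.
Proof.
  apply is_derive_Cexp. eapply is_derive_C_eq.
  - apply is_derive_C_mult; [apply is_derive_C_const|]. apply is_derive_C_RtoC, (is_derive_id (K := R_AbsRing)).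
  - change (RtoC (@one R_AbsRing)) with (RtoC 1). cbv beta. ring.
Qed.

Lemma ex_RInt_C_continuous (f : R -> C) (a b : R) :
  (forall t, Rmin a b <= t <= Rmax a b -> Ctends f (locally t) (f t)) -> exists l, is_RInt_C f a b l.
Proof.
  intros H. apply (ex_RInt_continuous (V := C_R_CompleteNormedModule)).
  intros t Ht. apply continuous_C_intro, H, Ht.
Qed.

(** The kernel continued by its limit 1/12. The constant on the negative axis gives two-sided
    continuity at 0, which the integrability criterion on [0, T] asks for. *)
Definition binet_kernel_ext (t : R) : R := if Rle_dec t 0 then / 12 else binet_kernel t.

Lemma binet_kernel_ext_eq (t : R) : 0 < t -> binet_kernel_ext t = binet_kernel t.
Proof. intros H; unfold binet_kernel_ext. destruct (Rle_dec t 0); [lra | reflexivity]. Qed.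

Lemma binet_kernel_ext_continuous (t : R) : 0 <= t -> continuous binet_kernel_ext t.
Proof.
  intros [Ht| <-].
  - apply (continuous_ext_loc _ binet_kernel).
    + exists (mkposreal t Ht). intros y Hy. symmetry; apply binet_kernel_ext_eq.
      change (Rabs (y - t) < t) in Hy. apply Rabs_def2 in Hy. lra.
    + apply (ex_derive_continuous (V := R_NormedModule)). eexists; apply binet_kernel_derive, Ht.
  - assert (E : binet_kernel_ext 0 = / 12) by (unfold binet_kernel_ext; destruct (Rle_dec 0 0); [reflexivity|lra]).
    unfold continuous. rewrite E.
    apply (filterlim_R_of_abs _ _ (fun t => Rabs (1 - exp (- t)) / 12)).
    + apply filter_forall. intros t.
      destruct (Rlt_dec 0 t) as [H|H].
      * rewrite binet_kernel_ext_eq by exact H.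
        pose proof (binet_kernel_ge t H). pose proof (binet_kernel_le t H).
        rewrite Rabs_left1 by lra. pose proof (Rle_abs (1 - exp (- t))). lra.
      * unfold binet_kernel_ext. destruct (Rle_dec t 0); [|lra].
        rewrite Rminus_diag, Rabs_R0. pose proof (Rabs_pos (1 - exp (- t))). lra.
    + assert (E0 : Rabs (1 - exp (- 0)) * / 12 = 0) by (rewrite Ropp_0, exp_0, Rminus_diag, Rabs_R0; ring).
      enough (H : filterlim (fun t => Rabs (1 - exp (- t)) / 12) (locally 0) (locally (Rabs (1 - exp (- 0)) * / 12)))
        by (rewrite E0 in H; exact H).
      apply Rlim_mult; [apply locally_filter| |apply filterlim_const].
      apply (Rlim_comp _ Rabs (fun t => 1 - exp (- t))); [|apply (continuous_abs (K := R_AbsRing))].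
      apply (ex_derive_continuous (V := R_NormedModule) (fun t => 1 - exp (- t))). auto_derive. auto.
Qed.

Definition mu_integrand (s tau t : R) : C := (Cexp (- (Cpair s tau) * RtoC t) * RtoC (binet_kernel t))%C.

Lemma mu_integrand_ex (s tau T : R) : 0 <= T -> exists l, is_RInt_C (mu_integrand s tau) 0 T l.
Proof.
  intros HT.
  destruct (ex_RInt_C_continuous (fun t => Cexp (- (Cpair s tau) * RtoC t) * RtoC (binet_kernel_ext t))%C 0 T) as [l Hl].
  - intros t Ht. rewrite Rmin_left in Ht by lra.
    apply (Ctends_mult (locally t)).
    + eapply Ctends_of_derive, is_derive_Cexp_lin.
    + apply (Ctends_RtoC (locally t)). apply binet_kernel_ext_continuous. lra.
  - exists l. apply (is_RInt_ext (V := C_R_NormedModule)) with (2 := Hl).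
    intros t Ht. rewrite Rmin_left in Ht by lra. unfold mu_integrand. rewrite binet_kernel_ext_eq by lra. reflexivity.
Qed.

Lemma Cmod_mu_integrand (s tau t : R) : 0 < t -> Cmod (mu_integrand s tau t) <= exp (- s * t) / 12.
Proof.
  intros Ht. unfold mu_integrand. rewrite Cmod_mult, Cmod_Cexp, Cmod_R.
  pose proof (binet_kernel_pos t Ht). pose proof (binet_kernel_le t Ht).
  rewrite Rabs_pos_eq by lra. simpl. replace (- s * t - - tau * 0) with (- s * t) by ring.
  pose proof (exp_pos (- s * t)). nra.
Qed.

Lemma Cmod_mu_RInt (s tau T b : R) (l : C) : 0 <= T ->
  is_RInt (fun t => exp (- s * t) / 12) 0 T b ->
  is_RInt_C (mu_integrand s tau) 0 T l -> Cmod l <= b.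
Proof.
  intros HT Hb Hl.
  (* The bound on the integrand is available for t > 0 only, so its value at 0 is replaced by 0,
     which leaves the integral unchanged. *)
  apply (Cmod_RInt_le (fun t => if Rlt_dec 0 t then mu_integrand s tau t else RtoC 0)
    (fun t => exp (- s * t) / 12) 0 T); [exact HT| | |exact Hb].
  - intros t Ht. destruct (Rlt_dec 0 t) as [H|H]; [apply Cmod_mu_integrand, H|].
    rewrite Cmod_0. pose proof (exp_pos (- s * t)). lra.
  - apply (is_RInt_ext (V := C_R_NormedModule)) with (2 := Hl).
    intros t Ht. rewrite Rmin_left in Ht by lra. destruct (Rlt_dec 0 t); [reflexivity|lra].
Qed.

(** For s > 0 the factor e^(-st) gives a bound uniform in T. With s = n + 1 it is the error left by
    n + 1 telescoping steps in [mu_exists]. *)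
Lemma Cmod_mu_shifted (s tau T : R) (l : C) : 0 < s -> 0 <= T ->
  is_RInt_C (mu_integrand s tau) 0 T l -> Cmod l <= / (12 * s).
Proof.
  intros Hs HT Hl.
  eapply Rle_trans; [apply (Cmod_mu_RInt s tau T _ l HT)|]; [|exact Hl|].
  - apply (is_RInt_derive (V := R_CompleteNormedModule) (fun t => - exp (- s * t) / (12 * s))).
    + intros t _. auto_derive; [auto|field; lra].
    + intros t _. apply (ex_derive_continuous (V := R_NormedModule)). auto_derive. auto.
  - unfold minus, plus, opp; simpl. rewrite Rmult_0_r, exp_0.
    pose proof (exp_pos (- s * T)).
    assert (0 < / (12 * s)) by (apply Rinv_0_lt_compat; lra).
    unfold Rdiv. nra.
Qed.

Lemma pair_neq_0 (s tau : R) : 0 < tau -> (Cpair s tau) <> RtoC 0.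
Proof. intros H E. injection E. lra. Qed.

Lemma Cmod_pair_ge (s tau : R) : 0 < tau -> tau <= Cmod (Cpair s tau).
Proof.
  intros H. eapply Rle_trans; [|apply (im_le_Cmod (Cpair s tau))]. simpl. apply Rle_abs.
Qed.

(** Here |e^(-zt)| = 1, so decay must come from oscillation. Integration by parts on [eps, T] bounds
    tau times the modulus of the integral by the boundary terms g(eps) + g(T) plus the variation
    g(eps) - g(T) of the decreasing kernel, that is by 2 g(eps) <= 1/6. The piece [0, eps], kept
    apart because g is singular as written at 0, costs at most eps / 12. *)
Lemma Cmod_mu (tau T : R) (l : C) : 0 < tau -> 0 < T ->
  is_RInt_C (mu_integrand 0 tau) 0 T l -> Cmod l <= / (6 * tau).
Proof.
  intros Htau HT Hl.
  assert (H : forall eps, 0 < eps < T -> Cmod l <= eps / 12 + / (6 * tau)).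
  { intros eps Heps.
    destruct (mu_integrand_ex 0 tau eps ltac:(lra)) as [l1 H1].
    assert (B1 : Cmod l1 <= eps / 12).
    { apply (Cmod_mu_RInt 0 tau eps _ l1 ltac:(lra)) with (2 := H1).
      apply (is_RInt_ext (V := R_NormedModule) (fun _ => / 12)).
      - intros t _. replace (- 0 * t) with 0 by ring. rewrite exp_0. change (/ 12 = 1 / 12). field.
      - replace (eps / 12) with ((eps - 0) * / 12) by field.
        exact (is_RInt_const (V := R_NormedModule) 0 eps (/ 12)). }
    assert (H2 : is_RInt_C (mu_integrand 0 tau) eps T (l - l1)%C).
    { replace (l - l1)%C with (- l1 + l)%C by ring.
      apply (is_RInt_Chasles (V := C_R_NormedModule)) with 0; [|exact Hl].
      apply (is_RInt_swap (V := C_R_NormedModule)). exact H1. }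
    set (z := (Cpair 0 tau)).
    assert (HP : forall t, Rmin eps T <= t <= Rmax eps T -> 0 < t)
      by (intros t Ht; rewrite Rmin_left in Ht by lra; lra).
    assert (H3 : is_RInt_C (fun t => - z * Cexp (- z * RtoC t) * RtoC (binet_kernel t)
       + Cexp (- z * RtoC t) * RtoC (binet_kernel' t))%C eps T
       (Cexp (- z * RtoC T) * RtoC (binet_kernel T) - Cexp (- z * RtoC eps) * RtoC (binet_kernel eps))%C).
    { apply (is_RInt_C_derive (fun t => Cexp (- z * RtoC t) * RtoC (binet_kernel t))%C); intros t Ht; apply HP in Ht.
      - apply (is_derive_C_mult (fun t => Cexp (- z * RtoC t)) (fun t => RtoC (binet_kernel t)) t).
        + apply is_derive_Cexp_lin.
        + apply is_derive_C_RtoC, binet_kernel_derive, Ht.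
      - pose proof (Ctends_of_derive _ _ _ (is_derive_Cexp_lin (- z) t)) as Hc.
        apply continuous_C_intro.
        apply (Ctends_plus (locally t) (fun t => - z * Cexp (- z * RtoC t) * RtoC (binet_kernel t))%C).
        + apply (Ctends_mult (locally t) (fun t => - z * Cexp (- z * RtoC t))%C).
          * apply (Ctends_mult (locally t) (fun t => - z)%C); [apply (Ctends_const (locally t))|exact Hc].
          * apply (Ctends_RtoC (locally t)), (ex_derive_continuous (V := R_NormedModule)).
            eexists; apply binet_kernel_derive, Ht.
        + apply (Ctends_mult (locally t) (fun t => Cexp (- z * RtoC t))%C); [exact Hc|].
          apply (Ctends_RtoC (locally t)), binet_kernel'_continuous, Ht. }
    pose proof (is_RInt_C_mult z _ _ _ _ H2) as H4.
    pose proof (is_RInt_C_plus _ _ _ _ _ _ H3 H4) as H5.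
    assert (B2 : Cmod ((Cexp (- z * RtoC T) * RtoC (binet_kernel T) - Cexp (- z * RtoC eps) * RtoC (binet_kernel eps)) + z * (l - l1)) <= binet_kernel eps - binet_kernel T).
    { apply (Cmod_RInt_le (fun t => Cexp (- z * RtoC t) * RtoC (binet_kernel' t))%C (fun t => - binet_kernel' t) eps T); [lra| | | ].
      - intros t Ht. pose proof (binet_kernel'_le t ltac:(lra)).
        rewrite Cmod_mult, Cmod_Cexp, Cmod_R, Rabs_left1 by assumption. simpl.
        replace (- 0 * t - - tau * 0) with 0 by ring. rewrite exp_0. lra.
      - apply is_RInt_C_ext with (3 := H5); [lra|].
        intros t _. unfold mu_integrand. fold z. ring.
      - replace (binet_kernel eps - binet_kernel T) with (opp (minus (binet_kernel T) (binet_kernel eps)))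
          by (unfold minus, plus, opp; simpl; ring).
        apply (is_RInt_opp (V := R_NormedModule)).
        apply (is_RInt_derive (V := R_CompleteNormedModule)); intros t Ht; apply HP in Ht.
        + apply binet_kernel_derive, Ht.
        + apply binet_kernel'_continuous, Ht. }
    assert (Ez : forall t, Cmod (Cexp (- z * RtoC t)) = 1).
    { intros t. rewrite Cmod_Cexp. unfold z; simpl. replace (- 0 * t - - tau * 0) with 0 by ring. apply exp_0. }
    assert (B3 : tau * Cmod (l - l1) <= 2 * binet_kernel eps).
    { replace tau with (Cmod z).
      2:{ unfold z, Cmod; simpl. replace (0 * (0 * 1) + tau * (tau * 1)) with (tau ^ 2) by ring. apply sqrt_pow2; lra. }
      rewrite <- Cmod_mult.
      set (A := (Cexp (- z * RtoC T) * RtoC (binet_kernel T))%C) in *.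
      set (B := (Cexp (- z * RtoC eps) * RtoC (binet_kernel eps))%C) in *.
      assert (CA : Cmod A = binet_kernel T).
      { unfold A. rewrite Cmod_mult, Ez, Cmod_R, Rabs_pos_eq by (left; apply binet_kernel_pos; lra). ring. }
      assert (CB : Cmod B = binet_kernel eps).
      { unfold B. rewrite Cmod_mult, Ez, Cmod_R, Rabs_pos_eq by (left; apply binet_kernel_pos; lra). ring. }
      replace (z * (l - l1))%C with ((A - B + z * (l - l1)) + (B - A))%C by ring.
      eapply Rle_trans; [apply Cmod_triangle|].
      pose proof (Cmod_triangle B (- A)). rewrite Cmod_opp in H. unfold Cminus at 3. lra. }
    pose proof (binet_kernel_le eps ltac:(lra)).
    replace l with (l1 + (l - l1))%C by ring. eapply Rle_trans; [apply Cmod_triangle|].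
    apply Rplus_le_compat; [exact B1|].
    apply Rmult_le_reg_l with tau; [exact Htau|]. replace (tau * / (6 * tau)) with (/ 6) by (field; lra). lra. }
  apply le_epsilon. intros eps Heps.
  specialize (H (Rmin eps (T / 2))).
  assert (0 < Rmin eps (T / 2) <= T / 2) by (split; [apply Rmin_glb_lt; lra | apply Rmin_r]).
  pose proof (Rmin_l eps (T / 2)). specialize (H ltac:(lra)). lra.
Qed.

(** * The difference of Binet's integrals at w and w + 1 *)

Lemma binet_kernel_int (t : R) : 0 < t ->
  is_RInt (fun u => (1 / 2 - u) * exp (- u * t)) 0 1 ((1 - exp (- t)) * binet_kernel t).
Proof.
  intros Ht.
  pose proof (is_RInt_R_derive (fun u => - (1 / 2 - u) * exp (- u * t) / t + exp (- u * t) / t ^ 2)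
     (fun u => (1 / 2 - u) * exp (- u * t)) 0 1 ltac:(lra)) as H.
  replace ((1 - exp (- t)) * binet_kernel t) with
    ((- (1 / 2 - 1) * exp (- (1) * t) / t + exp (- (1) * t) / t ^ 2) -
     (- (1 / 2 - 0) * exp (- 0 * t) / t + exp (- 0 * t) / t ^ 2)).
  - apply H.
    + intros u _. auto_derive; [auto|]. field. lra.
    + intros u _. apply (ex_derive_continuous (V := R_NormedModule)). auto_derive. auto.
  - rewrite binet_kernel_eq by exact Ht. replace (- (1) * t) with (- t) by ring.
    replace (- 0 * t) with 0 by ring. rewrite exp_0, exp_Ropp.
    pose proof (exp_gt_1 t Ht). pose proof (exp_pos t). field. lra.
Qed.

Definition mu_diff_kernel (s tau t u : R) : C :=
  (RtoC (1 / 2 - u) * Cexp (- (Cpair (s + u) tau) * RtoC t))%C.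

Lemma mu_diff_kernel_int (s tau t : R) : 0 <= t ->
  is_RInt_C (mu_diff_kernel s tau t) 0 1
    (Cexp (- (Cpair s tau) * RtoC t) * RtoC ((1 - exp (- t)) * binet_kernel_ext t))%C.
Proof.
  intros Ht.
  assert (H : is_RInt (fun u => (1 / 2 - u) * exp (- u * t)) 0 1 ((1 - exp (- t)) * binet_kernel_ext t)).
  { destruct Ht as [Ht|<-].
    - rewrite binet_kernel_ext_eq by exact Ht. apply binet_kernel_int, Ht.
    - rewrite Ropp_0, exp_0. replace ((1 - 1) * binet_kernel_ext 0) with ((1 / 2 * 1 - 1 ^ 2 / 2) - (1 / 2 * 0 - 0 ^ 2 / 2)) by field.
      apply (is_RInt_R_derive (fun u => 1 / 2 * u - u ^ 2 / 2)); [lra| |].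
      + intros u _. auto_derive; [auto|]. rewrite Rmult_0_r, exp_0. field.
      + intros u _. apply (ex_derive_continuous (V := R_NormedModule)). auto_derive. auto. }
  assert (HC : is_RInt_C (fun u => RtoC ((1 / 2 - u) * exp (- u * t))) 0 1 (RtoC ((1 - exp (- t)) * binet_kernel_ext t))).
  { apply is_RInt_C_intro; simpl; [exact H|].
    pose proof (is_RInt_const (V := R_NormedModule) 0 1 0) as H0.
    change (is_RInt (fun _ => 0) 0 1 ((1 - 0) * 0)) in H0. rewrite Rmult_0_r in H0. exact H0. }
  apply (is_RInt_C_mult (Cexp (- (Cpair s tau) * RtoC t))) in HC.
  apply is_RInt_C_ext with (3 := HC); [lra|].
  intros u _. unfold mu_diff_kernel.
  replace (- (Cpair (s + u) tau) * RtoC t)%C with (- (Cpair s tau) * RtoC t + RtoC (- u * t))%C by (apply C_eq; simpl; ring).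
  rewrite Cexp_plus, Cexp_RtoC, RtoC_mult. ring.
Qed.

(** The integral of [mu_diff_kernel s tau t u] over t in [0, T], in closed form. *)
Definition mu_diff_prim (s tau T u : R) : C :=
  (RtoC (1 / 2 - u) * (RtoC 1 - Cexp (- (Cpair (s + u) tau) * RtoC T)) * / (Cpair (s + u) tau))%C.

Lemma Ctends_pair_shift {T : Type} (F : (T -> Prop) -> Prop) {FF : Filter F} (h : T -> R) (s tau a : R) :
  filterlim h F (locally a) -> Ctends (fun t => (Cpair (s + h t) tau)) F (Cpair (s + a) tau).
Proof. intros H; split; simpl; [apply Rlim_plus; [assumption|apply filterlim_const|exact H] | apply filterlim_const]. Qed.

(** Both sides vanish at T = 0 and have the same derivative in T, namely the integral over u of
    [mu_diff_kernel], which is the difference of the two integrands of mu. *)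
Lemma mu_diff_RInt (s tau T : R) (l1 l2 : C) : 0 < tau -> 0 <= T ->
  is_RInt_C (mu_integrand s tau) 0 T l1 -> is_RInt_C (mu_integrand (s + 1) tau) 0 T l2 ->
  is_RInt_C (mu_diff_prim s tau T) 0 1 (l1 - l2)%C.
Proof.
  intros Htau HT H1 H2.
  destruct (is_derive_RInt_param_C (mu_diff_prim s tau) (mu_diff_kernel s tau) 0 1) as [B [HB1 HB2]].
  - intros t u. unfold mu_diff_prim, mu_diff_kernel.
    pose proof (pair_neq_0 (s + u) tau Htau) as Hn.
    eapply is_derive_C_eq.
    + apply (is_derive_C_mult (fun t => RtoC (1 / 2 - u) * (RtoC 1 - Cexp (- (Cpair (s + u) tau) * RtoC t)))%C (fun _ => / (Cpair (s + u) tau))%C).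
      * apply (is_derive_C_mult (fun _ => RtoC (1 / 2 - u))); [apply is_derive_C_const|].
        apply (is_derive_C_minus (fun _ => RtoC 1)); [apply is_derive_C_const | apply is_derive_Cexp_lin].
      * apply is_derive_C_const.
    + field. exact Hn.
  - intros t u. unfold mu_diff_kernel.
    assert (H_u : filterlim (fun z : R * R => snd z) (locally (t, u)) (locally u)) by apply continuous_snd.
    assert (H_t : filterlim (fun z : R * R => fst z) (locally (t, u)) (locally t)) by apply continuous_fst.
    apply (Ctends_mult (locally (t, u)) (fun z => RtoC (1 / 2 - snd z))).
    + apply (Ctends_RtoC (locally (t, u))). apply (Rlim_minus (locally (t, u)) (fun _ => 1 / 2)); [apply filterlim_const|exact H_u].
    + apply (Ctends_Cexp (locally (t, u)) (fun z => - (Cpair (s + snd z) tau) * RtoC (fst z))%C).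
      apply (Ctends_mult (locally (t, u))).
      * apply (Ctends_opp (locally (t, u))). apply (Ctends_pair_shift (locally (t, u)) (fun z => snd z)). exact H_u.
      * apply (Ctends_RtoC (locally (t, u))). exact H_t.
  - intros t u. unfold mu_diff_prim.
    assert (H_u : filterlim (fun v : R => v) (locally u) (locally u)) by apply filterlim_id.
    pose proof (Ctends_pair_shift (locally u) (fun v => v) s tau u H_u) as Hp.
    apply (Ctends_mult (locally u) (fun v => RtoC (1 / 2 - v) * (RtoC 1 - Cexp (- (Cpair (s + v) tau) * RtoC t)))%C (fun v => / (Cpair (s + v) tau))%C).
    + apply (Ctends_mult (locally u) (fun v => RtoC (1 / 2 - v))).
      * apply (Ctends_RtoC (locally u)). apply (Rlim_minus (locally u) (fun _ => 1 / 2)); [apply filterlim_const|exact H_u].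
      * apply (Ctends_minus (locally u) (fun _ => RtoC 1)); [apply (Ctends_const (locally u))|].
        apply (Ctends_Cexp (locally u) (fun v => - (Cpair (s + v) tau) * RtoC t)%C).
        apply (Ctends_mult (locally u) (fun v => - (Cpair (s + v) tau))%C); [apply (Ctends_opp (locally u)); exact Hp|].
        apply (Ctends_const (locally u)).
    + apply (Ctends_inv (locally u)); [apply pair_neq_0, Htau | exact Hp].
  - assert (E : is_RInt_C (fun t => Cexp (- (Cpair s tau) * RtoC t) * RtoC ((1 - exp (- t)) * binet_kernel_ext t))%C 0 T (B T - B 0)%C).
    { apply (is_RInt_C_derive B); intros t Ht; rewrite Rmin_left in Ht by exact HT.
      - apply HB2, mu_diff_kernel_int. lra.
      - apply continuous_C_intro. apply (Ctends_mult (locally t) (fun t => Cexp (- (Cpair s tau) * RtoC t))).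
        + eapply Ctends_of_derive, is_derive_Cexp_lin.
        + apply (Ctends_RtoC (locally t)). apply (Rlim_mult (locally t)).
          * apply (ex_derive_continuous (V := R_NormedModule) (fun t => 1 - exp (- t))). auto_derive. auto.
          * apply binet_kernel_ext_continuous. lra. }
    assert (B0 : B 0 = RtoC 0).
    { apply (RInt_C_unique (mu_diff_prim s tau 0) 0 1); [apply HB1|].
      apply is_RInt_C_ext with (f := fun _ => RtoC 0); [lra| |].
      - intros u _. unfold mu_diff_prim. replace (- (Cpair (s + u) tau) * RtoC 0)%C with (RtoC 0) by ring. rewrite Cexp_0. ring.
      - pose proof (is_RInt_const (V := C_R_NormedModule) 0 1 (RtoC 0)) as H0.
        rewrite scal_R_Cmult, Cmult_0_r in H0. exact H0. }
    replace (l1 - l2)%C with (B T); [apply HB1|].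
    rewrite B0 in E. replace (B T) with (B T - RtoC 0)%C by ring.
    apply (RInt_C_unique _ _ _ _ _ E).
    pose proof (is_RInt_C_minus _ _ _ _ _ _ H1 H2) as H3.
    apply is_RInt_C_ext with (3 := H3); [exact HT|].
    intros t Ht. unfold mu_integrand. rewrite binet_kernel_ext_eq by lra.
    replace (- (Cpair (s + 1) tau) * RtoC t)%C with (- (Cpair s tau) * RtoC t + RtoC (- t))%C by (apply C_eq; simpl; ring).
    rewrite Cexp_plus, Cexp_RtoC, RtoC_mult, RtoC_minus. ring.
Qed.

(* [log (s + i tau)] for [0 < tau]: [PI / 2 - atan (s / tau)] is the argument. *)
Definition Clog (s tau : R) : C := (/ 2 * ln (s ^ 2 + tau ^ 2), PI / 2 - atan (s / tau)).

Lemma Clog_derive (s tau : R) : 0 < tau -> is_derive_C (fun s => Clog s tau) s (/ (Cpair s tau))%C.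
Proof.
  intros Htau. assert (0 < s * (s * 1) + tau * (tau * 1)) by nra. apply is_derive_C_intro; unfold Clog; simpl.
  - auto_derive; [exact H|]. field. lra.
  - auto_derive; [exact I|]. field. split; nra.
Qed.

Lemma Cexp_Clog (s tau : R) : 0 < tau -> Cexp (Clog s tau) = (Cpair s tau).
Proof.
  intros Htau. unfold Cexp, Clog, Cpair, Re, Im; cbv beta iota delta [fst snd].
  assert (H : 0 < s ^ 2 + tau ^ 2) by nra.
  rewrite cos_shift, sin_shift, cos_atan, sin_atan.
  replace (exp (/ 2 * ln (s ^ 2 + tau ^ 2))) with (sqrt (s ^ 2 + tau ^ 2)).
  2:{ rewrite <- Rpower_sqrt by exact H. unfold Rpower. reflexivity. }
  assert (E : sqrt (s ^ 2 + tau ^ 2) = tau * sqrt (1 + (s / tau)²)).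
  { rewrite <- (sqrt_pow2 tau) at 2 by lra. rewrite <- sqrt_mult; [|nra|pose proof (Rle_0_sqr (s / tau)); lra].
    f_equal. unfold Rsqr. field. lra. }
  rewrite E.
  assert (0 < sqrt (1 + (s / tau)²)) by (apply sqrt_lt_R0; pose proof (Rle_0_sqr (s / tau)); lra).
  f_equal; field; lra.
Qed.

Definition mu_diff (s tau : R) : C :=
  ((Cpair (s + / 2) tau) * (Clog (s + 1) tau - Clog s tau) - RtoC 1)%C.

(** With w = s + i tau, (1/2 - u) / (w + u) = (w + 1/2) / (w + u) - 1 has an elementary
    antiderivative. *)
Lemma mu_diff_int (s tau : R) : 0 < tau ->
  is_RInt_C (fun u => RtoC (1 / 2 - u) * / (Cpair (s + u) tau))%C 0 1 (mu_diff s tau).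
Proof.
  intros Htau.
  pose proof (is_RInt_C_derive (fun u => (Cpair (s + / 2) tau) * Clog (s + u) tau - RtoC u)%C
    (fun u => RtoC (1 / 2 - u) * / (Cpair (s + u) tau))%C 0 1) as H.
  unfold mu_diff. replace (_ - RtoC 1)%C with
    (((Cpair (s + / 2) tau) * Clog (s + 1) tau - RtoC 1) - ((Cpair (s + / 2) tau) * Clog (s + 0) tau - RtoC 0))%C
    by (rewrite Rplus_0_r; ring).
  apply H; clear H.
  - intros u _. eapply is_derive_C_eq.
    + apply (is_derive_C_minus (fun u => (Cpair (s + / 2) tau) * Clog (s + u) tau)%C RtoC).
      * apply (is_derive_C_mult (fun _ => (Cpair (s + / 2) tau))); [apply is_derive_C_const|].
        apply (is_derive_C_comp (fun s => Clog s tau) (fun u => s + u)); [apply Clog_derive, Htau|].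
        auto_derive; [auto|reflexivity].
      * apply (is_derive_C_RtoC (fun u => u)). apply (is_derive_id (K := R_AbsRing)).
    + change (RtoC (@one R_AbsRing)) with (RtoC 1). pose proof (pair_neq_0 (s + u) tau Htau).
      replace (Cpair (s + / 2) tau) with ((Cpair (s + u) tau) + RtoC (1 / 2 - u))%C by (apply C_eq; simpl; field).
      rewrite ?Rmult_1_r. field. exact H.
  - intros u _. apply continuous_C_intro.
    assert (H_u : filterlim (fun v : R => v) (locally u) (locally u)) by apply filterlim_id.
    apply (Ctends_mult (locally u) (fun v => RtoC (1 / 2 - v)) (fun v => / (Cpair (s + v) tau))%C).
    + apply (Ctends_RtoC (locally u)). apply (Rlim_minus (locally u) (fun _ => 1 / 2)); [apply filterlim_const|exact H_u].
    + apply (Ctends_inv (locally u)); [apply pair_neq_0, Htau|].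
      apply (Ctends_pair_shift (locally u) (fun v => v) s tau u H_u).
Qed.

(** The error is the integral of (1/2 - u) e^(-(w + u) T) / (w + u) over u. At s = 0 and u = 0 the
    exponential does not decay in T, but e^(-uT) integrated over u still gains the factor 1 / T;
    this is what admits s = 0. *)
Lemma mu_diff_approx (s tau T : R) (l1 l2 : C) : 0 <= s -> 0 < tau -> 0 < T ->
  is_RInt_C (mu_integrand s tau) 0 T l1 -> is_RInt_C (mu_integrand (s + 1) tau) 0 T l2 ->
  Cmod (l1 - l2 - mu_diff s tau) <= / (2 * tau * T).
Proof.
  intros Hs Htau HT H1 H2.
  pose proof (mu_diff_RInt s tau T l1 l2 Htau ltac:(lra) H1 H2) as H3.
  pose proof (is_RInt_C_minus _ _ _ _ _ _ H3 (mu_diff_int s tau Htau)) as H4.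
  eapply Rle_trans; [apply (Cmod_RInt_le _ (fun u => exp (- u * T) / (2 * tau)) 0 1 _ (- exp (- 1 * T) / (2 * tau * T) - - exp (- 0 * T) / (2 * tau * T)) ltac:(lra) ) with (2 := H4)|].
  - intros u Hu. unfold mu_diff_prim.
    replace (_ - _)%C with (- (RtoC (1 / 2 - u) * (Cexp (- (Cpair (s + u) tau) * RtoC T) * / (Cpair (s + u) tau))))%C by ring.
    rewrite Cmod_opp, !Cmod_mult, Cmod_R, Cmod_Cexp, Cmod_inv by (apply pair_neq_0, Htau). simpl.
    replace (- (s + u) * T - - tau * 0) with (- s * T + - u * T) by ring. rewrite exp_plus.
    pose proof (Cmod_pair_ge (s + u) tau Htau).
    assert (A1 : / Cmod (Cpair (s + u) tau) <= / tau) by (apply Rinv_le_contravar; assumption).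
    assert (A0 : 0 < / Cmod (Cpair (s + u) tau)) by (apply Rinv_0_lt_compat; lra).
    assert (A2 : exp (- s * T) <= 1) by (rewrite <- exp_0; apply exp_le_mono; nra).
    assert (A3 : Rabs (1 / 2 - u) <= / 2) by (apply Rabs_le; lra).
    pose proof (exp_pos (- u * T)). pose proof (exp_pos (- s * T)). pose proof (Rabs_pos (1 / 2 - u)).
    replace (exp (- u * T) / (2 * tau)) with (/ 2 * (1 * exp (- u * T) * / tau)) by (field; lra).
    apply Rmult_le_compat; [assumption| |assumption|].
    + apply Rmult_le_pos; [nra|lra].
    + apply Rmult_le_compat; try nra.
  - apply (is_RInt_R_derive (fun u => - exp (- u * T) / (2 * tau * T))); [lra| |].
    + intros u _. auto_derive; [auto|]. field. lra.
    + intros u _. apply (ex_derive_continuous (V := R_NormedModule)). auto_derive. auto.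
  - replace (- 0 * T) with 0 by ring. rewrite exp_0. pose proof (exp_pos (- 1 * T)).
    assert (0 < / (2 * tau * T)) by (apply Rinv_0_lt_compat; nra). unfold Rdiv. nra.
Qed.

(** * Stirling's formula *)

Definition wallis (n : nat) : R := RInt (fun t => sin t ^ n) 0 (PI / 2).

Lemma wallis_is_RInt (n : nat) : is_RInt (fun t => sin t ^ n) 0 (PI / 2) (wallis n).
Proof.
  apply (RInt_correct (V := R_CompleteNormedModule) (fun t => sin t ^ n)).
  apply (ex_RInt_continuous (V := R_CompleteNormedModule)). intros t _.
  apply (ex_derive_continuous (V := R_NormedModule)). auto_derive. auto.
Qed.

Lemma wallis_rec (n : nat) : INR (n + 2) * wallis (n + 2) = INR (n + 1) * wallis n.
Proof.
  pose proof PI_RGT_0.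
  assert (H1 : is_RInt (fun t => INR (n + 1) * sin t ^ n - INR (n + 2) * sin t ^ (n + 2)) 0 (PI / 2)
     (cos (PI / 2) * sin (PI / 2) ^ (n + 1) - cos 0 * sin 0 ^ (n + 1))).
  { apply (is_RInt_R_derive (fun t => cos t * sin t ^ (n + 1))); [lra| |].
    - intros t _. auto_derive; [auto|].
      replace (Nat.pred (n + 1)) with n by lia.
      rewrite !plus_INR, !pow_add. simpl INR.
      pose proof (sin2_cos2 t) as E. unfold Rsqr in E.
      transitivity ((INR n + 1) * sin t ^ n * (cos t * cos t) - sin t ^ n * (sin t * sin t)); [ring|].
      replace (cos t * cos t) with (1 - sin t * sin t) by lra. ring.
    - intros t _. apply (ex_derive_continuous (V := R_NormedModule)). auto_derive. auto. }
  rewrite cos_PI2, sin_0, Nat.add_1_r, (pow_i (S n)) in H1 by lia. rewrite <- Nat.add_1_r in H1.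
  pose proof (is_RInt_minus (V := R_NormedModule) _ _ _ _ _ _
    (is_RInt_scal (V := R_NormedModule) _ _ _ (INR (n + 1)) _ (wallis_is_RInt n))
    (is_RInt_scal (V := R_NormedModule) _ _ _ (INR (n + 2)) _ (wallis_is_RInt (n + 2)))) as H2.
  pose proof (eq_trans (eq_sym (is_RInt_unique (V := R_CompleteNormedModule) _ _ _ _ H1))
    (is_RInt_unique (V := R_CompleteNormedModule) _ _ _ _ H2)) as E.
  change (0 * sin (PI / 2) ^ (n + 1) - cos 0 * 0 = INR (n + 1) * wallis n - INR (n + 2) * wallis (n + 2)) in E. lra.
Qed.

Lemma wallis_pos (n : nat) : 0 < wallis n.
Proof.
  pose proof PI_RGT_0. unfold wallis. apply (RInt_gt_0 (fun t => sin t ^ n)); [lra| |].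
  - intros t Ht. apply pow_lt, sin_gt_0; lra.
  - intros t _. apply (ex_derive_continuous (V := R_NormedModule)). auto_derive. auto.
Qed.

Lemma wallis_decr (n : nat) : wallis (n + 1) <= wallis n.
Proof.
  pose proof PI_RGT_0. apply (is_RInt_le (fun t => sin t ^ (n + 1)) (fun t => sin t ^ n) 0 (PI / 2)); [lra|apply wallis_is_RInt|apply wallis_is_RInt|].
  intros t Ht. rewrite pow_add, pow_1.
  assert (0 < sin t) by (apply sin_gt_0; lra). pose proof (SIN_bound t).
  pose proof (pow_lt _ n H0). nra.
Qed.

Lemma wallis_0 : wallis 0 = PI / 2.
Proof.
  apply (is_RInt_unique (V := R_CompleteNormedModule)). simpl.
  replace (PI / 2) with ((PI / 2 - 0) * 1) at 2 by ring.
  exact (is_RInt_const (V := R_NormedModule) 0 (PI / 2) 1).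
Qed.

Lemma wallis_1 : wallis 1 = 1.
Proof.
  pose proof PI_RGT_0. apply (is_RInt_unique (V := R_CompleteNormedModule)).
  replace 1 with (- cos (PI / 2) - - cos 0) by (rewrite cos_PI2, cos_0; ring).
  apply (is_RInt_R_derive (fun t => - cos t)); [lra| |].
  - intros t _. auto_derive; [auto|simpl; ring].
  - intros t _. apply (ex_derive_continuous (V := R_NormedModule)). auto_derive. auto.
Qed.

Lemma wallis_prod (n : nat) : INR (n + 1) * wallis (n + 1) * wallis n = PI / 2.
Proof.
  induction n as [|n IH].
  - simpl Nat.add. rewrite wallis_0, wallis_1. simpl. ring.
  - replace (S n + 1)%nat with (n + 2)%nat by lia. rewrite wallis_rec.
    replace (S n) with (n + 1)%nat by lia. rewrite <- IH. ring.
Qed.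

(** The central binomial coefficient divided by 4^n. *)
Definition central (n : nat) : R := INR (fact (2 * n)) / (4 ^ n * INR (fact n) ^ 2).

Lemma wallis_even (n : nat) : wallis (2 * n) = central n * (PI / 2).
Proof.
  unfold central. induction n as [|n IH].
  - simpl. rewrite wallis_0. field.
  - pose proof (wallis_rec (2 * n)) as H. rewrite IH in H.
    replace (2 * S n)%nat with (2 * n + 2)%nat by lia.
    assert (Hn : INR (2 * n + 2) <> 0) by (apply not_0_INR; lia).
    apply (Rmult_eq_reg_l (INR (2 * n + 2))); [|exact Hn]. rewrite H.
    replace (fact (2 * n + 2)) with ((2 * n + 2) * ((2 * n + 1) * fact (2 * n)))%nat
      by (replace (2 * n + 2)%nat with (S (S (2 * n))) by lia; rewrite !fact_simpl; ring).
    rewrite fact_simpl, !mult_INR. change (4 ^ S n) with (4 * 4 ^ n).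
    assert (4 ^ n <> 0) by (apply pow_nonzero; lra). pose proof (INR_fact_neq_0 n).
    rewrite S_INR, !plus_INR, !mult_INR. simpl (INR 2). simpl (INR 1).
    assert (INR n + 1 <> 0) by (pose proof (pos_INR n); lra). field. auto.
Qed.

(** Wallis's product: the decreasing integrals W(2n+1) <= W(2n) <= W(2n-1), together with (k + 1)
    W(k+1) W(k) = pi / 2, squeeze W(2n)^2 between pi / (2 (2n + 1)) and pi / (4n). *)
Lemma central_bounds (n : nat) : (1 <= n)%nat ->
  / PI * (1 - / (2 * INR n + 1)) <= central n ^ 2 * INR n <= / PI.
Proof.
  intros Hn. pose proof PI_RGT_0.
  assert (HN : 1 <= INR n) by (apply (le_INR 1); exact Hn).
  pose proof (wallis_prod (2 * n)) as H1. pose proof (wallis_prod (2 * n - 1)) as H2.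
  replace (2 * n - 1 + 1)%nat with (2 * n)%nat in H2 by lia.
  pose proof (wallis_decr (2 * n)) as D1. pose proof (wallis_decr (2 * n - 1)) as D2.
  replace (2 * n - 1 + 1)%nat with (2 * n)%nat in D2 by lia.
  pose proof (wallis_pos (2 * n)) as P.
  rewrite (wallis_even n) in *.
  set (c := central n) in *. set (W1 := wallis (2 * n + 1)) in *. set (W2 := wallis (2 * n - 1)) in *.
  rewrite plus_INR, mult_INR in H1. rewrite mult_INR in H2. simpl INR in H1, H2.
  set (N := INR n) in *.
  assert (Hc : 0 < c) by (apply (Rmult_lt_reg_r (PI / 2)); lra).
  assert (Q1 : (2 * N + 1) * (c * (PI / 2)) * (c * (PI / 2)) >= PI / 2).
  { assert (0 <= (2 * N + 1) * (c * (PI / 2)) * (c * (PI / 2) - W1)) by (apply Rmult_le_pos; [apply Rmult_le_pos|]; lra). lra. }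
  assert (Q2 : 2 * N * (c * (PI / 2)) * (c * (PI / 2)) <= PI / 2).
  { assert (0 <= 2 * N * (c * (PI / 2)) * (W2 - c * (PI / 2))) by (apply Rmult_le_pos; [apply Rmult_le_pos|]; lra). lra. }
  split.
  - apply (Rmult_le_reg_l (PI ^ 2 / 4 * (2 * (2 * N + 1)))); [apply Rmult_lt_0_compat; nra|].
    replace (PI ^ 2 / 4 * (2 * (2 * N + 1)) * (/ PI * (1 - / (2 * N + 1)))) with (PI / 2 * (2 * N)) by (field; lra).
    replace (PI ^ 2 / 4 * (2 * (2 * N + 1)) * (c ^ 2 * N)) with ((2 * N + 1) * (c * (PI / 2)) * (c * (PI / 2)) * (2 * N)) by field.
    apply Rmult_le_compat_r; lra.
  - apply (Rmult_le_reg_l (PI ^ 2 / 2)); [nra|].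
    replace (PI ^ 2 / 2 * / PI) with (PI / 2) by (field; lra).
    replace (PI ^ 2 / 2 * (c ^ 2 * N)) with (2 * N * (c * (PI / 2)) * (c * (PI / 2))) by field. exact Q2.
Qed.

(** n! e^n / n^(n + 1/2), with the power written as an exponential. *)
Definition stirling_ratio (n : nat) : R :=
  INR (fact n) * exp (INR n - (INR n + / 2) * ln (INR n)).

(** At x = n the middle expression is the logarithm of [stirling_ratio n / stirling_ratio (S n)].
    The lower bound makes the ratios decrease; the upper bound telescopes and keeps their limit away
    from 0. *)
Lemma ln_step_bounds (x : R) : 0 < x ->
  0 <= (x + / 2) * (ln (x + 1) - ln x) - 1 <= / 4 * (/ x - / (x + 1)).
Proof.
  intros Hx.
  assert (A : forall t, 0 <= t -> 0 <= ln (1 + t) - 2 * t / (2 + t)).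
  { apply nonneg_of_derive with (df := fun t => t ^ 2 / ((1 + t) * (2 + t) ^ 2)).
    - rewrite !Rplus_0_r, ln_1. field.
    - intros t Ht. auto_derive; [repeat split; lra|]. field. lra.
    - intros t Ht. apply Rdiv_le_0_compat; [nra|]. apply Rmult_lt_0_compat; nra. }
  assert (B : forall t, 0 <= t -> 0 <= t * (2 + t) / (2 * (1 + t)) - ln (1 + t)).
  { apply nonneg_of_derive with (df := fun t => t ^ 2 / (2 * (1 + t) ^ 2)).
    - rewrite !Rplus_0_r, ln_1. field.
    - intros t Ht. auto_derive; [repeat split; lra|]. field. lra.
    - intros t Ht. apply Rdiv_le_0_compat; nra. }
  assert (H : 0 < / x) by (apply Rinv_0_lt_compat, Hx).
  assert (E : ln (x + 1) - ln x = ln (1 + / x)).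
  { rewrite <- ln_div by lra. f_equal. field. lra. }
  rewrite E. specialize (A (/ x) ltac:(lra)). specialize (B (/ x) ltac:(lra)).
  replace (2 * / x / (2 + / x)) with (/ (x + / 2)) in A by (field; lra).
  replace (/ x * (2 + / x) / (2 * (1 + / x))) with ((x + / 2) / (x * (x + 1))) in B by (field; lra).
  set (l := ln (1 + / x)) in *. split.
  - assert ((x + / 2) * / (x + / 2) = 1) by (field; lra).
    assert (0 <= (x + / 2) * (l - / (x + / 2))) by (apply Rmult_le_pos; lra). lra.
  - assert (0 <= (x + / 2) * ((x + / 2) / (x * (x + 1)) - l)) by (apply Rmult_le_pos; lra).
    replace (/ 4 * (/ x - / (x + 1))) with ((x + / 2) * ((x + / 2) / (x * (x + 1))) - 1) by (field; lra). lra.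
Qed.

Lemma stirling_ratio_pos (n : nat) : 0 < stirling_ratio n.
Proof. apply Rmult_lt_0_compat; [apply INR_fact_lt_0 | apply exp_pos]. Qed.

Lemma stirling_ratio_step (n : nat) : (1 <= n)%nat ->
  stirling_ratio n = stirling_ratio (S n) * exp ((INR n + / 2) * (ln (INR n + 1) - ln (INR n)) - 1).
Proof.
  intros Hn. assert (HN : 1 <= INR n) by (apply (le_INR 1); exact Hn).
  unfold stirling_ratio. rewrite fact_simpl, mult_INR, S_INR.
  rewrite <- (exp_ln (INR n + 1)) at 1 by lra.
  replace (exp (ln (INR n + 1)) * INR (fact n)) with (INR (fact n) * exp (ln (INR n + 1))) by ring.
  rewrite !Rmult_assoc, <- !exp_plus. f_equal. f_equal. field.
Qed.

Lemma stirling_ratio_cv : exists l, 0 < l /\ is_lim_seq stirling_ratio l.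
Proof.
  set (u := fun n => stirling_ratio (S n)).
  assert (P : forall n, 0 < INR (S n)) by (intros; apply lt_0_INR; lia).
  assert (D : forall n, u (S n) <= u n).
  { intros n. unfold u. rewrite (stirling_ratio_step (S n)) by lia.
    pose proof (proj1 (ln_step_bounds (INR (S n)) (P n))).
    pose proof (stirling_ratio_pos (S (S n))). 
    assert (1 <= exp ((INR (S n) + / 2) * (ln (INR (S n) + 1) - ln (INR (S n))) - 1)) by (apply exp_ge_1; assumption). nra. }
  (* The telescoped upper bound; dropping 1 / (n + 1) from the exponent leaves the positive lower
     bound u(0) e^(-1/4). *)
  assert (L : forall n, u 0%nat * exp (/ 4 * (/ INR (S n) - 1)) <= u n).
  { induction n as [|n IH].
    - simpl INR. replace (/ 4 * (/ 1 - 1)) with 0 by field. rewrite exp_0. lra.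
    - pose proof (proj2 (ln_step_bounds (INR (S n)) (P n))) as H. apply exp_le_mono in H.
      unfold u in IH at 2. rewrite (stirling_ratio_step (S n)) in IH by lia.
      pose proof (stirling_ratio_pos (S (S n))). unfold u at 2.
      set (e := exp ((INR (S n) + / 2) * (ln (INR (S n) + 1) - ln (INR (S n))) - 1)) in *.
      rewrite (S_INR (S n)).
      apply (Rmult_le_reg_r (exp (/ 4 * (/ INR (S n) - / (INR (S n) + 1))))); [apply exp_pos|].
      rewrite Rmult_assoc, <- exp_plus.
      replace (/ 4 * (/ (INR (S n) + 1) - 1) + / 4 * (/ INR (S n) - / (INR (S n) + 1))) with (/ 4 * (/ INR (S n) - 1)) by ring.
      eapply Rle_trans; [exact IH|]. apply Rmult_le_compat_l; lra. }
  assert (L2 : forall n, u 0%nat * exp (- / 4) <= u n).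
  { intros n. eapply Rle_trans; [|apply L]. apply Rmult_le_compat_l; [left; apply stirling_ratio_pos|].
    apply exp_le_mono. assert (0 < / INR (S n)) by (apply Rinv_0_lt_compat, P). lra. }
  destruct (ex_finite_lim_seq_decr u (u 0%nat * exp (- / 4)) D L2) as [l Hl].
  exists l. split.
  - apply Rlt_le_trans with (u 0%nat * exp (- / 4)).
    + apply Rmult_lt_0_compat; [apply stirling_ratio_pos|apply exp_pos].
    + apply (is_lim_seq_le (fun _ => u 0%nat * exp (- / 4)) u (u 0%nat * exp (- / 4)) l L2); [apply is_lim_seq_const|exact Hl].
  - apply is_lim_seq_incr_1. exact Hl.
Qed.

(** Expressing the factorials of [central] through [stirling_ratio], the powers of n and e cancel up
    to sqrt(2 / n); the identity is stated squared. In the limit l it reads l^4 / pi = 2 l^2, which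
    gives l. *)
Lemma stirling_ratio_central (n : nat) : (1 <= n)%nat ->
  (stirling_ratio n ^ 2) ^ 2 * (central n ^ 2 * INR n) = 2 * stirling_ratio (2 * n) ^ 2.
Proof.
  intros Hn. assert (HN : 1 <= INR n) by (apply (le_INR 1); exact Hn).
  unfold stirling_ratio, central. rewrite mult_INR. change (INR 2) with 2. rewrite ln_mult by lra.
  assert (E4 : (4 ^ n) = exp (2 * INR n * ln 2)).
  { replace (2 * INR n * ln 2) with (INR n * ln 4).
    - rewrite <- Rpower_pow by lra. reflexivity.
    - replace 4 with (2 * 2) by ring. rewrite ln_mult by lra. ring. }
  rewrite E4. set (N := INR n) in *. set (f := INR (fact n)). set (F := INR (fact (2 * n))).
  assert (f <> 0) by apply INR_fact_neq_0.
  assert (Hs : forall a, exp a ^ 2 = exp (2 * a)).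
  { intros a. simpl. rewrite Rmult_1_r, <- exp_plus. f_equal. ring. }
  set (A := exp (N - (N + / 2) * ln N)). set (B := exp (2 * N - (2 * N + / 2) * (ln 2 + ln N))).
  set (q := exp (2 * N * ln 2)).
  assert (Hq : q <> 0) by (apply Rgt_not_eq, exp_pos).
  assert (E : A ^ 2 * A ^ 2 * N = 2 * (q ^ 2 * B ^ 2)).
  { transitivity (A ^ 2 * A ^ 2 * exp (ln N)); [rewrite exp_ln by lra; reflexivity|].
    transitivity (exp (ln 2) * (q ^ 2 * B ^ 2)); [|rewrite exp_ln by lra; reflexivity].
    unfold A, B, q. rewrite !Hs, <- !exp_plus. f_equal. field. }
  transitivity (F ^ 2 / q ^ 2 * (A ^ 2 * A ^ 2 * N)); [field; auto|].
  rewrite E. field. exact Hq.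
Qed.

Lemma stirling : is_lim_seq stirling_ratio (sqrt (2 * PI)).
Proof.
  pose proof PI_RGT_0.
  destruct stirling_ratio_cv as [l [Hl Hlim]].
  assert (H2 : is_lim_seq (fun n => stirling_ratio (2 * n)) l).
  { apply (is_lim_seq_subseq stirling_ratio l (fun n => (2 * n)%nat)); [|exact Hlim].
    apply eventually_subseq. intros n; lia. }
  assert (Hsq : forall u (a : R), is_lim_seq u a -> is_lim_seq (fun n => u n ^ 2) (a ^ 2)).
  { intros u a Hu. simpl. apply (is_lim_seq_ext (fun n => u n * u n)); [intros; ring|].
    replace (a * (a * 1)) with (a * a) by ring. apply is_lim_seq_mult'; exact Hu. }
  assert (Hc : is_lim_seq (fun n => central n ^ 2 * INR n) (/ PI)).
  { apply (is_lim_seq_le_le_loc (fun n => / PI * (1 - / (2 * INR n + 1))) _ (fun _ => / PI)).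
    - exists 1%nat. intros n Hn. apply central_bounds, Hn.
    - replace (Finite (/ PI)) with (Finite (/ PI * (1 - 0))) by (f_equal; ring).
      apply is_lim_seq_mult'; [apply is_lim_seq_const|].
      apply is_lim_seq_minus'; [apply is_lim_seq_const|].
      replace (Finite 0) with (Rbar_inv p_infty) by reflexivity.
      apply is_lim_seq_inv; [|discriminate].
      eapply is_lim_seq_plus; [|apply is_lim_seq_const|].
      + eapply is_lim_seq_mult; [apply is_lim_seq_const|apply is_lim_seq_INR|].
        apply is_Rbar_mult_sym, is_Rbar_mult_p_infty_pos. simpl; lra.
      + reflexivity.
    - apply is_lim_seq_const. }
  assert (E : (l ^ 2) ^ 2 * / PI = 2 * l ^ 2).
  { pose proof (is_lim_seq_mult' _ _ _ _ (Hsq _ _ (Hsq _ _ Hlim)) Hc) as L1.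
    pose proof (is_lim_seq_mult' _ _ _ _ (is_lim_seq_const 2) (Hsq _ _ H2)) as L2.
    assert (L3 : is_lim_seq (fun n => 2 * stirling_ratio (2 * n) ^ 2) ((l ^ 2) ^ 2 * / PI)).
    { refine (is_lim_seq_ext_loc _ _ _ _ L1). exists 1%nat. intros n Hn. apply stirling_ratio_central, Hn. }
    pose proof (is_lim_seq_unique _ _ L2) as U2. pose proof (is_lim_seq_unique _ _ L3) as U3.
    rewrite U2 in U3. injection U3. auto. }
  assert (E2 : l ^ 2 = 2 * PI).
  { assert (l ^ 2 <> 0) by (apply pow_nonzero; lra).
    apply (Rmult_eq_reg_l (l ^ 2)); [|assumption]. replace (l ^ 2 * l ^ 2) with (PI * ((l ^ 2) ^ 2 * / PI)) by (field; lra).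
    rewrite E. ring. }
  rewrite <- E2, sqrt_pow2 by lra. exact Hlim.
Qed.

(** * Binet's formula for Gamma (i tau) *)

(** mu(z) - mu(z + n) for z = i tau. *)
Fixpoint mu_sum (tau : R) (n : nat) : C :=
  match n with
  | O => RtoC 0
  | S k => (mu_sum tau k + mu_diff (INR k) tau)%C
  end.

Lemma lim_inv_scal (c : R) : 0 < c ->
  filterlim (fun T => / (c * T)) (Rbar_locally p_infty) (locally 0).
Proof.
  intros Hc. apply filterlim_locally. intros eps. exists (/ (c * eps)).
  intros T HT. pose proof (cond_pos eps).
  assert (0 < / (c * eps)) by (apply Rinv_0_lt_compat; nra).
  change (Rabs (/ (c * T) - 0) < eps). rewrite Rminus_0_r, Rabs_pos_eq by (left; apply Rinv_0_lt_compat; nra).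
  apply (Rmult_lt_reg_l (c * T)); [nra|]. rewrite Rinv_r by nra.
  apply (Rmult_lt_compat_l (c * eps)) in HT; [|nra]. rewrite Rinv_r in HT by nra. lra.
Qed.

Lemma lim_seq_inv_scal (c : R) : 0 < c -> is_lim_seq (fun n => / (c * INR n)) 0.
Proof.
  intros Hc.
  exact (filterlim_comp _ _ _ INR (fun T => / (c * T)) _ _ _ is_lim_seq_INR (lim_inv_scal c Hc)).
Qed.

(** Convergence is not absolute at s = 0. For each n the difference of the truncated integrals at s
    = 0 and s = n + 1 converges as T grows, by finitely many uses of [mu_diff_approx], while the
    integral at s = n + 1 is small uniformly in T; [Ctends_approx] then yields the limit. The last
    conclusion is the only link between mu and Gamma used later. *)
Lemma mu_exists (tau : R) : 0 < tau ->
  exists mu : C,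
    is_RInt_gen (V := C_R_NormedModule) (mu_integrand 0 tau) (at_point 0) (Rbar_locally p_infty) mu /\
    Cmod mu <= / (6 * tau) /\
    forall n, Cmod (mu - mu_sum tau (S n)) <= / (12 * INR (S n)).
Proof.
  intros Htau.
  set (I := fun s T => CRInt (mu_integrand s tau) 0 T).
  assert (HI : forall s T, 0 < T -> is_RInt_C (mu_integrand s tau) 0 T (I s T)).
  { intros s T HT. destruct (mu_integrand_ex s tau T ltac:(lra)) as [l Hl].
    unfold I. rewrite (CRInt_eq _ _ _ _ Hl). exact Hl. }
  assert (Hd : forall n, Ctends (fun T => I 0 T - I (INR n) T)%C (Rbar_locally p_infty) (mu_sum tau n)).
  { induction n as [|n IH].
    - simpl. apply (Ctends_ext (Rbar_locally p_infty) (fun _ => RtoC 0)); [intros; ring|].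
      apply (Ctends_const (Rbar_locally p_infty)).
    - apply (Ctends_ext (Rbar_locally p_infty) (fun T => (I 0 T - I (INR n) T) + (I (INR n) T - I (INR (S n)) T))%C); [intros; ring|].
      apply (Ctends_plus (Rbar_locally p_infty)); [exact IH|].
      apply (Ctends_of_Cmod (Rbar_locally p_infty)) with (g := fun T => / (2 * tau * T)).
      + exists 0. intros T HT. rewrite S_INR.
        apply mu_diff_approx; [apply pos_INR|exact Htau|exact HT|apply HI, HT|apply HI, HT].
      + apply lim_inv_scal. lra. }
  destruct (Ctends_approx (Rbar_locally p_infty) (I 0) (fun n T => I 0 T - I (INR (S n)) T)%C
     (fun n => mu_sum tau (S n)) (fun n => / (12 * INR (S n)))) as [mu [H1 H2]].
  - intros n. exists 0. intros T HT.
    replace (I 0 T - (I 0 T - I (INR (S n)) T))%C with (I (INR (S n)) T) by ring.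
    apply (Cmod_mu_shifted _ tau T); [apply lt_0_INR; lia|lra|apply HI, HT].
  - intros n; apply Hd.
  - apply (is_lim_seq_incr_1 (fun n => / (12 * INR n))).
    apply lim_seq_inv_scal. lra.
  - exists mu. split; [|split; [|exact H2]].
    + apply is_RInt_gen_intro with (I := I 0); [exact (HI 0)|].
      apply Ctends_filterlim; [apply Rbar_locally_filter|exact H1].
    + replace mu with (mu - RtoC 0)%C by ring.
      apply (Ctends_Cmod_le (Rbar_locally p_infty) (I 0) mu (RtoC 0)); [exact H1|].
      exists 0. intros T HT. replace (I 0 T - RtoC 0)%C with (I 0 T) by ring.
      apply (Cmod_mu tau T); [exact Htau|exact HT|apply HI, HT].
Qed.

Lemma pochhammer_neq_0 (s tau : R) (n : nat) : 0 < tau -> pochhammer (Cpair s tau) n <> RtoC 0.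
Proof.
  intros Htau. induction n as [|n IH]; [apply C1_nz|]. simpl. apply Cmult_neq_0; [exact IH|].
  intros E. apply (f_equal snd) in E. simpl in E. lra.
Qed.

(** With w = z + k, exp(mu(w) - mu(w + 1)) w = (w + 1)^(w + 1/2) / (e w^(w - 1/2)), so the product
    over k telescopes to z^(z - 1/2) at one end and (z + n)^(z + n - 1/2) at the other. *)
Lemma Cexp_mu_sum (tau : R) (n : nat) : 0 < tau ->
  (Cexp (mu_sum tau n) * pochhammer (Cpair 0 tau) n * Cexp (Cpair (- / 2) tau * Clog 0 tau) * Cexp (RtoC (INR n)) =
   Cexp (Cpair (INR n - / 2) tau * Clog (INR n) tau))%C.
Proof.
  intros Htau. induction n as [|n IH].
  - simpl. rewrite Cexp_0, Rminus_0_l. ring.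
  - simpl mu_sum. simpl pochhammer. rewrite S_INR.
    replace (Cpair 0 tau + RtoC (INR n))%C with (Cexp (Clog (INR n) tau))
      by (rewrite Cexp_Clog by exact Htau; apply C_eq; simpl; ring).
    rewrite RtoC_plus, !Cexp_plus.
    transitivity ((Cexp (mu_sum tau n) * pochhammer (Cpair 0 tau) n * Cexp (Cpair (- / 2) tau * Clog 0 tau) * Cexp (RtoC (INR n))) *
       Cexp (mu_diff (INR n) tau + Clog (INR n) tau + RtoC 1))%C; [rewrite !Cexp_plus; ring|].
    rewrite IH, <- Cexp_plus. f_equal. unfold mu_diff.
    apply C_eq; simpl; field.
Qed.

(* [Gamma (i tau)] by Binet's formula, [mu] being Binet's integral. *)
Definition Gamma_imag (tau : R) (mu : C) : C :=
  (RtoC (sqrt (2 * PI)) * Cexp (Cpair (- / 2) tau * Clog 0 tau - Cpair 0 tau) * Cexp mu)%C.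

Lemma atan_bounds (y : R) : 0 <= y -> y / (1 + y ^ 2) <= atan y <= y.
Proof.
  intros Hy. split.
  - enough (0 <= atan y - y / (1 + y ^ 2)) by lra. revert y Hy.
    apply nonneg_of_derive with (df := fun y => 2 * y ^ 2 / (1 + y ^ 2) ^ 2).
    + rewrite atan_0. field.
    + intros t Ht. auto_derive; [nra|]. field. nra.
    + intros t Ht. apply Rdiv_le_0_compat; [nra|]. apply pow_lt. nra.
  - enough (0 <= y - atan y) by lra. revert y Hy.
    apply nonneg_of_derive with (df := fun y => y ^ 2 / (1 + y ^ 2)).
    + rewrite atan_0. ring.
    + intros t Ht. auto_derive; [auto|]. field. nra.
    + intros t Ht. apply Rdiv_le_0_compat; nra.
Qed.

Lemma ln_1p_bounds (y : R) : 0 <= y -> 0 <= ln (1 + y) <= y.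
Proof.
  intros Hy. split.
  - rewrite <- ln_1. destruct Hy as [Hy|<-]; [left; apply ln_increasing; lra|right; f_equal; ring].
  - rewrite <- (ln_exp y) at 2. pose proof (exp_ineq1_le y) as [H|H].
    + left. apply ln_increasing; lra.
    + right. f_equal. exact H.
Qed.

(* The terms are [i tau - (n + 1/2 + i tau) log (1 + i tau / n)]. *)
Lemma Clog_asympt (tau : R) : 0 < tau ->
  Ctends (fun n => Cpair 0 tau * RtoC (ln (INR n)) + Cpair 0 tau + RtoC ((INR n + / 2) * ln (INR n))
     - Cpair (INR n + / 2) tau * Clog (INR n) tau)%C eventually (RtoC 0).
Proof.
  intros Htau.
  assert (Hinv : is_lim_seq (fun n => / (1 * INR n)) 0)
    by (apply lim_seq_inv_scal; lra).
  assert (Hinv' : forall c, is_lim_seq (fun n => c * / (1 * INR n)) 0).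
  { intros c. replace (Finite 0) with (Finite (c * 0)) by (f_equal; ring).
    apply is_lim_seq_mult'; [apply is_lim_seq_const|exact Hinv]. }
  apply (Ctends_of_Cmod eventually) with (g := fun n => (3 * tau ^ 2 + tau + 3 * tau ^ 3) * / (1 * INR n)); [|apply Hinv'].
  exists 1%nat. intros n Hn.
  assert (HN : 1 <= INR n) by (apply (le_INR 1); exact Hn).
  set (N := INR n) in *.
  set (y := tau / N). assert (Hy : 0 < y) by (apply Rdiv_lt_0_compat; lra).
  assert (EL : Clog N tau = Cpair (ln N + / 2 * ln (1 + y ^ 2)) (atan y)).
  { unfold Clog, Cpair. f_equal.
    - replace (N ^ 2 + tau ^ 2) with (N * N * (1 + y ^ 2)) by (unfold y; field; lra).
      rewrite !ln_mult by nra. field.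
    - replace (N / tau) with (/ y) by (unfold y; field; lra). rewrite atan_inv by exact Hy. ring. }
  rewrite EL.
  pose proof (atan_bounds y ltac:(lra)) as [A1 A2]. pose proof (ln_1p_bounds (y ^ 2) ltac:(nra)) as [B1 B2].
  set (a := atan y) in *. set (l := ln (1 + y ^ 2)) in *.
  assert (Ey : N * y = tau) by (unfold y; field; lra).
  replace (/ (1 * N)) with (y / tau) by (unfold y; field; lra).
  replace ((3 * tau ^ 2 + tau + 3 * tau ^ 3) * (y / tau)) with (3 * tau * y + y + 3 * tau ^ 2 * y) by (field; lra).
  assert (Hyt : y <= tau) by nra.
  assert (A3 : tau - N * a <= tau * y ^ 2).
  { apply (Rmult_le_compat_l N) in A1; [|lra].
    replace (N * (y / (1 + y ^ 2))) with (tau / (1 + y ^ 2)) in A1 by (rewrite <- Ey; field; nra).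
    assert (tau / (1 + y ^ 2) >= tau * (1 - y ^ 2)).
    { apply Rle_ge, (Rle_div_r (tau * (1 - y ^ 2)) tau (1 + y ^ 2)); [pose proof (pow2_ge_0 y); lra|]. replace (tau * (1 - y ^ 2) * (1 + y ^ 2)) with (tau * (1 - y ^ 4)) by ring.
      assert (0 <= y ^ 4) by (apply pow_le; lra). nra. }
    lra. }
  assert (A4 : N * a <= tau) by nra.
  eapply Rle_trans; [apply Cmod_le_Rabs|].
  match goal with |- Rabs ?r + Rabs ?i <= _ =>
    replace r with (- ((N + / 2) * (/ 2 * l)) + tau * a) by (simpl; field);
    replace i with ((tau - N * a) - / 2 * a - tau * (/ 2 * l)) by (simpl; field) end.
  assert (N * l <= tau * y) by nra.
  assert (0 <= N * l) by nra.
  assert (0 <= a) by (apply Rle_trans with (2 := A1); apply Rdiv_le_0_compat; nra).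
  assert (tau * a <= tau * y) by nra. assert (0 <= tau * a) by nra.
  assert (l <= tau * y) by nra.
  assert (tau * l <= tau ^ 2 * y) by nra.
  assert (0 <= tau * l) by nra.
  assert (tau * y ^ 2 <= tau ^ 2 * y) by nra.
  assert (0 <= tau ^ 2 * y) by nra.
  assert (R1 : Rabs (- ((N + / 2) * (/ 2 * l)) + tau * a) <= 3 * tau * y) by (apply Rabs_le; lra).
  assert (R2 : Rabs (tau - N * a - / 2 * a - tau * (/ 2 * l)) <= y + 3 * tau ^ 2 * y) by (apply Rabs_le; lra).
  lra.
Qed.

(** By [Cexp_mu_sum], Gauss's product n! n^z / (z)_(n+1) is the product of [stirling_ratio n], the
    constant z^(z - 1/2) e^(-z), [Cexp (mu_sum tau n)], and an exponential that tends to 1 by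
    [Clog_asympt]. *)
Lemma Gamma_imag_limit (tau : R) (mu : C) : 0 < tau ->
  (forall n, Cmod (mu - mu_sum tau (S n)) <= / (12 * INR (S n))) ->
  Ctends (fun n => RtoC (INR (fact n)) * Cexp (Cpair 0 tau * RtoC (ln (INR n)))
     / pochhammer (Cpair 0 tau) (S n))%C eventually (Gamma_imag tau mu).
Proof.
  intros Htau Hmu.
  assert (Hs : Ctends (mu_sum tau) eventually mu).
  { apply (Ctends_of_Cmod eventually) with (g := fun n => / (12 * INR n)); [|apply lim_seq_inv_scal; lra].
    exists 1%nat. intros [|n] Hn; [lia|].
    rewrite <- Cmod_opp. replace (- (mu_sum tau (S n) - mu))%C with (mu - mu_sum tau (S n))%C by ring. apply Hmu. }
  unfold Gamma_imag.
  assert (HA : Ctends (fun n => RtoC (stirling_ratio n)) eventually (RtoC (sqrt (2 * PI))))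
    by (apply (Ctends_RtoC eventually), stirling).
  pose proof (Ctends_Cexp eventually _ _ Hs) as HB.
  pose proof (Ctends_Cexp eventually _ _ (Clog_asympt tau Htau)) as HC.
  rewrite Cexp_0 in HC.
  pose proof (Ctends_mult eventually _ _ _ _ (Ctends_mult eventually _ _ _ _ (Ctends_mult eventually _ _ _ _ HA
    (Ctends_const eventually (Cexp (Cpair (- / 2) tau * Clog 0 tau - Cpair 0 tau)))) HB) HC) as H.
  rewrite Cmult_1_r in H.
  refine (Ctends_ext_loc eventually _ _ _ _ H).
  exists 1%nat. intros n Hn.
  pose proof (Cexp_mu_sum tau n Htau) as E. pose proof (pochhammer_neq_0 0 tau n Htau) as Hp.
  simpl pochhammer.
  replace (Cpair 0 tau + RtoC (INR n))%C with (Cexp (Clog (INR n) tau))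
    by (rewrite Cexp_Clog by exact Htau; apply C_eq; simpl; ring).
  unfold stirling_ratio. rewrite RtoC_mult, <- Cexp_RtoC.
  set (P := pochhammer (Cpair 0 tau) n) in *.
  apply (f_equal (fun w => w / (P * Cexp (Cpair (- / 2) tau * Clog 0 tau) * Cexp (RtoC (INR n))))%C) in E.
  replace (Cexp (mu_sum tau n) * P * Cexp (Cpair (- / 2) tau * Clog 0 tau) * Cexp (RtoC (INR n)) / (P * Cexp (Cpair (- / 2) tau * Clog 0 tau) * Cexp (RtoC (INR n))))%C
    with (Cexp (mu_sum tau n)) in E by (field; repeat split; try apply Cexp_neq_0; exact Hp).
  rewrite E.
  replace (Cpair (INR n + / 2) tau * Clog (INR n) tau)%C
    with (Cpair (INR n - / 2) tau * Clog (INR n) tau + Clog (INR n) tau)%C by (apply C_eq; simpl; field).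
  rewrite RtoC_minus, !Cexp_minus, !Cexp_plus.
  field. repeat split; try apply Cexp_neq_0; exact Hp.
Qed.

(** * The lower incomplete gamma function *)

Lemma Ctends_shift (u : nat -> C) (l : C) :
  Ctends u eventually l -> Ctends (fun n => u (S n)) eventually l.
Proof.
  intros [H1 H2]; split.
  - exact (proj1 (is_lim_seq_incr_1 (fun n => Re (u n)) (Re l)) H1).
  - exact (proj1 (is_lim_seq_incr_1 (fun n => Im (u n)) (Im l)) H2).
Qed.

(** * Finite sums and remainders of series *)

Fixpoint Rsum (f : nat -> R) (n : nat) : R :=
  match n with O => 0 | S k => Rsum f k + f k end.

(** Like [Rsum], a sum of n terms, whereas [sum_n] has n + 1; the empty sum serves as the base of
    the inductions. *)
Fixpoint Csum (f : nat -> C) (n : nat) : C :=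
  match n with O => RtoC 0 | S k => (Csum f k + f k)%C end.

Lemma Csum_ext (f g : nat -> C) (n : nat) :
  (forall k, (k < n)%nat -> f k = g k) -> Csum f n = Csum g n.
Proof. induction n as [|n IH]; intros H; simpl; [reflexivity|]. rewrite IH, H; auto. Qed.

Lemma Csum_mult_l (c : C) (f : nat -> C) (n : nat) : (c * Csum f n = Csum (fun k => c * f k) n)%C.
Proof. induction n as [|n IH]; simpl; [ring|]. rewrite <- IH. ring. Qed.

Lemma Csum_plus (f g : nat -> C) (n : nat) : (Csum f n + Csum g n = Csum (fun k => f k + g k) n)%C.
Proof. induction n as [|n IH]; simpl; [ring|]. rewrite <- IH. ring. Qed.

Lemma Csum_minus (f g : nat -> C) (n : nat) : (Csum f n - Csum g n = Csum (fun k => f k - g k) n)%C.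
Proof. induction n as [|n IH]; simpl; [ring|]. rewrite <- IH. ring. Qed.

Lemma Csum_0 (n : nat) : Csum (fun _ => RtoC 0) n = RtoC 0.
Proof. induction n as [|n IH]; simpl; [reflexivity|]. rewrite IH. ring. Qed.

Lemma Csum_swap (f : nat -> nat -> C) (n m : nat) :
  Csum (fun i => Csum (f i) m) n = Csum (fun j => Csum (fun i => f i j) n) m.
Proof.
  induction n as [|n IH]; simpl; [symmetry; apply Csum_0|]. rewrite IH. apply Csum_plus.
Qed.

Lemma Csum_conj (f : nat -> C) (n : nat) : Cconj (Csum f n) = Csum (fun k => Cconj (f k)) n.
Proof.
  induction n as [|n IH]; simpl; [apply C_eq; simpl; ring|]. rewrite <- IH. apply C_eq; simpl; ring.
Qed.

Lemma Csum_opp (f : nat -> C) (n : nat) : (- Csum f n = Csum (fun k => - f k) n)%C.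
Proof. induction n as [|n IH]; simpl; [ring|]. rewrite <- IH. ring. Qed.

Lemma Csum_RtoC (f : nat -> R) (n : nat) : Csum (fun k => RtoC (f k)) n = RtoC (Rsum f n).
Proof. induction n as [|n IH]; simpl; [reflexivity|]. rewrite IH, RtoC_plus. reflexivity. Qed.

Lemma Cmod_Csum_le (f : nat -> C) (g : nat -> R) (n : nat) :
  (forall k, (k < n)%nat -> Cmod (f k) <= g k) -> Cmod (Csum f n) <= Rsum g n.
Proof.
  induction n as [|n IH]; intros H; simpl; [rewrite Cmod_0; lra|].
  eapply Rle_trans; [apply Cmod_triangle|]. apply Rplus_le_compat; auto.
Qed.

Lemma Rsum_ext (f g : nat -> R) (n : nat) :
  (forall k, (k < n)%nat -> f k = g k) -> Rsum f n = Rsum g n.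
Proof. induction n as [|n IH]; intros H; simpl; [reflexivity|]. rewrite IH, H; auto. Qed.

Lemma Rsum_mult_r (c : R) (f : nat -> R) (n : nat) : Rsum f n * c = Rsum (fun k => f k * c) n.
Proof. induction n as [|n IH]; simpl; [ring|]. rewrite <- IH. ring. Qed.

Lemma Rsum_sum_n (f : nat -> R) (n : nat) : sum_n f n = Rsum f (S n).
Proof.
  induction n as [|n IH]; [rewrite sum_O; simpl; ring|]. rewrite sum_Sn, IH. reflexivity.
Qed.

Lemma is_lim_seq_Rsum (f : nat -> R) (l : R) : is_series f l -> is_lim_seq (Rsum f) l.
Proof.
  intros H. apply is_lim_seq_incr_1. apply (is_lim_seq_ext (sum_n f)); [apply Rsum_sum_n|exact H].
Qed.

Lemma Re_Csum (f : nat -> C) (n : nat) : Re (Csum f n) = Rsum (fun k => Re (f k)) n.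
Proof. induction n as [|n IH]; [reflexivity|]. simpl. rewrite <- IH. reflexivity. Qed.

Lemma Im_Csum (f : nat -> C) (n : nat) : Im (Csum f n) = Rsum (fun k => Im (f k)) n.
Proof. induction n as [|n IH]; [reflexivity|]. simpl. rewrite <- IH. reflexivity. Qed.

(** Weierstrass's test in remainder form: the remainder of [f] is dominated by that of [g]. Every
    truncation error of a series below is measured in this way against an exponential series. *)
Lemma Csum_tail (f : nat -> C) (g : nat -> R) (l : C) (G : R) :
  (forall k, Cmod (f k) <= g k) -> Ctends (Csum f) eventually l -> is_lim_seq (Rsum g) G ->
  forall n, Cmod (l - Csum f n) <= G - Rsum g n.
Proof.
  intros Hfg Hl HG n.
  assert (Hg : forall k, 0 <= g k) by (intros k; eapply Rle_trans; [apply Cmod_ge_0|apply Hfg]).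
  assert (A : forall k, Cmod (Csum f (n + k) - Csum f n) <= Rsum g (n + k) - Rsum g n).
  { induction k as [|k IH].
    - rewrite Nat.add_0_r, Rminus_diag. replace (Csum f n - Csum f n)%C with (RtoC 0) by ring. rewrite Cmod_0; lra.
    - rewrite Nat.add_succ_r. simpl. 
      replace (Csum f (n + k) + f (n + k)%nat - Csum f n)%C with ((Csum f (n + k) - Csum f n) + f (n + k)%nat)%C by ring.
      eapply Rle_trans; [apply Cmod_triangle|]. specialize (Hfg (n + k)%nat). lra. }
  assert (B : forall m, Rsum g m <= G).
  { intros m. apply (is_lim_seq_incr_compare (Rsum g) G HG). intros k; simpl. specialize (Hg k). lra. }
  apply (Ctends_Cmod_le eventually (Csum f)); [exact Hl|].
  exists n. intros m Hm. replace m with (n + (m - n))%nat by lia.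
  eapply Rle_trans; [apply A|]. specialize (B (n + (m - n))%nat). lra.
Qed.

(** * The exponential series as a majorant *)

Definition exp_term (v : R) (j : nat) : R := v ^ j / INR (fact j).

Lemma exp_term_pos (v : R) (j : nat) : 0 <= v -> 0 <= exp_term v j.
Proof. intros Hv. apply Rdiv_le_0_compat; [apply pow_le, Hv|apply INR_fact_lt_0]. Qed.

Lemma Rabs_exp_term (v : R) (j : nat) : Rabs (exp_term v j) = exp_term (Rabs v) j.
Proof.
  unfold exp_term. rewrite Rabs_div by apply INR_fact_neq_0. rewrite RPow_abs.
  rewrite (Rabs_pos_eq (INR _)) by apply pos_INR. reflexivity.
Qed.

Lemma exp_term_le (u v : R) (j : nat) : 0 <= u <= v -> exp_term u j <= exp_term v j.
Proof.
  intros H. apply Rmult_le_compat_r; [left; apply Rinv_0_lt_compat, INR_fact_lt_0|].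
  apply pow_incr, H.
Qed.

Lemma exp_sum_lim (v : R) : is_lim_seq (Rsum (exp_term v)) (exp v).
Proof.
  apply is_lim_seq_Rsum. apply is_series_ext with (2 := proj1 (is_pseries_R _ _ _) (is_exp_Reals v)).
  intros n. unfold exp_term, Rdiv. apply Rmult_comm.
Qed.

Lemma exp_sum_le (v : R) (n : nat) : 0 <= v -> Rsum (exp_term v) n <= exp v.
Proof.
  intros Hv. apply (is_lim_seq_incr_compare (Rsum (exp_term v)) (exp v) (exp_sum_lim v)).
  intros k; simpl. pose proof (exp_term_pos v k Hv). lra.
Qed.

Lemma exp_term_le_exp (v : R) (n : nat) : 0 <= v -> exp_term v n <= exp v.
Proof.
  intros Hv. eapply Rle_trans; [|apply (exp_sum_le v (S n) Hv)]. simpl.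
  enough (0 <= Rsum (exp_term v) n) by lra.
  induction n as [|n IH]; simpl; [lra|]. pose proof (exp_term_pos v n Hv). lra.
Qed.

Lemma CV_radius_exp_bound (a : nat -> R) (K : R) :
  (forall j, Rabs (a j) <= K / INR (fact j)) -> forall x, Rbar_lt (Rabs x) (CV_radius a).
Proof.
  intros H x.
  apply Rbar_lt_le_trans with (Rabs x + 1); [simpl; lra|].
  apply (CV_radius_bounded a). exists (K * exp (Rabs x + 1)). intros n.
  pose proof (Rabs_pos x). pose proof (pow_le (Rabs x + 1) n ltac:(lra)).
  rewrite Rabs_mult, (Rabs_pos_eq (_ ^ n)) by assumption.
  apply Rle_trans with (K / INR (fact n) * (Rabs x + 1) ^ n).
  - apply Rmult_le_compat_r; [assumption|apply H].
  - replace (K / INR (fact n) * (Rabs x + 1) ^ n) with (K * exp_term (Rabs x + 1) n)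
      by (unfold exp_term; field; apply INR_fact_neq_0).
    apply Rmult_le_compat_l; [|apply exp_term_le_exp; lra].
    specialize (H 0%nat). simpl in H. pose proof (Rabs_pos (a 0%nat)). lra.
Qed.

(** * The power series p_c *)

Definition lower_gamma_coef (tau c : R) (j : nat) : C :=
  (RtoC ((-1) ^ j / INR (fact j)) * / Cpair (c + INR j) tau)%C.

(* [v^(c + i tau)] times this is the lower incomplete gamma function
   [int_0^v u^(c + i tau - 1) e^(-u) du], continued analytically to [c <= 0]. *)
Definition lower_gamma (tau c v : R) : C :=
  (PSeries (fun j => Re (lower_gamma_coef tau c j)) v, PSeries (fun j => Im (lower_gamma_coef tau c j)) v).

Lemma Cmod_lower_gamma_coef (tau c : R) (j : nat) : 0 < tau ->
  Cmod (lower_gamma_coef tau c j) <= / tau / INR (fact j).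
Proof.
  intros Ht. unfold lower_gamma_coef. rewrite Cmod_mult, Cmod_R, Cmod_inv by (apply pair_neq_0, Ht).
  rewrite Rabs_div by apply INR_fact_neq_0. rewrite (Rabs_pos_eq (INR _)) by apply pos_INR.
  rewrite pow_1_abs. unfold Rdiv. rewrite Rmult_1_l, Rmult_comm.
  apply Rmult_le_compat_r; [left; apply Rinv_0_lt_compat, INR_fact_lt_0|].
  apply Rinv_le_contravar; [exact Ht|apply Cmod_pair_ge, Ht].
Qed.

Lemma lower_gamma_CV (tau c x : R) : 0 < tau ->
  Rbar_lt (Rabs x) (CV_radius (fun j => Re (lower_gamma_coef tau c j))) /\
  Rbar_lt (Rabs x) (CV_radius (fun j => Im (lower_gamma_coef tau c j))).
Proof.
  intros Ht; split; apply (CV_radius_exp_bound _ (/ tau)); intros j.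
  - eapply Rle_trans; [apply re_le_Cmod|apply Cmod_lower_gamma_coef, Ht].
  - eapply Rle_trans; [apply im_le_Cmod|apply Cmod_lower_gamma_coef, Ht].
Qed.

Definition lower_gamma_term (tau c v : R) (j : nat) : C :=
  (RtoC (exp_term (- v) j) * / Cpair (c + INR j) tau)%C.

Lemma lower_gamma_term_eq (tau c v : R) (j : nat) :
  lower_gamma_term tau c v j = (lower_gamma_coef tau c j * RtoC (v ^ j))%C.
Proof.
  unfold lower_gamma_term, lower_gamma_coef, exp_term.
  replace (- v) with (-1 * v) by ring. rewrite Rpow_mult_distr.
  replace ((-1) ^ j * v ^ j / INR (fact j)) with ((-1) ^ j / INR (fact j) * v ^ j) by (unfold Rdiv; ring).
  rewrite RtoC_mult. ring.
Qed.

Lemma lower_gamma_lim (tau c v : R) : 0 < tau ->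
  Ctends (Csum (lower_gamma_term tau c v)) eventually (lower_gamma tau c v).
Proof.
  intros Ht. destruct (lower_gamma_CV tau c v Ht) as [H1 H2].
  assert (H : forall a, Rbar_lt (Rabs v) (CV_radius a) -> is_lim_seq (Rsum (fun j => a j * v ^ j)) (PSeries a v)).
  { intros a Ha. apply is_lim_seq_Rsum. apply is_pseries_R. apply PSeries_correct, CV_radius_inside, Ha. }
  split.
  - apply (is_lim_seq_ext _ _ _) with (2 := H _ H1). intros n. rewrite Re_Csum. apply Rsum_ext.
    intros k _. rewrite lower_gamma_term_eq. symmetry; apply re_scal_r.
  - apply (is_lim_seq_ext _ _ _) with (2 := H _ H2). intros n. rewrite Im_Csum. apply Rsum_ext.
    intros k _. rewrite lower_gamma_term_eq. symmetry; apply im_scal_r.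
Qed.

Lemma lower_gamma_derive (tau c v : R) : 0 < tau ->
  is_derive_C (lower_gamma tau c) v (- lower_gamma tau (c + 1) v)%C.
Proof.
  intros Ht. destruct (lower_gamma_CV tau c v Ht) as [H1 H2].
  assert (E : forall j, (RtoC (INR (S j)) * lower_gamma_coef tau c (S j) = - lower_gamma_coef tau (c + 1) j)%C).
  { intros j. unfold lower_gamma_coef. replace (c + INR (S j)) with (c + 1 + INR j) by (rewrite S_INR; ring).
    rewrite fact_simpl, mult_INR. simpl pow.
    assert (INR (S j) <> 0) by (apply not_0_INR; lia). pose proof (INR_fact_neq_0 j).
    replace (-1 * (-1) ^ j / (INR (S j) * INR (fact j))) with (- ((-1) ^ j / INR (fact j)) * / INR (S j)) by (field; auto).
    rewrite RtoC_mult, RtoC_opp, RtoC_inv by assumption. field.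
    split; [apply pair_neq_0, Ht|]. intros H3. apply RtoC_inj in H3. auto. }
  apply is_derive_C_intro; simpl.
  - eapply is_derive_eq; [apply is_derive_PSeries, H1|].
    rewrite <- PSeries_opp. apply PSeries_ext. intros j. unfold PS_derive, PS_opp.
    change (INR (S j) * Re (lower_gamma_coef tau c (S j)) = - Re (lower_gamma_coef tau (c + 1) j)).
    rewrite <- re_scal_l, E. reflexivity.
  - eapply is_derive_eq; [apply is_derive_PSeries, H2|].
    rewrite <- PSeries_opp. apply PSeries_ext. intros j. unfold PS_derive, PS_opp.
    change (INR (S j) * Im (lower_gamma_coef tau c (S j)) = - Im (lower_gamma_coef tau (c + 1) j)).
    rewrite <- im_scal_l, E. reflexivity.
Qed.

Lemma exp_term_S (v : R) (j : nat) : INR (S j) * exp_term v (S j) = v * exp_term v j.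
Proof.
  unfold exp_term. rewrite fact_simpl, mult_INR. simpl pow. field.
  split; [apply INR_fact_neq_0|apply not_0_INR; lia].
Qed.

(** With s = c + i tau this is the recurrence gamma(s + 1, v) = s gamma(s, v) - v^s e^(-v) divided
    by v^s. It holds exactly for partial sums, with n + 1 terms on the left and n in the shifted
    series on the right. *)
Lemma lower_gamma_rec (tau c v : R) : 0 < tau ->
  (Cpair c tau * lower_gamma tau c v = RtoC (exp (- v)) + RtoC v * lower_gamma tau (c + 1) v)%C.
Proof.
  intros Ht.
  assert (A : forall n, (Cpair c tau * Csum (lower_gamma_term tau c v) (S n) =
    RtoC (Rsum (exp_term (- v)) (S n)) + RtoC v * Csum (lower_gamma_term tau (c + 1) v) n)%C).
  { induction n as [|n IH].
    - simpl. unfold lower_gamma_term, exp_term. simpl. rewrite Rplus_0_r. 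
      replace (0 + 1 / 1) with 1 by field. replace (1 / 1) with 1 by field. field. apply pair_neq_0, Ht.
    - change (Csum (lower_gamma_term tau c v) (S (S n))) with (Csum (lower_gamma_term tau c v) (S n) + lower_gamma_term tau c v (S n))%C.
      rewrite Cmult_plus_distr_l, IH.
      change (Rsum (exp_term (- v)) (S (S n))) with (Rsum (exp_term (- v)) (S n) + exp_term (- v) (S n)).
      change (Csum (lower_gamma_term tau (c + 1) v) (S n)) with (Csum (lower_gamma_term tau (c + 1) v) n + lower_gamma_term tau (c + 1) v n)%C.
      rewrite RtoC_plus. unfold lower_gamma_term at 2 4.
      replace (c + 1 + INR n) with (c + INR (S n)) by (rewrite S_INR; ring).
      assert (E : (RtoC v * RtoC (exp_term (- v) n) = - RtoC (INR (S n)) * RtoC (exp_term (- v) (S n)))%C).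
      { rewrite <- RtoC_opp, <- !RtoC_mult. f_equal. pose proof (exp_term_S (- v) n). lra. }
      rewrite Cmult_plus_distr_l, (Cmult_assoc (RtoC v)), E.
      replace (Cpair c tau) with (Cpair (c + INR (S n)) tau - RtoC (INR (S n)))%C by (apply C_eq; simpl; ring).
      field. apply pair_neq_0, Ht. }
  apply (Ctends_unique eventually (fun n => Cpair c tau * Csum (lower_gamma_term tau c v) (S n))%C).
  - apply (Ctends_mult eventually (fun _ => Cpair c tau)); [apply (Ctends_const eventually)|].
    apply (Ctends_shift (Csum (lower_gamma_term tau c v))), lower_gamma_lim, Ht.
  - refine (Ctends_ext eventually _ _ _ (fun n => eq_sym (A n)) _).
    apply (Ctends_plus eventually (fun n => RtoC (Rsum (exp_term (- v)) (S n)))).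
    + apply (Ctends_RtoC eventually). exact (proj1 (is_lim_seq_incr_1 (Rsum (exp_term (- v))) (exp (- v))) (exp_sum_lim (- v))).
    + apply (Ctends_mult eventually (fun _ => RtoC v)); [apply (Ctends_const eventually)|apply lower_gamma_lim, Ht].
Qed.

Lemma lower_gamma_tail (tau c v : R) (n : nat) : 0 < tau -> 0 <= v ->
  Cmod (lower_gamma tau c v - Csum (lower_gamma_term tau c v) n) <= (exp v - Rsum (exp_term v) n) / tau.
Proof.
  intros Ht Hv. unfold Rdiv. rewrite Rmult_minus_distr_r, Rsum_mult_r.
  apply Csum_tail.
  - intros k. unfold lower_gamma_term. rewrite Cmod_mult, Cmod_R, Rabs_exp_term, Rabs_Ropp, Rabs_pos_eq by exact Hv.
    apply Rmult_le_compat_l; [apply exp_term_pos, Hv|].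
    rewrite Cmod_inv by (apply pair_neq_0, Ht). apply Rinv_le_contravar; [exact Ht|apply Cmod_pair_ge, Ht].
  - apply lower_gamma_lim, Ht.
  - apply (is_lim_seq_ext (fun n => Rsum (exp_term v) n * / tau)); [intros; apply Rsum_mult_r|].
    apply is_lim_seq_mult'; [apply exp_sum_lim|apply is_lim_seq_const].
Qed.

Lemma is_derive_C_comp_exp (f : R -> C) (t : R) (l : C) :
  is_derive_C f (exp t) l -> is_derive_C (fun t => f (exp t)) t (RtoC (exp t) * l)%C.
Proof.
  intros H. apply is_derive_C_comp; [exact H|]. apply is_derive_Reals, derivable_pt_lim_exp.
Qed.

(** In the variable t = log v, the lower incomplete gamma function is exp(zt) p_0(e^t), and u^(z -
    1) e^(-u) du becomes exp(zt) e^(-e^t) dt, without any complex power. *)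
Lemma lower_gamma_exp_derive (tau t : R) : 0 < tau ->
  is_derive_C (fun t => Cexp (Cpair 0 tau * RtoC t) * lower_gamma tau 0 (exp t))%C t
    (Cexp (Cpair 0 tau * RtoC t) * RtoC (exp (- exp t)))%C.
Proof.
  intros Ht. eapply is_derive_C_eq.
  - apply (is_derive_C_mult (fun t => Cexp (Cpair 0 tau * RtoC t)) (fun t => lower_gamma tau 0 (exp t))).
    + apply is_derive_Cexp_lin.
    + apply is_derive_C_comp_exp, lower_gamma_derive, Ht.
  - pose proof (lower_gamma_rec tau 0 (exp t) Ht) as E.
    transitivity (Cexp (Cpair 0 tau * RtoC t) * (Cpair 0 tau * lower_gamma tau 0 (exp t) - RtoC (exp t) * lower_gamma tau (0 + 1) (exp t)))%C; [ring|].
    rewrite E. ring.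
Qed.

(* [w^(c + i tau)] times this is [int_0^w u^(c + i tau - 1) (1 - u)^n du]. *)
Fixpoint lower_beta (tau : R) (n : nat) (c w : R) : C :=
  match n with
  | O => (/ Cpair c tau)%C
  | S k => ((RtoC ((1 - w) ^ n) + RtoC (INR n * w) * lower_beta tau k (c + 1) w) / Cpair c tau)%C
  end.

Lemma lower_beta_0 (tau : R) (n : nat) (c : R) : lower_beta tau n c 0 = (/ Cpair c tau)%C.
Proof.
  destruct n as [|n]; [reflexivity|]. cbn [lower_beta]. rewrite Rmult_0_r, Rminus_0_r, pow1.
  unfold Cdiv. ring.
Qed.

Lemma pochhammer_shift (a : C) (n : nat) : pochhammer a (S n) = (a * pochhammer (a + RtoC 1) n)%C.
Proof.
  induction n as [|n IH]; [simpl; ring|].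
  change (pochhammer a (S (S n))) with (pochhammer a (S n) * (a + RtoC (INR (S n))))%C.
  rewrite IH, S_INR, RtoC_plus. simpl. ring.
Qed.

Lemma Cpair_plus_1 (c tau : R) : (Cpair c tau + RtoC 1)%C = Cpair (c + 1) tau.
Proof. apply C_eq; simpl; ring. Qed.

(** Euler's beta integral B(s, n + 1) at s = c + i tau. For c = 0, rescaling the variable by n turns
    it into Gauss's product. *)
Lemma lower_beta_1 (tau : R) (n : nat) (c : R) : 0 < tau ->
  lower_beta tau n c 1 = (RtoC (INR (fact n)) / pochhammer (Cpair c tau) (S n))%C.
Proof.
  intros Ht. revert c. induction n as [|n IH]; intros c.
  - simpl. replace (Cpair c tau + RtoC 0)%C with (Cpair c tau) by ring. field. apply pair_neq_0, Ht.
  - cbn [lower_beta]. rewrite IH, (pochhammer_shift _ (S n)), Cpair_plus_1, Rmult_1_r.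
    rewrite Rminus_diag, pow_i by lia. rewrite fact_simpl, mult_INR, RtoC_mult.
    pose proof (pochhammer_neq_0 (c + 1) tau (S n) Ht). pose proof (pair_neq_0 c tau Ht).
    change (Cpair c tau <> 0) in H0. field. split; assumption.
Qed.

Lemma lower_beta_ex_derive (tau : R) (n : nat) (c w : R) : exists l, is_derive_C (lower_beta tau n c) w l.
Proof.
  revert c. induction n as [|n IH]; intros c.
  - eexists. apply (is_derive_C_const (/ Cpair c tau)%C).
  - destruct (IH (c + 1)) as [l Hl]. eexists. cbn [lower_beta].
    apply (is_derive_C_mult (fun w => RtoC ((1 - w) ^ S n) + RtoC (INR (S n) * w) * lower_beta tau n (c + 1) w)%C (fun _ => / Cpair c tau)%C).
    + apply (is_derive_C_plus (fun w => RtoC ((1 - w) ^ S n))).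
      * apply (is_derive_C_RtoC (fun w => (1 - w) ^ S n)). auto_derive; [auto|reflexivity].
      * apply (is_derive_C_mult (fun w => RtoC (INR (S n) * w))); [|exact Hl].
        apply (is_derive_C_RtoC (fun w => INR (S n) * w)). auto_derive; [auto|reflexivity].
    + apply is_derive_C_const.
Qed.

Lemma lower_beta_exp_derive (tau : R) (n : nat) (c t : R) : 0 < tau ->
  is_derive_C (fun t => Cexp (Cpair c tau * RtoC t) * lower_beta tau n c (exp t))%C t
    (Cexp (Cpair c tau * RtoC t) * RtoC ((1 - exp t) ^ n))%C.
Proof.
  intros Ht. revert c. induction n as [|n IH]; intros c; pose proof (pair_neq_0 c tau Ht) as Hz.
  - eapply is_derive_C_eq.
    + apply (is_derive_C_mult (fun t => Cexp (Cpair c tau * RtoC t)) (fun t => / Cpair c tau)%C).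
      * apply is_derive_Cexp_lin.
      * apply is_derive_C_const.
    + simpl. field. exact Hz.
  - apply (is_derive_ext (V := C_R_NormedModule) (fun t => / Cpair c tau *
      (Cexp (Cpair c tau * RtoC t) * RtoC ((1 - exp t) ^ S n) + RtoC (INR (S n)) * (Cexp (Cpair (c + 1) tau * RtoC t) * lower_beta tau n (c + 1) (exp t))))%C).
    { intros u. cbn [lower_beta]. rewrite <- Cpair_plus_1, Cmult_plus_distr_r, Cmult_1_l, Cexp_plus, Cexp_RtoC, RtoC_mult.
      match goal with |- @eq _ ?a ?b => change (@eq C a b) end.
      field. exact Hz. }
    eapply is_derive_C_eq.
    + apply (is_derive_C_mult (fun _ => / Cpair c tau)%C); [apply is_derive_C_const|].
      apply (is_derive_C_plus (fun t => Cexp (Cpair c tau * RtoC t) * RtoC ((1 - exp t) ^ S n))%C).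
      * apply (is_derive_C_mult (fun t => Cexp (Cpair c tau * RtoC t))); [apply is_derive_Cexp_lin|].
        apply (is_derive_C_RtoC (fun t => (1 - exp t) ^ S n) t (- exp t * (INR (S n) * (1 - exp t) ^ n))).
        auto_derive; [auto|]. change (Nat.pred (S n)) with n.
        replace (match n with 0%nat => 1 | S _ => INR n + 1 end) with (INR (S n)) by reflexivity. unfold Rminus. ring.
      * apply (is_derive_C_mult (fun _ => RtoC (INR (S n)))); [apply is_derive_C_const|]. apply IH.
    + cbn [Nat.pred]. rewrite <- Cpair_plus_1, Cmult_plus_distr_r, Cmult_1_l, Cexp_plus, Cexp_RtoC.
      rewrite !RtoC_mult, RtoC_opp. field. exact Hz.
Qed.

(** * Comparison of the incomplete gamma function with Gauss's product *)

Lemma bernoulli_le (u : R) (n : nat) : 0 <= u <= 1 -> 1 - INR n * u <= (1 - u) ^ n.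
Proof.
  intros Hu. induction n as [|n IH]; [simpl; lra|].
  rewrite S_INR. simpl pow. assert (0 <= INR n) by apply pos_INR.
  destruct (Rle_dec (1 - INR n * u) 0).
  - assert (0 <= (1 - u) * (1 - u) ^ n) by (apply Rmult_le_pos; [|apply pow_le]; lra). nra.
  - apply Rle_trans with ((1 - u) * (1 - INR n * u)); [nra|]. apply Rmult_le_compat_l; lra.
Qed.

(** Since e^(v/n) >= 1 + v/n, the product e^v (1 - v/n)^n is at least (1 - v^2/n^2)^n, and
    Bernoulli's inequality bounds this below by 1 - v^2/n. *)
Lemma exp_pow_approx (v : R) (n : nat) : (1 <= n)%nat -> 0 <= v <= INR n ->
  0 <= exp (- v) - (1 - v / INR n) ^ n <= v ^ 2 * exp (- v) / INR n.
Proof.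
  intros Hn Hv. assert (HN : 1 <= INR n) by (apply (le_INR 1); exact Hn).
  set (N := INR n) in *.
  assert (Hu : 0 <= v / N <= 1) by (split; [apply Rdiv_le_0_compat; lra|apply Rle_div_l; lra]).
  assert (Ep : forall x, exp x ^ n = exp (N * x)).
  { intros x. unfold N. rewrite <- Rpower_pow by apply exp_pos. unfold Rpower. rewrite ln_exp. reflexivity. }
  split.
  - enough ((1 - v / N) ^ n <= exp (- v)) by lra.
    replace (- v) with (N * (- (v / N))) by (field; lra). rewrite <- Ep.
    apply pow_incr. pose proof (exp_ineq1_le (- (v / N))). lra.
  - assert (A : 1 - v ^ 2 / N <= exp v * (1 - v / N) ^ n).
    { apply Rle_trans with ((1 - (v / N) ^ 2) ^ n).
      - replace (v ^ 2 / N) with (N * (v / N) ^ 2) by (field; lra). apply bernoulli_le. nra.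
      - replace (exp v) with (exp (v / N) ^ n) by (rewrite Ep; f_equal; field; lra).
        rewrite <- Rpow_mult_distr. apply pow_incr. split; [nra|].
        pose proof (exp_ineq1_le (v / N)). nra. }
    pose proof (exp_pos (- v)) as P.
    assert (E : exp (- v) * exp v = 1) by (rewrite <- exp_plus, Rplus_opp_l; apply exp_0).
    apply (Rmult_le_compat_l (exp (- v))) in A; [|lra].
    rewrite <- Rmult_assoc, E in A. unfold Rdiv in *. lra.
Qed.

(** Formally the two terms are the integrals of u^(z-1) e^(-u) and u^(z-1) (1 - u/n)^n over [0, n].
    Each diverges at 0, but the difference converges: with u = e^t it is dominated by u^2 e^(-u) / n
    dt, whose antiderivative -(1 + u) e^(-u) / n varies by at most 1 / n. *)
Lemma lower_gamma_asympt (tau : R) (n : nat) : 0 < tau -> (1 <= n)%nat ->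
  Cmod (Cexp (Cpair 0 tau * RtoC (ln (INR n))) * lower_gamma tau 0 (INR n)
    - RtoC (INR (fact n)) * Cexp (Cpair 0 tau * RtoC (ln (INR n))) / pochhammer (Cpair 0 tau) (S n)) <= / INR n.
Proof.
  intros Ht Hn. assert (HN : 1 <= INR n) by (apply (le_INR 1); exact Hn).
  set (N := INR n) in *. set (z := Cpair 0 tau).
  set (Rr := fun t => (Cexp (z * RtoC t) * (lower_gamma tau 0 (exp t) - lower_beta tau n 0 (exp (t - ln N))))%C).
  assert (D : forall t, is_derive_C Rr t (Cexp (z * RtoC t) * RtoC (exp (- exp t) - (1 - exp t / N) ^ n))%C).
  { intros t.
    apply (is_derive_ext (V := C_R_NormedModule) (fun t => Cexp (z * RtoC t) * lower_gamma tau 0 (exp t) -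
       Cexp (z * RtoC (ln N)) * (Cexp (z * RtoC (t - ln N)) * lower_beta tau n 0 (exp (t - ln N))))%C).
    { intros u. unfold Rr. match goal with |- @eq _ ?a ?b => change (@eq C a b) end.
      replace (z * RtoC u)%C with (z * RtoC (ln N) + z * RtoC (u - ln N))%C by (rewrite RtoC_minus; ring).
      rewrite Cexp_plus. ring. }
    eapply is_derive_C_eq.
    - apply (is_derive_C_minus (fun t => Cexp (z * RtoC t) * lower_gamma tau 0 (exp t))%C); [apply lower_gamma_exp_derive, Ht|].
      apply (is_derive_C_mult (fun _ => Cexp (z * RtoC (ln N)))); [apply is_derive_C_const|].
      apply (is_derive_C_comp (fun t => Cexp (z * RtoC t) * lower_beta tau n 0 (exp t))%C (fun t => t - ln N) t 1).
      + apply lower_beta_exp_derive, Ht.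
      + auto_derive; [auto|ring].
    - replace (exp (t - ln N)) with (exp t / N) by (unfold Rminus; rewrite exp_plus, exp_Ropp, exp_ln by lra; reflexivity).
      rewrite (RtoC_minus (exp (- exp t))). fold z.
      replace (Cexp (z * RtoC t)) with (Cexp (z * RtoC (ln N)) * Cexp (z * RtoC (t - ln N)))%C
        by (rewrite <- Cexp_plus; f_equal; rewrite RtoC_minus; ring).
      ring. }
  assert (B : forall L, 0 < L -> Cmod (Rr (ln N) - Rr (- L)) <= / N).
  { intros L HL.
    assert (Hln : 0 <= ln N) by (rewrite <- ln_1; destruct HN as [H|H]; [left; apply ln_increasing; lra|rewrite H; lra]).
    pose proof (is_RInt_C_derive Rr (fun t => Cexp (z * RtoC t) * RtoC (exp (- exp t) - (1 - exp t / N) ^ n))%C (- L) (ln N)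
      (fun t _ => D t)) as H.
    eapply Rle_trans; [apply (Cmod_RInt_le (fun t => Cexp (z * RtoC t) * RtoC (exp (- exp t) - (1 - exp t / N) ^ n))%C
       (fun t => exp t ^ 2 * exp (- exp t) / N) (- L) (ln N) _
       (- (1 + exp (ln N)) * exp (- exp (ln N)) / N - - (1 + exp (- L)) * exp (- exp (- L)) / N))|].
    - lra.
    - intros t Ht'. rewrite Cmod_mult, Cmod_Cexp, Cmod_R. simpl Re. unfold Re, Im; simpl.
      replace (0 * t - tau * 0) with 0 by ring. rewrite exp_0, Rmult_1_l.
      destruct (exp_pow_approx (exp t) n Hn) as [A1 A2].
      + split; [left; apply exp_pos|]. fold N. rewrite <- (exp_ln N) by lra. apply exp_le_mono. lra.
      + fold N in A1, A2. rewrite Rabs_pos_eq by exact A1. exact A2.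
    - apply H. intros t _. apply continuous_C_intro.
      apply (Ctends_mult (locally t) (fun t => Cexp (z * RtoC t))).
      + eapply Ctends_of_derive, is_derive_Cexp_lin.
      + apply (Ctends_RtoC (locally t)). apply (ex_derive_continuous (V := R_NormedModule) (fun t => exp (- exp t) - (1 - exp t / N) ^ n)).
        auto_derive. auto.
    - apply (is_RInt_R_derive (fun t => - (1 + exp t) * exp (- exp t) / N)); [lra| |].
      + intros t _. auto_derive; [auto|]. field. lra.
      + intros t _. apply (ex_derive_continuous (V := R_NormedModule)). auto_derive. auto.
    - assert (A : (1 + exp (- L)) * exp (- exp (- L)) <= 1).
      { set (q := exp (- L)). rewrite (exp_Ropp q). pose proof (exp_ineq1_le q). pose proof (exp_pos q).
        apply (Rmult_le_reg_r (exp q)); [assumption|].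
        rewrite Rmult_assoc, Rinv_l, Rmult_1_r, Rmult_1_l by lra. assumption. }
      assert (A2 : 0 <= (1 + exp (ln N)) * exp (- exp (ln N))) by (apply Rmult_le_pos; [pose proof (exp_pos (ln N)); lra|left; apply exp_pos]).
      assert (0 < / N) by (apply Rinv_0_lt_compat; lra).
      unfold Rdiv. nra. }
  (* The factor exp(-zL) keeps modulus 1 and has no limit, but it multiplies the difference of two
     functions that are both 1 / z at 0. *)
  assert (Lm : Ctends (fun L : R => Rr (ln N) - Rr (- L)%R)%C (Rbar_locally p_infty) (Rr (ln N))).
  { replace (Rr (ln N)) with (Rr (ln N) - RtoC 0)%C at 1 by ring.
    apply (Ctends_minus (Rbar_locally p_infty)); [apply (Ctends_const (Rbar_locally p_infty))|].
    assert (He : filterlim (fun L => exp (- L)) (Rbar_locally p_infty) (locally 0)).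
    { apply (filterlim_comp _ _ _ (fun L => - L) exp _ (Rbar_locally m_infty)).
      - apply (filterlim_Rbar_opp p_infty).
      - apply is_lim_exp_m. }
    assert (H0 : Ctends (fun L : R => lower_gamma tau 0 (exp (- L)) - lower_beta tau n 0 (exp (- L) * / N))%C (Rbar_locally p_infty)
       (lower_gamma tau 0 0 - lower_beta tau n 0 (0 * / N))%C).
    { apply (Ctends_minus (Rbar_locally p_infty)).
      - apply (Ctends_comp (Rbar_locally p_infty) (locally 0) (fun L => exp (- L)) (lower_gamma tau 0)); [exact He|].
        eapply Ctends_of_derive, lower_gamma_derive, Ht.
      - apply (Ctends_comp (Rbar_locally p_infty) (locally (0 * / N)) (fun L => exp (- L) * / N) (lower_beta tau n 0)).
        + apply (Rlim_mult (Rbar_locally p_infty)); [exact He|apply filterlim_const].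
        + destruct (lower_beta_ex_derive tau n 0 (0 * / N)) as [l Hl]. eapply Ctends_of_derive, Hl. }
    rewrite Rmult_0_l, lower_beta_0 in H0.
    assert (E0 : lower_gamma tau 0 0 = (/ Cpair 0 tau)%C).
    { pose proof (lower_gamma_rec tau 0 0 Ht) as E. rewrite Ropp_0, exp_0 in E.
      replace (RtoC 1 + RtoC 0 * lower_gamma tau (0 + 1) 0)%C with (RtoC 1) in E by ring.
      apply (f_equal (fun w => / Cpair 0 tau * w)%C) in E. rewrite Cmult_assoc, Cinv_l, Cmult_1_l, Cmult_1_r in E by (apply pair_neq_0, Ht). exact E. }
    rewrite E0 in H0. replace (/ Cpair 0 tau - / Cpair 0 tau)%C with (RtoC 0) in H0 by ring.
    apply Ctends_Cmod in H0; [|apply Rbar_locally_filter].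
    apply (Ctends_of_Cmod (Rbar_locally p_infty)) with (2 := H0).
    apply filter_forall. intros L. unfold Rr.
    replace (exp (- L - ln N)) with (exp (- L) * / N) by (unfold Rminus; rewrite exp_plus, (exp_Ropp (ln N)), exp_ln by lra; reflexivity).
    unfold Cminus at 1. rewrite Copp_0, Cplus_0_r. rewrite Cmod_mult, Cmod_Cexp.
    replace (Re (z * RtoC (- L))) with 0 by (simpl; ring). rewrite exp_0, Rmult_1_l.
    right. f_equal. ring. }
  replace (_ - _)%C with (Rr (ln N) - RtoC 0)%C.
  - apply (Ctends_Cmod_le (Rbar_locally p_infty) _ _ (RtoC 0) (/ N) Lm).
    exists 0. intros L HL. replace (Rr (ln N) - Rr (- L)%R - RtoC 0)%C with (Rr (ln N) - Rr (- L)%R)%C by ring. apply B, HL.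
  - unfold Rr. rewrite Rminus_diag, exp_0, lower_beta_1, exp_ln by (exact Ht || lra). fold z. unfold Cdiv. ring.
Qed.

(** Beyond t = log n the function moves by at most the integral of e^(-s) from log n on, that is 1 /
    n. With [lower_gamma_asympt] it stays within 2 / n of Gauss's product, so both have the same
    limit. *)
Lemma lower_gamma_limit (tau : R) (mu : C) : 0 < tau ->
  (forall n, Cmod (mu - mu_sum tau (S n)) <= / (12 * INR (S n))) ->
  Ctends (fun t => Cexp (Cpair 0 tau * RtoC t) * lower_gamma tau 0 (exp t))%C (Rbar_locally p_infty) (Gamma_imag tau mu).
Proof.
  intros Ht Hmu. set (z := Cpair 0 tau).
  set (w := fun t => (Cexp (z * RtoC t) * lower_gamma tau 0 (exp t))%C).
  set (g := fun n => (RtoC (INR (fact n)) * Cexp (z * RtoC (ln (INR n))) / pochhammer z (S n))%C).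
  pose proof (Gamma_imag_limit tau mu Ht Hmu) as HG. fold z in HG.
  change (Ctends g eventually (Gamma_imag tau mu)) in HG.
  assert (Hw : forall n, (1 <= n)%nat -> forall t, ln (INR n) < t -> Cmod (w t - g n) <= 2 * / (1 * INR n)).
  { intros n Hn t Hnt. assert (HN : 1 <= INR n) by (apply (le_INR 1); exact Hn). rewrite Rmult_1_l.
    pose proof (lower_gamma_asympt tau n Ht Hn) as A. fold z in A. fold (g n) in A.
    replace (Cexp (z * RtoC (ln (INR n))) * lower_gamma tau 0 (INR n))%C with (w (ln (INR n))) in A
      by (unfold w; rewrite exp_ln by lra; reflexivity).
    assert (B : Cmod (w t - w (ln (INR n))) <= / INR n).
    { eapply Rle_trans; [apply (Cmod_RInt_le (fun t => Cexp (z * RtoC t) * RtoC (exp (- exp t)))%C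
        (fun t => exp (- t)) (ln (INR n)) t _ (- exp (- t) - - exp (- ln (INR n))))|].
      - lra.
      - intros s Hs. rewrite Cmod_mult, Cmod_Cexp, Cmod_R.
        replace (Re (z * RtoC s)) with 0 by (simpl; ring). rewrite exp_0, Rmult_1_l, Rabs_pos_eq by (left; apply exp_pos).
        apply exp_le_mono. pose proof (exp_ineq1_le s). lra.
      - apply (is_RInt_C_derive w).
        + intros s _. apply lower_gamma_exp_derive, Ht.
        + intros s _. apply continuous_C_intro. apply (Ctends_mult (locally s) (fun t => Cexp (z * RtoC t))).
          * eapply Ctends_of_derive, is_derive_Cexp_lin.
          * apply (Ctends_RtoC (locally s)). apply (ex_derive_continuous (V := R_NormedModule) (fun t => exp (- exp t))).
            auto_derive. auto.
      - apply (is_RInt_R_derive (fun t => - exp (- t))); [lra| |].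
        + intros s _. auto_derive; [auto|]. ring.
        + intros s _. apply (ex_derive_continuous (V := R_NormedModule)). auto_derive. auto.
      - rewrite (exp_Ropp (ln (INR n))), exp_ln by lra. pose proof (exp_pos (- t)). lra. }
    replace (w t - g n)%C with ((w t - w (ln (INR n))) + (w (ln (INR n)) - g n))%C by ring.
    eapply Rle_trans; [apply Cmod_triangle|]. lra. }
  assert (He : is_lim_seq (fun n => 2 * / (1 * INR n)) 0).
  { replace (Finite 0) with (Finite (2 * 0)) by (f_equal; ring).
    apply is_lim_seq_mult'; [apply is_lim_seq_const|apply lim_seq_inv_scal; lra]. }
  destruct (Ctends_approx (Rbar_locally p_infty) w (fun n _ => g (S n)) (fun n => g (S n)) (fun n => 2 * / (1 * INR (S n)))) as [l [H1 H2]].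
  - intros n. exists (ln (INR (S n))). apply Hw. lia.
  - intros n. apply (Ctends_const (Rbar_locally p_infty)).
  - apply (is_lim_seq_incr_1 (fun n => 2 * / (1 * INR n))). exact He.
  - replace (Gamma_imag tau mu) with l; [exact H1|].
    apply (Ctends_unique eventually g); [|exact HG].
    apply (Ctends_of_Cmod eventually) with (2 := He). exists 1%nat. intros [|n] Hn; [lia|].
    rewrite <- Cmod_opp. replace (- (g (S n) - l))%C with (l - g (S n))%C by ring. apply H2.
Qed.

(** * The Macdonald function as a power series *)

(** By u = a e^t, its integral over t > 0 is a^(m - z) times the upper incomplete gamma function at
    (z - m, a), with z = i tau. *)
Definition upper_gamma_integrand (tau a : R) (m : nat) (t : R) : C :=
  (Cexp (Cpair (- INR m) tau * RtoC t) * RtoC (exp (- (a * exp t))))%C.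

Lemma Ctends_upper_gamma_integrand (tau a : R) (m : nat) (t : R) :
  Ctends (upper_gamma_integrand tau a m) (locally t) (upper_gamma_integrand tau a m t).
Proof.
  apply (Ctends_mult (locally t) (fun t => Cexp (Cpair (- INR m) tau * RtoC t))).
  - eapply Ctends_of_derive, is_derive_Cexp_lin.
  - apply (Ctends_RtoC (locally t)).
    apply (ex_derive_continuous (V := R_NormedModule) (fun t => exp (- (a * exp t)))). auto_derive. auto.
Qed.

Lemma upper_gamma_is_RInt (tau a T : R) (m : nat) :
  is_RInt_C (upper_gamma_integrand tau a m) 0 T (CRInt (upper_gamma_integrand tau a m) 0 T).
Proof.
  destruct (ex_RInt_C_continuous (upper_gamma_integrand tau a m) 0 T) as [l Hl].
  - intros t _. apply Ctends_upper_gamma_integrand.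
  - rewrite (CRInt_eq _ _ _ _ Hl). exact Hl.
Qed.

Lemma upper_gamma_rec (tau a T : R) (m : nat) :
  (Cpair (- INR (S m)) tau * CRInt (upper_gamma_integrand tau a (S m)) 0 T =
   RtoC a * CRInt (upper_gamma_integrand tau a m) 0 T +
   (upper_gamma_integrand tau a (S m) T - RtoC (exp (- a))))%C.
Proof.
  set (I := fun m => CRInt (upper_gamma_integrand tau a m) 0 T).
  set (c := Cpair (- INR (S m)) tau).
  assert (H : is_RInt_C (fun t => c * upper_gamma_integrand tau a (S m) t - RtoC a * upper_gamma_integrand tau a m t)%C 0 T
    (upper_gamma_integrand tau a (S m) T - upper_gamma_integrand tau a (S m) 0)%C).
  { apply (is_RInt_C_derive (upper_gamma_integrand tau a (S m))).
    - intros t _. eapply is_derive_C_eq.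
      + apply (is_derive_C_mult (fun t => Cexp (c * RtoC t)) (fun t => RtoC (exp (- (a * exp t))))).
        * apply is_derive_Cexp_lin.
        * apply (is_derive_C_RtoC (fun t => exp (- (a * exp t))) t (- (a * exp t) * exp (- (a * exp t)))).
          auto_derive; [auto|ring].
      + unfold upper_gamma_integrand.
        replace (Cpair (- INR m) tau * RtoC t)%C with (c * RtoC t + RtoC t)%C
          by (unfold c; rewrite S_INR; apply C_eq; simpl; ring).
        rewrite Cexp_plus, Cexp_RtoC, !RtoC_mult, RtoC_opp, RtoC_mult. fold c. ring.
    - intros t _. apply continuous_C_intro.
      apply (Ctends_minus (locally t) (fun t => c * upper_gamma_integrand tau a (S m) t)%C);
      apply (Ctends_mult (locally t) (fun _ => _)); try apply (Ctends_const (locally t)); apply Ctends_upper_gamma_integrand. }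
  pose proof (is_RInt_C_minus _ _ _ _ _ _ (is_RInt_C_mult c _ _ _ _ (upper_gamma_is_RInt tau a T (S m)))
    (is_RInt_C_mult (RtoC a) _ _ _ _ (upper_gamma_is_RInt tau a T m))) as H2.
  pose proof (RInt_C_unique _ _ _ _ _ H H2) as E.
  replace (RtoC (exp (- a))) with (upper_gamma_integrand tau a (S m) 0).
  - rewrite E. ring.
  - unfold upper_gamma_integrand. rewrite Cmult_0_r, Cexp_0, exp_0, Rmult_1_r. ring.
Qed.

Lemma upper_gamma_0 (tau a T : R) : 0 < tau -> 0 < a ->
  CRInt (upper_gamma_integrand tau a 0) 0 T =
  (Cexp (- (Cpair 0 tau * RtoC (ln a))) *
    (Cexp (Cpair 0 tau * RtoC (T + ln a)) * lower_gamma tau 0 (exp (T + ln a))) - lower_gamma tau 0 a)%C.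
Proof.
  intros Ht Ha. set (z := Cpair 0 tau).
  set (w := fun s => (Cexp (z * RtoC s) * lower_gamma tau 0 (exp s))%C).
  assert (H : is_RInt_C (upper_gamma_integrand tau a 0) 0 T
    (Cexp (- (z * RtoC (ln a))) * w (T + ln a)%R - Cexp (- (z * RtoC (ln a))) * w (0 + ln a)%R)%C).
  { apply (is_RInt_C_derive (fun t => Cexp (- (z * RtoC (ln a))) * w (t + ln a)%R)%C).
    - intros t _. eapply is_derive_C_eq.
      + apply (is_derive_C_mult (fun _ => Cexp (- (z * RtoC (ln a)))) (fun t => w (t + ln a))); [apply is_derive_C_const|].
        apply (is_derive_C_comp w (fun t => t + ln a) t 1); [apply lower_gamma_exp_derive, Ht|].
        auto_derive; [auto|ring].
      + unfold upper_gamma_integrand. rewrite exp_plus, exp_ln by exact Ha. simpl INR. rewrite Ropp_0. fold z.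
        rewrite RtoC_plus, Cmult_plus_distr_l, Cexp_plus, Cexp_opp, (Rmult_comm a). field. apply Cexp_neq_0.
    - intros t _. apply continuous_C_intro, Ctends_upper_gamma_integrand. }
  rewrite (CRInt_eq _ _ _ _ H). unfold w at 2. rewrite Rplus_0_l, exp_ln by exact Ha.
  rewrite Cmult_assoc, <- Cexp_plus.
  replace (- (z * RtoC (ln a)) + z * RtoC (ln a))%C with (RtoC 0) by ring. rewrite Cexp_0. unfold w. ring.
Qed.

Lemma exp_opp_le_inv (y : R) : 0 < y -> exp (- y) <= / y.
Proof.
  intros Hy. rewrite exp_Ropp. apply Rinv_le_contravar; [exact Hy|]. pose proof (exp_ineq1_le y). lra.
Qed.

Lemma pochhammer_neg_neq_0 (tau : R) (m : nat) : 0 < tau -> pochhammer (Cpair 1 (- tau)) m <> RtoC 0.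
Proof.
  intros Ht. induction m as [|m IH]; [apply C1_nz|]. simpl. apply Cmult_neq_0; [exact IH|].
  intros E. apply (f_equal snd) in E. simpl in E. lra.
Qed.

(** Gamma(z - m) is reached from Gamma(z) by induction on m. The recurrences [upper_gamma_rec] and
    [lower_gamma_rec] share the inhomogeneous term e^(-a), so the remaining part only acquires the
    factor a / (z - m - 1) = -a / (m + 1 - z), which builds up (-a)^m / (1 - z)_m. *)
Lemma upper_gamma_limit (tau a : R) (mu : C) (m : nat) : 0 < tau -> 0 < a ->
  (forall n, Cmod (mu - mu_sum tau (S n)) <= / (12 * INR (S n))) ->
  Ctends (fun T => CRInt (upper_gamma_integrand tau a m) 0 T) (Rbar_locally p_infty)
    (Cexp (- (Cpair 0 tau * RtoC (ln a))) * Gamma_imag tau mu * RtoC ((- a) ^ m) / pochhammer (Cpair 1 (- tau)) m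
      - lower_gamma tau (- INR m) a)%C.
Proof.
  intros Ht Ha Hmu. set (z := Cpair 0 tau). set (Y := (Cexp (- (z * RtoC (ln a))) * Gamma_imag tau mu)%C).
  induction m as [|m IH].
  - apply (Ctends_ext (Rbar_locally p_infty) (fun T => Cexp (- (z * RtoC (ln a))) *
      (Cexp (z * RtoC (T + ln a)) * lower_gamma tau 0 (exp (T + ln a))) - lower_gamma tau 0 a)%C);
      [intros T; symmetry; apply upper_gamma_0; assumption|].
    simpl INR. rewrite Ropp_0. simpl pow. simpl pochhammer.
    replace (Y * RtoC 1 / RtoC 1)%C with Y by (field; apply C1_nz).
    apply (Ctends_minus (Rbar_locally p_infty)); [|apply (Ctends_const (Rbar_locally p_infty))].
    apply (Ctends_mult (Rbar_locally p_infty)); [apply (Ctends_const (Rbar_locally p_infty))|].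
    apply (Ctends_comp (Rbar_locally p_infty) (Rbar_locally p_infty) (fun T => T + ln a)
      (fun t => Cexp (z * RtoC t) * lower_gamma tau 0 (exp t))%C); [|apply lower_gamma_limit; assumption].
    intros P [M HM]. exists (M - ln a). intros t Htt. apply HM. lra.
  - set (c := Cpair (- INR (S m)) tau). assert (Hc : c <> RtoC 0) by (apply pair_neq_0, Ht).
    apply (Ctends_ext (Rbar_locally p_infty) (fun T => / c * (RtoC a * CRInt (upper_gamma_integrand tau a m) 0 T +
        (upper_gamma_integrand tau a (S m) T - RtoC (exp (- a)))))%C).
    { intros T. rewrite <- upper_gamma_rec. fold c. field. exact Hc. }
    replace (Y * RtoC ((- a) ^ S m) / pochhammer (Cpair 1 (- tau)) (S m) - lower_gamma tau (- INR (S m)) a)%C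
      with (/ c * (RtoC a * (Y * RtoC ((- a) ^ m) / pochhammer (Cpair 1 (- tau)) m - lower_gamma tau (- INR m) a) + (RtoC 0 - RtoC (exp (- a)))))%C.
    + apply (Ctends_mult (Rbar_locally p_infty)); [apply (Ctends_const (Rbar_locally p_infty))|].
      apply (Ctends_plus (Rbar_locally p_infty)).
      * apply (Ctends_mult (Rbar_locally p_infty)); [apply (Ctends_const (Rbar_locally p_infty))|exact IH].
      * apply (Ctends_minus (Rbar_locally p_infty)); [|apply (Ctends_const (Rbar_locally p_infty))].
        apply (Ctends_of_Cmod (Rbar_locally p_infty)) with (g := fun T => / (a * T)); [|apply lim_inv_scal, Ha].
        exists 0. intros T HT. unfold upper_gamma_integrand. unfold Cminus. rewrite Copp_0, Cplus_0_r, Cmod_mult, Cmod_Cexp, Cmod_R.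
        rewrite Rabs_pos_eq by (left; apply exp_pos).
        replace (Re (Cpair (- INR (S m)) tau * RtoC T)) with (- (INR (S m) * T)) by (cbn -[INR]; ring).
        assert (exp (- (INR (S m) * T)) <= 1).
        { rewrite <- exp_0. apply exp_le_mono. pose proof (pos_INR (S m)). nra. }
        assert (exp (- (a * exp T)) <= / (a * T)).
        { eapply Rle_trans; [|apply exp_opp_le_inv; nra]. apply exp_le_mono. pose proof (exp_ineq1_le T). nra. }
        pose proof (exp_pos (- (INR (S m) * T))). pose proof (exp_pos (- (a * exp T))). nra.
    + pose proof (lower_gamma_rec tau (- INR (S m)) a Ht) as E. fold c in E.
      replace (- INR (S m) + 1) with (- INR m) in E by (rewrite S_INR; ring).
      apply (f_equal (fun w => / c * w)%C) in E. rewrite Cmult_assoc, Cinv_l, Cmult_1_l in E by exact Hc. rewrite E.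
      simpl pochhammer. replace (Cpair 1 (- tau) + RtoC (INR m))%C with (- c)%C
        by (unfold c; rewrite S_INR; apply C_eq; simpl; ring).
      simpl pow. rewrite RtoC_mult, RtoC_opp. field.
      repeat split; first [exact Hc | apply pochhammer_neg_neq_0, Ht].
Qed.

Lemma exp_alternating_tail (a u : R) (n : nat) : 0 <= u <= a ->
  Rabs (exp (- u) - Rsum (exp_term (- u)) n) <= exp a - Rsum (exp_term a) n.
Proof.
  intros Hu. rewrite <- Cmod_R, RtoC_minus, <- Csum_RtoC.
  apply Csum_tail; [|apply (Ctends_ext eventually (fun n => RtoC (Rsum (exp_term (- u)) n)))|apply exp_sum_lim].
  - intros k. rewrite Cmod_R, Rabs_exp_term, Rabs_Ropp, Rabs_pos_eq by lra. apply exp_term_le, Hu.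
  - intros k; symmetry; apply Csum_RtoC.
  - apply (Ctends_RtoC eventually), exp_sum_lim.
Qed.

(** With a = x / 2 its real part is the integrand of [besselK_imag]; cosh is split because only the
    factor exp(- a e^(-t)) is expanded. *)
Definition besselK_integrand (tau a t : R) : C :=
  (Cexp (Cpair 0 tau * RtoC t) * RtoC (exp (- (a * exp t)) * exp (- (a * exp (- t)))))%C.

Lemma besselK_is_RInt (tau a T : R) :
  is_RInt_C (besselK_integrand tau a) 0 T (CRInt (besselK_integrand tau a) 0 T).
Proof.
  destruct (ex_RInt_C_continuous (besselK_integrand tau a) 0 T) as [l Hl].
  - intros t _. apply (Ctends_mult (locally t) (fun t => Cexp (Cpair 0 tau * RtoC t))).
    + eapply Ctends_of_derive, is_derive_Cexp_lin.
    + apply (Ctends_RtoC (locally t)).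
      apply (ex_derive_continuous (V := R_NormedModule) (fun t => exp (- (a * exp t)) * exp (- (a * exp (- t))))). auto_derive. auto.
  - rewrite (CRInt_eq _ _ _ _ Hl). exact Hl.
Qed.

Lemma is_RInt_C_Csum (f : nat -> R -> C) (I : nat -> C) (a b : R) (n : nat) :
  (forall k, is_RInt_C (f k) a b (I k)) -> is_RInt_C (fun t => Csum (fun k => f k t) n) a b (Csum I n).
Proof.
  intros H. induction n as [|n IH]; simpl.
  - pose proof (is_RInt_const (V := C_R_NormedModule) a b (RtoC 0)) as H0.
    rewrite scal_R_Cmult, Cmult_0_r in H0. exact H0.
  - apply is_RInt_C_plus; [exact IH|apply H].
Qed.

(** For t >= 0 the argument a e^(-t) stays in [0, a], so the truncation error of its exponential
    series is uniform in t; the other factor is at most e^(-at), whose integral is at most 1 / a.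
    The bound does not depend on T. *)
Lemma besselK_trunc (tau a T : R) (n : nat) : 0 < a -> 0 < T ->
  Cmod (CRInt (besselK_integrand tau a) 0 T
    - Csum (fun m => RtoC (exp_term (- a) m) * CRInt (upper_gamma_integrand tau a m) 0 T) n)%C
  <= (exp a - Rsum (exp_term a) n) * / a.
Proof.
  intros Ha HT.
  pose proof (is_RInt_C_Csum _ _ 0 T n (fun m => is_RInt_C_mult (RtoC (exp_term (- a) m)) _ _ _ _ (upper_gamma_is_RInt tau a T m))) as H1.
  pose proof (is_RInt_C_minus _ _ _ _ _ _ (besselK_is_RInt tau a T) H1) as H2.
  set (eps := exp a - Rsum (exp_term a) n) in *.
  assert (He : 0 <= eps) by (unfold eps; pose proof (exp_sum_le a n ltac:(lra)); lra).
  eapply Rle_trans; [apply (Cmod_RInt_le _ (fun t => eps * exp (- (a * t))) 0 T _ (- eps * exp (- (a * T)) / a - - eps * exp (- (a * 0)) / a) ltac:(lra)) with (2 := H2)|].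
  - intros t Ht.
    assert (E : Csum (fun m => RtoC (exp_term (- a) m) * upper_gamma_integrand tau a m t)%C n =
      (Cexp (Cpair 0 tau * RtoC t) * RtoC (exp (- (a * exp t))) * RtoC (Rsum (exp_term (- (a * exp (- t)))) n))%C).
    { rewrite <- Csum_RtoC, Csum_mult_l. apply Csum_ext. intros k _. unfold upper_gamma_integrand.
      replace (Cpair (- INR k) tau * RtoC t)%C with (Cpair 0 tau * RtoC t + RtoC (INR k * - t))%C by (apply C_eq; simpl; ring).
      rewrite Cexp_plus, Cexp_RtoC.
      replace (exp (INR k * - t)) with (exp (- t) ^ k)
        by (rewrite <- Rpower_pow by apply exp_pos; unfold Rpower; rewrite ln_exp; reflexivity).
      replace (exp_term (- (a * exp (- t))) k) with (exp_term (- a) k * exp (- t) ^ k).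
      - rewrite (RtoC_mult (exp_term (- a) k)). ring.
      - unfold exp_term. replace (- (a * exp (- t))) with (- a * exp (- t)) by ring. rewrite Rpow_mult_distr.
        field. apply INR_fact_neq_0. }
    rewrite E. unfold besselK_integrand. rewrite RtoC_mult.
    replace (_ - _)%C with (Cexp (Cpair 0 tau * RtoC t) * RtoC (exp (- (a * exp t))) *
       RtoC (exp (- (a * exp (- t))) - Rsum (exp_term (- (a * exp (- t)))) n))%C by (rewrite RtoC_minus; ring).
    rewrite !Cmod_mult, Cmod_Cexp, !Cmod_R. replace (Re (Cpair 0 tau * RtoC t)) with 0 by (simpl; ring).
    rewrite exp_0, Rmult_1_l, (Rabs_pos_eq (exp _)) by (left; apply exp_pos).
    rewrite (Rmult_comm eps). apply Rmult_le_compat; [left; apply exp_pos|apply Rabs_pos| |].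
    + apply exp_le_mono. pose proof (exp_ineq1_le t). nra.
    + apply exp_alternating_tail. pose proof (exp_pos (- t)).
      assert (exp (- t) <= 1) by (rewrite <- exp_0; apply exp_le_mono; lra). nra.
  - apply (is_RInt_R_derive (fun t => - eps * exp (- (a * t)) / a)); [lra| |].
    + intros t _. auto_derive; [auto|]. field. lra.
    + intros t _. apply (ex_derive_continuous (V := R_NormedModule)). auto_derive. auto.
  - rewrite Rmult_0_r, Ropp_0, exp_0. pose proof (exp_pos (- (a * T))). assert (0 < / a) by (apply Rinv_0_lt_compat, Ha).
    unfold Rdiv. assert (0 <= eps * exp (- (a * T)) * / a) by (apply Rmult_le_pos; [apply Rmult_le_pos|]; lra). lra.
Qed.

(** The antisymmetry under exchange of m and j needs a square truncation, which is why the inner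
    series is cut at the same n as the outer sum. The diagonal terms are multiples of 1 / (i tau),
    hence imaginary. *)
Lemma Re_double_sum_0 (tau a : R) (n : nat) : 0 < tau ->
  Re (Csum (fun m => RtoC (exp_term (- a) m) * Csum (lower_gamma_term tau (- INR m) a) n)%C n) = 0.
Proof.
  intros Ht.
  set (F := fun m j => (RtoC (exp_term (- a) m) * (RtoC (exp_term (- a) j) * / Cpair (- INR m + INR j) tau))%C).
  assert (E : Csum (fun m => RtoC (exp_term (- a) m) * Csum (lower_gamma_term tau (- INR m) a) n)%C n
     = Csum (fun m => Csum (F m) n) n).
  { apply Csum_ext. intros m _. apply Csum_mult_l. }
  rewrite E. set (Sg := Csum (fun m => Csum (F m) n) n).
  assert (H : Cconj Sg = (- Sg)%C).
  { unfold Sg. rewrite Csum_conj. transitivity (Csum (fun m => Csum (fun j => - F j m)%C n) n).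
    - apply Csum_ext. intros m _. rewrite Csum_conj. apply Csum_ext. intros j _. unfold F.
      rewrite !Cmult_conj, Cinv_conj by (apply pair_neq_0, Ht).
      replace (Cconj (Cpair (- INR m + INR j) tau)) with (- Cpair (- INR j + INR m) tau)%C by (apply C_eq; simpl; ring).
      replace (Cconj (RtoC (exp_term (- a) m))) with (RtoC (exp_term (- a) m)) by (apply C_eq; simpl; ring).
      replace (Cconj (RtoC (exp_term (- a) j))) with (RtoC (exp_term (- a) j)) by (apply C_eq; simpl; ring).
      field. apply pair_neq_0, Ht.
    - rewrite (Csum_swap (fun m j => - F j m)%C), Csum_opp. apply Csum_ext. intros m _. rewrite Csum_opp. reflexivity. }
  apply (f_equal Re) in H. simpl in H. unfold Re in *. simpl in H. lra.
Qed.

Definition bessel_term (tau x : R) (m : nat) : C :=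
  (RtoC ((x / 2) ^ (2 * m)) / (RtoC (INR (fact m)) * pochhammer (Cpair 1 (- tau)) m))%C.

Lemma besselK_imag_series (tau x : R) (mu Sg : C) : 0 < tau -> 0 < x ->
  (forall n, Cmod (mu - mu_sum tau (S n)) <= / (12 * INR (S n))) ->
  Ctends (Csum (bessel_term tau x)) eventually Sg ->
  besselK_imag tau x = Re (Cexp (- (Cpair 0 tau * RtoC (ln (x / 2)))) * Gamma_imag tau mu * Sg)%C.
Proof.
  intros Ht Hx Hmu HS. set (a := x / 2). assert (Ha : 0 < a) by (unfold a; lra).
  set (Y := (Cexp (- (Cpair 0 tau * RtoC (ln a))) * Gamma_imag tau mu)%C).
  set (L := fun m => (Y * RtoC ((- a) ^ m) / pochhammer (Cpair 1 (- tau)) m - lower_gamma tau (- INR m) a)%C).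
  set (eps := fun n => exp a - Rsum (exp_term a) n).
  assert (Heps : is_lim_seq eps 0).
  { replace (Finite 0) with (Finite (exp a - exp a)) by (f_equal; ring).
    apply is_lim_seq_minus'; [apply is_lim_seq_const|apply exp_sum_lim]. }
  assert (Heps0 : forall n, 0 <= eps n) by (intros n; unfold eps; pose proof (exp_sum_le a n ltac:(lra)); lra).
  destruct (Ctends_approx (Rbar_locally p_infty) (fun T => CRInt (besselK_integrand tau a) 0 T)
    (fun n T => Csum (fun m => RtoC (exp_term (- a) m) * CRInt (upper_gamma_integrand tau a m) 0 T)%C n)
    (fun n => Csum (fun m => RtoC (exp_term (- a) m) * L m)%C n) (fun n => eps n * / a)) as [K [HK1 HK2]].
  - intros n. exists 0. intros T HT. apply besselK_trunc; assumption.
  - intros n. induction n as [|n IH]; simpl; [apply (Ctends_const (Rbar_locally p_infty))|].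
    apply (Ctends_plus (Rbar_locally p_infty)); [exact IH|].
    apply (Ctends_mult (Rbar_locally p_infty)); [apply (Ctends_const (Rbar_locally p_infty))|].
    apply upper_gamma_limit; assumption.
  - replace (Finite 0) with (Finite (0 * / a)) by (f_equal; ring).
    apply is_lim_seq_mult'; [exact Heps|apply is_lim_seq_const].
  - assert (EK : besselK_imag tau x = Re K).
    { unfold besselK_imag. apply (is_RInt_gen_unique (V := R_CompleteNormedModule)).
      apply is_RInt_gen_intro with (I := fun T => Re (CRInt (besselK_integrand tau a) 0 T)).
      - intros T HT. apply is_RInt_R_ext with (3 := is_RInt_Re _ _ _ _ (besselK_is_RInt tau a T)); [lra|].
        intros t _. unfold besselK_integrand. rewrite re_scal_r, <- exp_plus.
        change (Re (Cexp ?w)) with (exp (Re w) * cos (Im w)).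
        replace (Re (Cpair 0 tau * RtoC t)) with 0 by (simpl; ring).
        replace (Im (Cpair 0 tau * RtoC t)) with (tau * t) by (simpl; ring).
        rewrite exp_0. replace (- x * cosh t) with (- (a * exp t) + - (a * exp (- t))) by (unfold cosh, a; field). ring.
      - exact (proj1 HK1). }
    rewrite EK. fold Y.
    (* Two errors: [eps n / a] from truncating the expansion under the integral, and
       [exp a * eps n / tau] from cutting each p_(-m) at n terms to reach the square double sum. *)
    assert (HY : forall n, Rabs (Re K - Re (Y * Csum (bessel_term tau x) n)) <= eps n * (/ a + exp a / tau)).
    { intros n.
      assert (E : Csum (fun m => RtoC (exp_term (- a) m) * L m)%C n =
        (Y * Csum (bessel_term tau x) n - Csum (fun m => RtoC (exp_term (- a) m) * lower_gamma tau (- INR m) a) n)%C).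
      { rewrite Csum_mult_l, Csum_minus. apply Csum_ext. intros m _. unfold L, bessel_term. fold a.
        replace (a ^ (2 * m)) with ((- a) ^ m * (- a) ^ m) by (rewrite <- Rpow_mult_distr, pow_mult; f_equal; ring).
        unfold exp_term. rewrite RtoC_mult, RtoC_div by apply INR_fact_neq_0.
        field. split; first [apply pochhammer_neg_neq_0, Ht | intros H; apply RtoC_inj in H; revert H; apply INR_fact_neq_0]. }
      specialize (HK2 n). cbv beta in HK2. rewrite E in HK2.
      set (U := (Y * Csum (bessel_term tau x) n)%C) in *.
      set (V := Csum (fun m => RtoC (exp_term (- a) m) * lower_gamma tau (- INR m) a)%C n) in *.
      set (W := Csum (fun m => RtoC (exp_term (- a) m) * Csum (lower_gamma_term tau (- INR m) a) n)%C n).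
      assert (HW : Re W = 0) by (apply Re_double_sum_0, Ht).
      assert (HVW : Cmod (V - W) <= exp a * (eps n / tau)).
      { unfold V, W. rewrite Csum_minus.
        apply Rle_trans with (Rsum (fun m => exp_term a m * (eps n / tau)) n).
        - apply Cmod_Csum_le. intros m _.
          replace (_ - _)%C with (RtoC (exp_term (- a) m) * (lower_gamma tau (- INR m) a - Csum (lower_gamma_term tau (- INR m) a) n))%C by ring.
          rewrite Cmod_mult, Cmod_R, Rabs_exp_term, Rabs_Ropp, (Rabs_pos_eq a) by lra.
          apply Rmult_le_compat_l; [apply exp_term_pos; lra|]. apply lower_gamma_tail; lra.
        - rewrite <- Rsum_mult_r. apply Rmult_le_compat_r; [apply Rdiv_le_0_compat; [apply Heps0|exact Ht]|].
          apply exp_sum_le. lra. }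
      replace (Re K - Re U) with (Re (K - (U - V)) - Re (V - W)) by (unfold Re in *; simpl in *; lra).
      eapply Rle_trans; [apply Rabs_triang|]. rewrite Rabs_Ropp.
      pose proof (re_le_Cmod (K - (U - V))). pose proof (re_le_Cmod (V - W)).
      replace (eps n * (/ a + exp a / tau)) with (eps n * / a + exp a * (eps n / tau)) by (field; lra). lra. }
    assert (L1 : is_lim_seq (fun n => Re (Y * Csum (bessel_term tau x) n)) (Re K)).
    { apply (filterlim_R_of_abs eventually) with (g := fun n => eps n * (/ a + exp a / tau)).
      - apply filter_forall. intros n. rewrite Rabs_minus_sym. apply HY.
      - enough (H : is_lim_seq (fun n => eps n * (/ a + exp a / tau)) 0) by exact H.
        replace (Finite 0) with (Finite (0 * (/ a + exp a / tau))) by (f_equal; ring).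
        apply is_lim_seq_mult'; [exact Heps|apply is_lim_seq_const]. }
    assert (L2 : is_lim_seq (fun n => Re (Y * Csum (bessel_term tau x) n)) (Re (Y * Sg))).
    { apply (Ctends_mult eventually (fun _ => Y)); [apply (Ctends_const eventually)|exact HS]. }
    pose proof (is_lim_seq_unique _ _ L1) as U1. rewrite (is_lim_seq_unique _ _ L2) in U1. injection U1. auto.
Qed.

(** * Integrals of bounded functions, and factorials *)

Lemma step_indicator (a c b M : R) : a <= c <= b ->
  { chi : StepFun a b | (forall t, chi t = if Rle_dec t c then 0 else M) /\ RiemannInt_SF chi = M * (b - c) }.
Proof.
  intros H.
  assert (A : adapted_couple (fun t => if Rle_dec t c then 0 else M) a b (cons a (cons c (cons b nil))) (cons 0 (cons M nil))).
  { unfold adapted_couple. rewrite Rmin_left, Rmax_right by lra. repeat split.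
    - intros i Hi. simpl in Hi. destruct i as [|[|i]]; simpl; try lra; lia.
    - intros i Hi. simpl in Hi. unfold constant_D_eq, open_interval.
      destruct i as [|[|i]]; simpl; intros t Ht; [| |lia]; destruct (Rle_dec t c); lra. }
  exists (mkStepFun (existT _ _ (existT _ _ A)
    : IsStepFun (fun t => if Rle_dec t c then 0 else M) a b)). split; [reflexivity|].
  unfold RiemannInt_SF. destruct (Rle_dec a b); [|lra]. simpl. ring.
Qed.

Lemma ex_RInt_bounded (f : R -> R) (a b M : R) : a < b ->
  (forall t, a <= t <= b -> Rabs (f t) <= M) ->
  (forall c, a <= c < b -> ex_RInt f a c) -> ex_RInt f a b.
Proof.
  intros Hab HM Hc. apply ex_RInt_Reals_1. intros eps.
  assert (HM0 : 0 <= M) by (eapply Rle_trans; [apply Rabs_pos|apply (HM a); lra]).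
  pose proof (cond_pos eps) as He.
  set (d := Rmin (b - a) (eps / (2 * (M + 1)))).
  assert (Hd : 0 < d) by (apply Rmin_glb_lt; [lra|apply Rdiv_lt_0_compat; lra]).
  assert (Hd1 : d <= b - a) by apply Rmin_l.
  assert (Hd2 : M * d < eps / 2 + 0 * d).
  { assert (d <= eps / (2 * (M + 1))) by apply Rmin_r.
    assert (M * d < (M + 1) * d) by nra.
    assert ((M + 1) * d <= (M + 1) * (eps / (2 * (M + 1)))) by (apply Rmult_le_compat_l; lra).
    replace ((M + 1) * (eps / (2 * (M + 1)))) with (eps / 2) in H1 by (field; lra). lra. }
  set (c := b - d).
  assert (E1 : ex_RInt (fun t => if Rle_dec t c then f t else 0) a b).
  { apply (ex_RInt_Chasles (V := R_NormedModule)) with c.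
    - apply (ex_RInt_ext (V := R_NormedModule) f).
      + intros t Ht. unfold c in Ht. rewrite Rmin_left, Rmax_right in Ht by lra.
        destruct (Rle_dec t c) as [|n]; [reflexivity|exfalso; apply n; unfold c; lra].
      + apply Hc. unfold c; lra.
    - apply (ex_RInt_ext (V := R_NormedModule) (fun _ => 0)).
      + intros t Ht. unfold c in Ht. rewrite Rmin_left, Rmax_right in Ht by lra.
        destruct (Rle_dec t c) as [n|]; [exfalso; unfold c in n; lra|reflexivity].
      + apply (ex_RInt_const (V := R_NormedModule)). }
  apply ex_RInt_Reals_0 in E1.
  destruct (E1 (mkposreal (eps / 2) ltac:(lra))) as [phi [psi [H1 H2]]]. simpl in H2.
  destruct (step_indicator a c b M) as [chi [Hchi1 Hchi2]]; [unfold c; lra|].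
  exists phi. exists (mkStepFun (StepFun_P28 1 psi chi)). split.
  - intros t Ht. specialize (H1 t Ht). simpl. rewrite Hchi1.
    rewrite Rmin_left, Rmax_right in Ht by lra. specialize (HM t Ht).
    destruct (Rle_dec t c); [lra|].
    replace (f t - phi t) with (f t + (0 - phi t)) by ring.
    eapply Rle_trans; [apply Rabs_triang|]. lra.
  - rewrite StepFun_P30, Hchi2. eapply Rle_lt_trans; [apply Rabs_triang|].
    rewrite (Rabs_pos_eq (1 * _)) by (unfold c; nra). unfold c. lra.
Qed.

Lemma ex_RInt_C_bounded (f : R -> C) (a b M : R) : a < b ->
  (forall t, a <= t <= b -> Cmod (f t) <= M) ->
  (forall c, a <= c < b -> exists l, is_RInt_C f a c l) -> exists l, is_RInt_C f a b l.
Proof.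
  intros Hab HM Hc.
  destruct (ex_RInt_bounded (fun t => Re (f t)) a b M Hab) as [l1 H1].
  - intros t Ht. eapply Rle_trans; [apply re_le_Cmod|apply HM, Ht].
  - intros c Hcb. destruct (Hc c Hcb) as [l Hl]. exists (Re l). apply is_RInt_Re, Hl.
  - destruct (ex_RInt_bounded (fun t => Im (f t)) a b M Hab) as [l2 H2].
    + intros t Ht. eapply Rle_trans; [apply im_le_Cmod|apply HM, Ht].
    + intros c Hcb. destruct (Hc c Hcb) as [l Hl]. exists (Im l). apply is_RInt_Im, Hl.
    + exists (l1, l2). apply is_RInt_C_intro; assumption.
Qed.

Lemma RInt_C_upper_limit (f : R -> C) (I : R -> C) (a b M : R) (l : C) : a < b ->
  (forall t, a <= t <= b -> Cmod (f t) <= M) ->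
  (forall c, a < c < b -> is_RInt_C f a c (I c)) -> is_RInt_C f a b l ->
  Ctends I (at_left b) l.
Proof.
  intros Hab HM HI Hl.
  apply (Ctends_of_Cmod (at_left b)) with (g := fun c => M * (b - c)).
  - exists (mkposreal (b - a) ltac:(lra)). intros c Hc Hcb.
    change (Rabs (c - b) < b - a) in Hc. apply Rabs_def2 in Hc.
    assert (H1 : is_RInt_C f c b (l - I c)%C).
    { replace (l - I c)%C with (- I c + l)%C by ring.
      apply (is_RInt_Chasles (V := C_R_NormedModule)) with a; [|exact Hl].
      apply (is_RInt_swap (V := C_R_NormedModule)), HI. lra. }
    rewrite <- Cmod_opp. replace (- (I c - l))%C with (l - I c)%C by ring.
    apply (Cmod_RInt_le f (fun _ => M) c b); [lra| |exact H1|].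
    + intros t Ht. apply HM. lra.
    + replace (M * (b - c)) with ((b - c) * M) by ring. exact (is_RInt_const (V := R_NormedModule) c b M).
  - eapply filterlim_filter_le_1.
    + apply (filter_le_within (F := locally b)).
    + replace 0 with (M * (b - b)) by ring.
      apply (ex_derive_continuous (V := R_NormedModule) (fun c => M * (b - c))). auto_derive. auto.
Qed.

(** * Euler's integral at positive integers *)

Lemma exp_term_exp_lim (j : nat) :
  filterlim (fun t => exp_term t j * exp (- t)) (Rbar_locally p_infty) (locally 0).
Proof.
  apply (filterlim_R_of_abs (Rbar_locally p_infty)) with (g := fun t => / (/ INR (S j) * t)).
  - exists 0. intros t Ht. rewrite Rminus_0_r, Rabs_pos_eq
      by (apply Rmult_le_pos; [apply exp_term_pos; lra|left; apply exp_pos]).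
    pose proof (exp_term_le_exp t (S j) ltac:(lra)) as H. pose proof (exp_term_S t j) as E.
    assert (P : 0 < INR (S j)) by (apply lt_0_INR; lia).
    replace (/ (/ INR (S j) * t)) with (INR (S j) / t) by (field; lra).
    rewrite exp_Ropp. pose proof (exp_pos t).
    apply (Rmult_le_reg_r (exp t * t)); [nra|].
    replace (exp_term t j * / exp t * (exp t * t)) with (t * exp_term t j) by (field; lra).
    replace (INR (S j) / t * (exp t * t)) with (INR (S j) * exp t) by (field; lra).
    rewrite <- E. apply Rmult_le_compat_l; lra.
  - apply lim_inv_scal. apply Rinv_0_lt_compat, lt_0_INR. lia.
Qed.

Lemma exp_sum_derive (t : R) (n : nat) :
  is_derive (fun t => Rsum (exp_term t) (S n)) t (Rsum (exp_term t) n).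
Proof.
  induction n as [|n IH].
  - apply (is_derive_ext (fun _ => 1)); [intros u; unfold exp_term; simpl; field|].
    apply (is_derive_const (K := R_AbsRing) (V := R_NormedModule)).
  - apply (is_derive_plus (K := R_AbsRing) (V := R_NormedModule) (fun t => Rsum (exp_term t) (S n)) (fun t => exp_term t (S n))); [exact IH|].
    unfold exp_term. assert (EK : INR (fact (S n)) = INR (S n) * INR (fact n)) by (rewrite fact_simpl, mult_INR; reflexivity).
    pose proof (INR_fact_neq_0 (S n)) as HK. revert EK HK. generalize (INR (fact (S n))). intros K EK HK.
    auto_derive; [auto|]. change (Nat.pred (S n)) with n.
    replace (match n with 0%nat => 1 | S _ => INR n + 1 end) with (INR (S n)) by reflexivity. rewrite EK. field.
    split; [apply INR_fact_neq_0|apply not_0_INR; lia].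
Qed.

(** All integrations by parts are collected in one antiderivative of t^n e^(-t), namely -n! e^(-t)
    times the partial exponential sum up to t^n / n!. *)
Lemma Gamma_fact (n : nat) : Gamma (INR n + 1) = INR (fact n).
Proof.
  unfold Gamma. replace (INR n + 1 - 1) with (INR n) by ring.
  apply (is_RInt_gen_unique (V := R_CompleteNormedModule)).
  set (f := fun t => - (INR (fact n) * (Rsum (exp_term t) (S n) * exp (- t)))).
  assert (D : forall t, is_derive f t (t ^ n * exp (- t))).
  { intros t. unfold f. 
    eapply is_derive_eq.
    - apply (is_derive_opp (K := R_AbsRing) (V := R_NormedModule)).
      apply (is_derive_R_mult (fun _ => INR (fact n)) _ t 0); [apply (is_derive_const (K := R_AbsRing) (V := R_NormedModule))|].
      apply (is_derive_R_mult (fun t => Rsum (exp_term t) (S n)) (fun t => exp (- t)) t (Rsum (exp_term t) n) (- exp (- t))); [apply exp_sum_derive|].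
      auto_derive; [auto|ring].
    - change (- (0 * (Rsum (exp_term t) (S n) * exp (- t)) + INR (fact n) * (Rsum (exp_term t) n * exp (- t) + Rsum (exp_term t) (S n) * - exp (- t))) = t ^ n * exp (- t)).
      change (Rsum (exp_term t) (S n)) with (Rsum (exp_term t) n + exp_term t n).
      generalize (Rsum (exp_term t) n). intros r. unfold exp_term. field. apply INR_fact_neq_0. }
  assert (DE : forall t, Derive f t = t ^ n * exp (- t)) by (intros t; apply is_derive_unique, D).
  assert (H : is_RInt_gen (Derive f) (at_right 0) (Rbar_locally p_infty) (0 - - INR (fact n))).
  { apply is_RInt_gen_Derive.
    - apply filter_forall. intros ab t _. eexists; apply D.
    - apply filter_forall. intros ab t _.
      apply (continuous_ext (fun t => t ^ n * exp (- t))); [intros; symmetry; apply DE|].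
      apply (ex_derive_continuous (V := R_NormedModule)). auto_derive. auto.
    - eapply filterlim_filter_le_1.
      + apply (filter_le_within (F := locally 0)).
      + replace (- INR (fact n)) with (f 0).
        * apply (ex_derive_continuous (V := R_NormedModule)). eexists; apply D.
        * unfold f. rewrite Ropp_0, exp_0. replace (Rsum (exp_term 0) (S n)) with 1; [ring|].
          clear. induction n as [|n IH]; [unfold exp_term; simpl; field|].
          change (1 = Rsum (exp_term 0) (S n) + exp_term 0 (S n)). rewrite <- IH. unfold exp_term.
          rewrite pow_i by lia. unfold Rdiv. ring.
    - unfold f. replace 0 with (- (INR (fact n) * 0)) by ring.
      apply (Rlim_opp (Rbar_locally p_infty)). apply (Rlim_mult (Rbar_locally p_infty)); [apply filterlim_const|].
      generalize (S n). intros k. induction k as [|k IH]; simpl.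
      + apply (filterlim_ext (fun _ => 0)); [intros; ring|apply filterlim_const].
      + apply (filterlim_ext (fun t => Rsum (exp_term t) k * exp (- t) + exp_term t k * exp (- t))); [intros; ring|].
        replace 0 with (0 + 0) by ring. apply (Rlim_plus (Rbar_locally p_infty)); [exact IH|apply exp_term_exp_lim]. }
  replace (INR (fact n)) with (0 - - INR (fact n)) by ring.
  refine (is_RInt_gen_ext _ _ _ _ H).
  exists (fun a => 0 < a) (fun b => 0 < b).
  - exists (mkposreal 1 Rlt_0_1). intros y _ Hy. exact Hy.
  - exists 0. auto.
  - intros a b Ha Hb t Ht. simpl in Ht. rewrite DE.
    assert (0 < t) by (apply Rlt_trans with (2 := proj1 Ht); apply Rmin_glb_lt; assumption).
    rewrite Rpower_pow by assumption. reflexivity.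
Qed.

(** * The tail of the series as an integral *)

(* [I_n(y) = (y/2)^n bessel_core n (y^2/4)] *)
Definition bessel_core_coef (n k : nat) : R := / (INR (fact k) * INR (fact (k + n))).
Definition bessel_core (n : nat) (q : R) : R := PSeries (bessel_core_coef n) q.

Lemma bessel_core_coef_pos (n k : nat) : 0 < bessel_core_coef n k.
Proof. apply Rinv_0_lt_compat, Rmult_lt_0_compat; apply INR_fact_lt_0. Qed.

Lemma bessel_core_coef_le (n k : nat) : bessel_core_coef n k <= / INR (fact k).
Proof.
  unfold bessel_core_coef. pose proof (INR_fact_lt_0 k). pose proof (le_INR 1 (fact (k + n)) (lt_O_fact (k + n))) as H1.
  simpl in H1. apply Rinv_le_contravar; [assumption|]. nra.
Qed.

Lemma bessel_core_CV (n : nat) (q : R) : Rbar_lt (Rabs q) (CV_radius (bessel_core_coef n)).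
Proof.
  apply (CV_radius_exp_bound _ 1). intros j.
  rewrite Rabs_pos_eq by (left; apply bessel_core_coef_pos).
  unfold Rdiv. rewrite Rmult_1_l. apply bessel_core_coef_le.
Qed.

Lemma bessel_core_is_series (n : nat) (q : R) :
  is_series (fun k => bessel_core_coef n k * q ^ k) (bessel_core n q).
Proof. apply is_pseries_R, PSeries_correct, CV_radius_inside, bessel_core_CV. Qed.

Lemma bessel_core_ge (n : nat) (q : R) : 0 <= q -> / INR (fact n) <= bessel_core n q.
Proof.
  intros Hq.
  pose proof (is_lim_seq_Rsum _ _ (bessel_core_is_series n q)) as H.
  assert (H1 : Rsum (fun k => bessel_core_coef n k * q ^ k) 1 <= bessel_core n q).
  { apply (is_lim_seq_incr_compare _ _ H). intros k; simpl.
    pose proof (bessel_core_coef_pos n k). pose proof (pow_le q k Hq). nra. }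
  simpl in H1. unfold bessel_core_coef in H1. simpl in H1. rewrite Rmult_1_l, Rmult_1_r, Rplus_0_l in H1. exact H1.
Qed.

Lemma bessel_core_le (n : nat) (q : R) : 0 <= q -> bessel_core n q <= exp q.
Proof.
  intros Hq.
  apply (is_lim_seq_le _ _ (bessel_core n q) (exp q)) with (2 := is_lim_seq_Rsum _ _ (bessel_core_is_series n q)) (3 := exp_sum_lim q).
  intros m. induction m as [|m IH]; simpl; [lra|].
  pose proof (bessel_core_coef_le n m). pose proof (pow_le q m Hq).
  assert (bessel_core_coef n m * q ^ m <= exp_term q m) by (unfold exp_term, Rdiv; rewrite Rmult_comm; apply Rmult_le_compat_l; assumption).
  lra.
Qed.

Lemma bessel_core_0 (n : nat) : bessel_core n 0 = / INR (fact n).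
Proof. unfold bessel_core. rewrite PSeries_0. unfold bessel_core_coef. simpl. rewrite Rmult_1_l. reflexivity. Qed.

(** The classical rule that y^(-n) I_n(y) has derivative y^(-n) I_(n+1)(y), in the variable q = y^2
    / 4. *)
Lemma bessel_core_derive (n : nat) (q : R) : is_derive (bessel_core n) q (bessel_core (S n) q).
Proof.
  eapply is_derive_eq; [apply is_derive_PSeries, bessel_core_CV|].
  apply PSeries_ext. intros k. unfold PS_derive, bessel_core_coef.
  replace (S k + n)%nat with (k + S n)%nat by lia. rewrite (fact_simpl k), mult_INR.
  field. repeat split; try apply INR_fact_neq_0. apply not_0_INR; lia.
Qed.

Lemma besselI_eq (n : nat) (y : R) : besselI n y = (y / 2) ^ n * bessel_core n ((y / 2) ^ 2).
Proof.
  unfold besselI. apply is_series_unique.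
  apply (is_series_ext (fun k => (y / 2) ^ n * (bessel_core_coef n k * ((y / 2) ^ 2) ^ k))).
  - intros k. rewrite <- plus_INR, Gamma_fact, pow_add, <- pow_mult. unfold bessel_core_coef. match goal with |- @eq _ ?a ?b => change (@eq R a b) end. field.
    split; apply INR_fact_neq_0.
  - apply (is_series_scal (K := R_AbsRing) (V := R_NormedModule)). apply bessel_core_is_series.
Qed.

(** The integrand of [R_rem] multiplied by 2^(n+1), with the division by y^n carried out: I_(n+1)(y)
    / y^n is y / 2^(n+1) times [bessel_core]. *)
Definition tail_integrand (tau x : R) (n : nat) (y : R) : C :=
  (Cexp (Cpair (INR n) (- tau) * RtoC (ln (x ^ 2 - y ^ 2))) * RtoC (y * bessel_core (S n) ((y / 2) ^ 2)))%C.

Lemma ln_0 : ln 0 = 0.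
Proof. unfold ln. destruct (Rlt_dec 0 0) as [H|H]; [exfalso; lra|reflexivity]. Qed.

(** The summand 1 covers the endpoint y = x, where [ln 0 = 0] gives the power the value 1. *)
Lemma Cmod_tail_integrand (tau x : R) (n : nat) (y : R) : 0 <= y <= x ->
  Cmod (tail_integrand tau x n y) <= (1 + (x ^ 2) ^ n) * (x * exp ((x / 2) ^ 2)).
Proof.
  intros Hy. unfold tail_integrand. rewrite Cmod_mult, Cmod_Cexp, Cmod_R.
  replace (Re (Cpair (INR n) (- tau) * RtoC (ln (x ^ 2 - y ^ 2)))) with (INR n * ln (x ^ 2 - y ^ 2)) by (cbn -[INR ln pow]; ring).
  assert (0 <= (y / 2) ^ 2 <= (x / 2) ^ 2) by nra.
  pose proof (bessel_core_le (S n) ((y / 2) ^ 2) ltac:(lra)) as H1.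
  pose proof (bessel_core_ge (S n) ((y / 2) ^ 2) ltac:(lra)) as H2.
  pose proof (Rinv_0_lt_compat _ (INR_fact_lt_0 (S n))).
  assert (exp ((y / 2) ^ 2) <= exp ((x / 2) ^ 2)) by (apply exp_le_mono; lra).
  rewrite Rabs_pos_eq by (apply Rmult_le_pos; lra).
  apply Rmult_le_compat; [left; apply exp_pos|apply Rmult_le_pos; lra| |apply Rmult_le_compat; lra].
  pose proof (pow_le (x ^ 2) n ltac:(nra)).
  destruct (Req_dec y x) as [->|Hne].
  - rewrite Rminus_diag.
    rewrite ln_0, Rmult_0_r, exp_0. lra.
  - assert (Hp : 0 < x ^ 2 - y ^ 2) by nra.
    replace (exp (INR n * ln (x ^ 2 - y ^ 2))) with ((x ^ 2 - y ^ 2) ^ n) by (rewrite <- Rpower_pow by exact Hp; reflexivity).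
    assert ((x ^ 2 - y ^ 2) ^ n <= (x ^ 2) ^ n) by (apply pow_incr; nra). lra.
Qed.

Lemma bessel_core_sq_derive (n : nat) (y : R) :
  is_derive (fun y => bessel_core n ((y / 2) ^ 2)) y (y / 2 * bessel_core (S n) ((y / 2) ^ 2)).
Proof.
  assert (D : is_derive (fun y => (y / 2) ^ 2) y (y / 2)) by (auto_derive; [auto|field]).
  eapply is_derive_eq.
  - exact (is_derive_R_comp (bessel_core n) (fun y => (y / 2) ^ 2) y _ _ (bessel_core_derive n _) D).
  - apply Rmult_comm.
Qed.

Lemma Cexp_ln_derive (c : C) (x y : R) : 0 < x ^ 2 - y ^ 2 ->
  is_derive_C (fun y => Cexp (c * RtoC (ln (x ^ 2 - y ^ 2)))) y
    (RtoC (- (2 * y)) * c * Cexp ((c - RtoC 1) * RtoC (ln (x ^ 2 - y ^ 2))))%C.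
Proof.
  intros H. eapply is_derive_C_eq.
  - apply is_derive_Cexp. apply (is_derive_C_mult (fun _ => c)); [apply is_derive_C_const|].
    apply (is_derive_C_RtoC (fun y => ln (x ^ 2 - y ^ 2)) y (- (2 * y) * / (x ^ 2 - y ^ 2))).
    auto_derive; [exact H|]. simpl. field. simpl in H. lra.
  - cbv beta. replace (c * RtoC (ln (x ^ 2 - y ^ 2)))%C with ((c - RtoC 1) * RtoC (ln (x ^ 2 - y ^ 2)) + RtoC (ln (x ^ 2 - y ^ 2)))%C by ring.
    rewrite Cexp_plus, Cexp_RtoC, exp_ln by exact H.
    rewrite RtoC_mult, RtoC_inv by lra.
    match goal with |- @eq _ ?a ?b => change (@eq C a b) end. field.
    intros E. apply RtoC_inj in E. lra.
Qed.

Lemma Ctends_tail_integrand (tau x : R) (n : nat) (y : R) : 0 < x ^ 2 - y ^ 2 ->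
  Ctends (tail_integrand tau x n) (locally y) (tail_integrand tau x n y).
Proof.
  intros H. apply (Ctends_mult (locally y) (fun y => Cexp (Cpair (INR n) (- tau) * RtoC (ln (x ^ 2 - y ^ 2))))).
  - eapply Ctends_of_derive, Cexp_ln_derive, H.
  - apply (Ctends_RtoC (locally y)). apply (Rlim_mult (locally y) (fun y => y)); [apply filterlim_id|].
    apply (ex_derive_continuous (V := R_NormedModule) (fun y => bessel_core (S n) ((y / 2) ^ 2))).
    eexists; apply bessel_core_sq_derive.
Qed.

Lemma tail_is_RInt_lt (tau x c : R) (n : nat) : 0 <= c < x ->
  is_RInt_C (tail_integrand tau x n) 0 c (CRInt (tail_integrand tau x n) 0 c).
Proof.
  intros Hc. destruct (ex_RInt_C_continuous (tail_integrand tau x n) 0 c) as [l Hl].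
  - intros y Hy. rewrite Rmin_left, Rmax_right in Hy by lra. apply Ctends_tail_integrand. nra.
  - rewrite (CRInt_eq _ _ _ _ Hl). exact Hl.
Qed.

Lemma tail_is_RInt (tau x : R) (n : nat) : 0 < x ->
  is_RInt_C (tail_integrand tau x n) 0 x (CRInt (tail_integrand tau x n) 0 x).
Proof.
  intros Hx. destruct (ex_RInt_C_bounded (tail_integrand tau x n) 0 x ((1 + (x ^ 2) ^ n) * (x * exp ((x / 2) ^ 2))) Hx) as [l Hl].
  - intros y Hy. apply Cmod_tail_integrand, Hy.
  - intros c Hc. eexists. apply tail_is_RInt_lt, Hc.
  - rewrite (CRInt_eq _ _ _ _ Hl). exact Hl.
Qed.

Lemma tail_lim (tau x : R) (n : nat) : 0 < x ->
  Ctends (fun c => CRInt (tail_integrand tau x n) 0 c) (at_left x) (CRInt (tail_integrand tau x n) 0 x).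
Proof.
  intros Hx. apply (RInt_C_upper_limit (tail_integrand tau x n) _ 0 x ((1 + (x ^ 2) ^ n) * (x * exp ((x / 2) ^ 2)))); [exact Hx| | |].
  - intros y Hy. apply Cmod_tail_integrand, Hy.
  - intros c Hc. apply tail_is_RInt_lt. lra.
  - apply tail_is_RInt, Hx.
Qed.

(** The logarithm is singular at y = x, so the integration by parts is done on [0, b] with b < x.
    The boundary term at b vanishes as b tends to x, its exponent having the positive real part n +
    1; the one at 0 becomes the next term of the series. *)
Lemma tail_by_parts (tau x : R) (n : nat) : 0 < x ->
  (RtoC 2 * Cpair (INR (S n)) (- tau) * CRInt (tail_integrand tau x n) 0 x =
   RtoC (/ 2) * CRInt (tail_integrand tau x (S n)) 0 x
   + Cexp (Cpair (INR (S n)) (- tau) * RtoC (ln (x ^ 2))) * RtoC (/ INR (fact (S n))))%C.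
Proof.
  intros Hx. set (c := Cpair (INR (S n)) (- tau)).
  set (P := fun y => (Cexp (c * RtoC (ln (x ^ 2 - y ^ 2))) * RtoC (bessel_core (S n) ((y / 2) ^ 2)))%C).
  assert (H : forall b, 0 < b < x -> (RtoC 2 * c * CRInt (tail_integrand tau x n) 0 b =
     RtoC (/ 2) * CRInt (tail_integrand tau x (S n)) 0 b + P 0 - P b)%C).
  { intros b Hb.
    assert (H1 : is_RInt_C (fun y => RtoC (/ 2) * tail_integrand tau x (S n) y - RtoC 2 * c * tail_integrand tau x n y)%C 0 b (P b - P 0)%C).
    { apply (is_RInt_C_derive P); intros y Hy; rewrite Rmin_left, Rmax_right in Hy by lra; assert (Hpos : 0 < x ^ 2 - y ^ 2) by nra.
      - eapply is_derive_C_eq.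
        + apply (is_derive_C_mult (fun y => Cexp (c * RtoC (ln (x ^ 2 - y ^ 2)))) (fun y => RtoC (bessel_core (S n) ((y / 2) ^ 2)))).
          * apply Cexp_ln_derive, Hpos.
          * apply is_derive_C_RtoC, bessel_core_sq_derive.
        + unfold tail_integrand. fold c.
          replace (Cpair (INR n) (- tau)) with (c - RtoC 1)%C by (unfold c; rewrite S_INR; apply C_eq; simpl; ring).
          replace (y / 2 * bessel_core (S (S n)) ((y / 2) ^ 2)) with (/ 2 * (y * bessel_core (S (S n)) ((y / 2) ^ 2))) by field.
          rewrite RtoC_opp, !RtoC_mult. ring.
      - apply continuous_C_intro. apply (Ctends_minus (locally y) (fun y => RtoC (/ 2) * tail_integrand tau x (S n) y)%C);
        apply (Ctends_mult (locally y) (fun _ => _)); try apply (Ctends_const (locally y)); apply Ctends_tail_integrand, Hpos. }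
    pose proof (is_RInt_C_minus _ _ _ _ _ _ (is_RInt_C_mult (RtoC (/ 2)) _ _ _ _ (tail_is_RInt_lt tau x b (S n) ltac:(lra)))
      (is_RInt_C_mult (RtoC 2 * c) _ _ _ _ (tail_is_RInt_lt tau x b n ltac:(lra)))) as H2.
    pose proof (RInt_C_unique _ _ _ _ _ H1 H2) as E.
    replace (RtoC 2 * c * CRInt (tail_integrand tau x n) 0 b)%C with
      (RtoC (/ 2) * CRInt (tail_integrand tau x (S n)) 0 b - (P b - P 0))%C by (rewrite E; ring). ring. }
  replace (Cexp (c * RtoC (ln (x ^ 2))) * RtoC (/ INR (fact (S n))))%C with (P 0).
  2:{ unfold P. replace (x ^ 2 - 0 ^ 2) with (x ^ 2) by ring. replace ((0 / 2) ^ 2) with 0 by field. rewrite bessel_core_0. reflexivity. }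
  assert (PF : ProperFilter (at_left x)) by apply at_left_proper_filter.
  apply (Ctends_unique (at_left x) (fun b => RtoC 2 * c * CRInt (tail_integrand tau x n) 0 b)%C).
  - apply (Ctends_mult (at_left x) (fun _ => _)); [apply (Ctends_const (at_left x))|apply tail_lim, Hx].
  - apply (Ctends_ext_loc (at_left x) (fun b => RtoC (/ 2) * CRInt (tail_integrand tau x (S n)) 0 b + P 0 - P b)%C).
    + exists (mkposreal x Hx). intros b Hb1 Hb2. change (Rabs (b - x) < x) in Hb1. apply Rabs_def2 in Hb1.
      symmetry; apply H. lra.
    + replace (RtoC (/ 2) * CRInt (tail_integrand tau x (S n)) 0 x + P 0)%C with
        (RtoC (/ 2) * CRInt (tail_integrand tau x (S n)) 0 x + P 0 - RtoC 0)%C by ring.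
      apply (Ctends_minus (at_left x)); [apply (Ctends_plus (at_left x)); [|apply (Ctends_const (at_left x))]|].
      * apply (Ctends_mult (at_left x) (fun _ => _)); [apply (Ctends_const (at_left x))|apply tail_lim, Hx].
      * apply (Ctends_of_Cmod (at_left x)) with (g := fun b => (x ^ 2 - b ^ 2) * ((x ^ 2) ^ n * exp ((x / 2) ^ 2))).
        -- exists (mkposreal x Hx). intros b Hb1 Hb2. change (Rabs (b - x) < x) in Hb1. apply Rabs_def2 in Hb1.
           assert (Hpos : 0 < x ^ 2 - b ^ 2) by nra.
           unfold P. unfold Cminus. rewrite Copp_0, Cplus_0_r, Cmod_mult, Cmod_Cexp, Cmod_R.
           replace (Re (c * RtoC (ln (x ^ 2 - b ^ 2)))) with (INR (S n) * ln (x ^ 2 - b ^ 2)) by (unfold c; cbn -[INR ln pow]; ring).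
           replace (exp (INR (S n) * ln (x ^ 2 - b ^ 2))) with ((x ^ 2 - b ^ 2) ^ S n) by (rewrite <- Rpower_pow by exact Hpos; reflexivity).
           assert (0 <= (b / 2) ^ 2 <= (x / 2) ^ 2) by nra.
           pose proof (bessel_core_le (S n) ((b / 2) ^ 2) ltac:(lra)) as H1.
           pose proof (bessel_core_ge (S n) ((b / 2) ^ 2) ltac:(lra)) as H2.
           pose proof (Rinv_0_lt_compat _ (INR_fact_lt_0 (S n))).
           assert (exp ((b / 2) ^ 2) <= exp ((x / 2) ^ 2)) by (apply exp_le_mono; lra).
           rewrite Rabs_pos_eq by lra.
           assert (A : (x ^ 2 - b ^ 2) ^ n <= (x ^ 2) ^ n) by (apply pow_incr; nra).
           pose proof (pow_le (x ^ 2 - b ^ 2) n ltac:(lra)).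
           change ((x ^ 2 - b ^ 2) ^ S n) with ((x ^ 2 - b ^ 2) * (x ^ 2 - b ^ 2) ^ n).
           rewrite Rmult_assoc. apply Rmult_le_compat_l; [lra|]. apply Rmult_le_compat; lra.
        -- eapply filterlim_filter_le_1.
           ++ apply (filter_le_within (F := locally x)).
           ++ replace 0 with ((x ^ 2 - x ^ 2) * ((x ^ 2) ^ n * exp ((x / 2) ^ 2))) by ring.
              apply (ex_derive_continuous (V := R_NormedModule) (fun b => (x ^ 2 - b ^ 2) * ((x ^ 2) ^ n * exp ((x / 2) ^ 2)))).
              auto_derive. auto.
Qed.

Definition bessel_tail (tau x : R) (n : nat) : C :=
  (Cexp (Cpair 0 (2 * tau) * RtoC (ln x)) / (RtoC (2 ^ n) * pochhammer (Cpair 1 (- tau)) n)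
   * (RtoC (/ 2 ^ S n) * CRInt (tail_integrand tau x n) 0 x))%C.

Lemma bessel_tail_step (tau x : R) (n : nat) : 0 < tau -> 0 < x ->
  bessel_tail tau x n = (bessel_term tau x (S n) + bessel_tail tau x (S n))%C.
Proof.
  intros Ht Hx. pose proof (tail_by_parts tau x n Hx) as E.
  set (c := Cpair (INR (S n)) (- tau)) in *.
  assert (Hc : c <> RtoC 0) by (intros H; apply (f_equal snd) in H; simpl in H; lra).
  set (J0 := CRInt (tail_integrand tau x n) 0 x) in *. set (J1 := CRInt (tail_integrand tau x (S n)) 0 x) in *.
  assert (E0 : J0 = ((RtoC (/ 2) * J1 + Cexp (c * RtoC (ln (x ^ 2))) * RtoC (/ INR (fact (S n)))) / (RtoC 2 * c))%C).
  { rewrite <- E. field. exact Hc. }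
  (* The purpose of the prefactor x^(2 i tau): it cancels the oscillation of (x^2)^(n + 1 - i tau)
     in the boundary term. *)
  assert (EX : (Cexp (Cpair 0 (2 * tau) * RtoC (ln x)) * Cexp (c * RtoC (ln (x ^ 2))))%C = RtoC (x ^ (2 * S n))).
  { rewrite <- Cexp_plus. replace (ln (x ^ 2)) with (2 * ln x) by (simpl; rewrite Rmult_1_r, ln_mult by lra; ring).
    replace (Cpair 0 (2 * tau) * RtoC (ln x) + c * RtoC (2 * ln x))%C with (RtoC (INR (2 * S n) * ln x))
      by (rewrite mult_INR; unfold c; apply C_eq; cbn -[INR ln]; simpl (INR 2); ring).
    rewrite Cexp_RtoC. f_equal. rewrite <- Rpower_pow by exact Hx. reflexivity. }
  unfold bessel_tail, bessel_term. fold J0 J1. rewrite E0.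
  simpl pochhammer. replace (Cpair 1 (- tau) + RtoC (INR n))%C with c by (unfold c; rewrite S_INR; apply C_eq; simpl; ring).
  set (Pn := pochhammer (Cpair 1 (- tau)) n). assert (HP : Pn <> RtoC 0) by (apply pochhammer_neg_neq_0, Ht).
  unfold Rdiv at 1. rewrite Rpow_mult_distr, (RtoC_mult (x ^ (2 * S n))), <- EX.
  rewrite pow_mult. replace ((/ 2) ^ 2) with (/ (2 * 2)) by field. rewrite pow_inv, Rpow_mult_distr.
  change (2 ^ S (S n)) with (2 * 2 ^ S n). change (2 ^ S n) with (2 * 2 ^ n).
  assert (H2 : 2 ^ n <> 0) by (apply pow_nonzero; lra).
  pose proof (INR_fact_neq_0 (S n)) as Hf. revert Hf. generalize (INR (fact (S n))). intros f Hf.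
  revert H2. generalize (2 ^ n). intros w Hw.
  rewrite !RtoC_inv, !RtoC_mult by (repeat apply Rmult_integral_contrapositive_currified; lra || assumption).
  field. repeat split; first [exact HP | exact Hc | intros H; apply RtoC_inj in H; lra].
Qed.

Lemma exp_term_lim (v : R) : is_lim_seq (exp_term v) 0.
Proof.
  apply (is_lim_seq_ext (fun n => Rsum (exp_term v) (S n) - Rsum (exp_term v) n)); [intros n; simpl; ring|].
  replace (Finite 0) with (Finite (exp v - exp v)) by (f_equal; ring).
  apply is_lim_seq_minus'; [|apply exp_sum_lim].
  exact (proj1 (is_lim_seq_incr_1 (Rsum (exp_term v)) (exp v)) (exp_sum_lim v)).
Qed.

(** Two lower bounds for |(1 - z)_n|: the real parts k + 1 of the factors give n!, which drives the
    tail to 0 for every x, and the imaginary part gives tau^n in [Cmod_pochhammer_ge_pow], which is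
    the source of the decay in tau. *)
Lemma Cmod_pochhammer_ge_fact (tau : R) (n : nat) :
  INR (fact n) <= Cmod (pochhammer (Cpair 1 (- tau)) n).
Proof.
  induction n as [|n IH]; [simpl; rewrite Cmod_1; lra|].
  rewrite fact_simpl, mult_INR, Rmult_comm. simpl pochhammer. rewrite Cmod_mult.
  apply Rmult_le_compat; [apply pos_INR|apply pos_INR|exact IH|].
  eapply Rle_trans; [|apply re_le_Cmod]. eapply Rle_trans; [|apply Rle_abs]. rewrite S_INR. simpl. lra.
Qed.

Lemma Cmod_pochhammer_ge_pow (tau : R) (n : nat) : 0 < tau ->
  tau ^ n <= Cmod (pochhammer (Cpair 1 (- tau)) n).
Proof.
  intros Ht. induction n as [|n IH]; [simpl; rewrite Cmod_1; lra|].
  simpl. rewrite Cmod_mult, Rmult_comm. apply Rmult_le_compat; [apply pow_le; lra|lra|exact IH|].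
  eapply Rle_trans; [|apply im_le_Cmod]. simpl. replace (- tau + 0) with (- tau) by ring. rewrite Rabs_Ropp. apply Rle_abs.
Qed.

Lemma bessel_tail_lim (tau x : R) : 0 < tau -> 0 < x -> Ctends (bessel_tail tau x) eventually (RtoC 0).
Proof.
  intros Ht Hx. set (K := x * (x * exp ((x / 2) ^ 2))).
  assert (HK : 0 <= K) by (unfold K; pose proof (exp_pos ((x / 2) ^ 2)); apply Rmult_le_pos; [lra|apply Rmult_le_pos; lra]).
  apply (Ctends_of_Cmod eventually) with (g := fun n => (exp_term 1 n + exp_term (x ^ 2) n) * K).
  - apply filter_forall. intros n. unfold Cminus. rewrite Copp_0, Cplus_0_r. unfold bessel_tail, Cdiv.
    assert (H2 : 1 <= 2 ^ n) by (apply pow_R1_Rle; lra).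
    assert (HP : (RtoC (2 ^ n) * pochhammer (Cpair 1 (- tau)) n)%C <> RtoC 0).
    { apply Cmult_neq_0; [|apply pochhammer_neg_neq_0, Ht]. intros H; apply RtoC_inj in H; lra. }
    rewrite !Cmod_mult, Cmod_Cexp, Cmod_inv by exact HP. rewrite Cmod_mult, !Cmod_R.
    replace (Re (Cpair 0 (2 * tau) * RtoC (ln x))) with 0 by (simpl; ring). rewrite exp_0, Rmult_1_l.
    assert (HJ : Cmod (CRInt (tail_integrand tau x n) 0 x) <= (1 + (x ^ 2) ^ n) * K).
    { apply (Cmod_RInt_le (tail_integrand tau x n) (fun _ => (1 + (x ^ 2) ^ n) * (x * exp ((x / 2) ^ 2))) 0 x); [lra| |apply tail_is_RInt, Hx|].
      - intros y Hy. apply Cmod_tail_integrand, Hy.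
      - replace ((1 + (x ^ 2) ^ n) * K) with ((x - 0) * ((1 + (x ^ 2) ^ n) * (x * exp ((x / 2) ^ 2)))) by (unfold K; ring).
        exact (is_RInt_const (V := R_NormedModule) 0 x _). }
    pose proof (Cmod_pochhammer_ge_fact tau n) as Hf. pose proof (INR_fact_lt_0 n) as Hf0.
    rewrite (Rabs_pos_eq (2 ^ n)) by lra.
    assert (A1 : / (2 ^ n * Cmod (pochhammer (Cpair 1 (- tau)) n)) <= / INR (fact n)) by (apply Rinv_le_contravar; nra).
    assert (A2 : Rabs (/ 2 ^ S n) <= 1).
    { rewrite Rabs_pos_eq by (left; apply Rinv_0_lt_compat, pow_lt; lra). rewrite <- Rinv_1. apply Rinv_le_contravar; [lra|]. simpl. lra. }
    assert (A3 : 0 < / (2 ^ n * Cmod (pochhammer (Cpair 1 (- tau)) n))) by (apply Rinv_0_lt_compat; nra).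
    replace ((exp_term 1 n + exp_term (x ^ 2) n) * K) with (/ INR (fact n) * (1 * ((1 + (x ^ 2) ^ n) * K)))
      by (unfold exp_term; rewrite pow1; field; lra).
    apply Rmult_le_compat; [lra| |exact A1|].
    + apply Rmult_le_pos; [apply Rabs_pos|apply Cmod_ge_0].
    + apply Rmult_le_compat; [apply Rabs_pos|apply Cmod_ge_0|exact A2|exact HJ].
  - assert (H : is_lim_seq (fun n => (exp_term 1 n + exp_term (x ^ 2) n) * K) ((0 + 0) * K)).
    { apply is_lim_seq_mult'; [|apply is_lim_seq_const]. apply is_lim_seq_plus'; apply exp_term_lim. }
    rewrite Rplus_0_r, Rmult_0_l in H. exact H.
Qed.

(** Partial sum plus integral is independent of n by [bessel_tail_step]. Since the integral term
    tends to 0, this constant is the sum of the series, and convergence needs no separate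
    argument. *)
Lemma bessel_series (tau x : R) (N : nat) : 0 < tau -> 0 < x ->
  Ctends (Csum (bessel_term tau x)) eventually (Csum (bessel_term tau x) (S N) + bessel_tail tau x N)%C.
Proof.
  intros Ht Hx.
  set (c := (Csum (bessel_term tau x) 1 + bessel_tail tau x 0)%C).
  assert (H : forall n, (Csum (bessel_term tau x) (S n) + bessel_tail tau x n)%C = c).
  { induction n as [|n IH]; [reflexivity|]. rewrite <- IH, (bessel_tail_step tau x n Ht Hx). simpl. ring. }
  rewrite H.
  assert (H1 : Ctends (fun n => Csum (bessel_term tau x) (S n)) eventually c).
  { apply (Ctends_ext eventually (fun n => c - bessel_tail tau x n)%C).
    - intros n. rewrite <- (H n). ring.
    - replace c with (c - RtoC 0)%C at 1 by ring.
      apply (Ctends_minus eventually); [apply (Ctends_const eventually)|apply bessel_tail_lim; assumption]. }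
  destruct H1 as [A B]. split.
  - exact (proj2 (is_lim_seq_incr_1 (fun n => Re (Csum (bessel_term tau x) n)) (Re c)) A).
  - exact (proj2 (is_lim_seq_incr_1 (fun n => Im (Csum (bessel_term tau x) n)) (Im c)) B).
Qed.

Lemma bessel_series_bound (tau x : R) (Sg : C) : 0 < tau -> 0 < x ->
  Ctends (Csum (bessel_term tau x)) eventually Sg ->
  Cmod (Sg - RtoC 1) <= exp (x ^ 2 / (4 * tau)) - 1.
Proof.
  intros Ht Hx HS.
  replace (RtoC 1) with (Csum (bessel_term tau x) 1).
  2:{ unfold bessel_term. simpl. field. }
  assert (E1 : Rsum (exp_term (x ^ 2 / (4 * tau))) 1 = 1) by (unfold exp_term; simpl; field).
  rewrite <- E1. apply Csum_tail; [|exact HS|apply exp_sum_lim].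
  intros m. unfold bessel_term. pose proof (INR_fact_lt_0 m) as Hf. pose proof (pochhammer_neg_neq_0 tau m Ht) as HP.
  pose proof (Cmod_pochhammer_ge_pow tau m Ht) as HQ. pose proof (pow_lt tau m Ht) as Htm.
  assert (Hf' : RtoC (INR (fact m)) <> RtoC 0) by (intros H; apply RtoC_inj in H; lra).
  rewrite Cmod_div, Cmod_mult, !Cmod_R by (apply Cmult_neq_0; assumption).
  rewrite (Rabs_pos_eq (INR _)) by lra. rewrite Rabs_pos_eq by (apply pow_le; lra).
  unfold exp_term. rewrite pow_mult.
  replace (x ^ 2 / (4 * tau)) with ((x / 2) ^ 2 * / tau) by (field; lra).
  rewrite (Rpow_mult_distr ((x / 2) ^ 2)), pow_inv. unfold Rdiv at 1 3.
  replace (((x / 2) ^ 2) ^ m * / tau ^ m * / INR (fact m)) with (((x / 2) ^ 2) ^ m * / (INR (fact m) * tau ^ m)) by (field; lra).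
  apply Rmult_le_compat_l; [apply pow_le, pow2_ge_0|]. apply Rinv_le_contravar; nra.
Qed.

(** * Conclusion *)

(** e^w - 1 is the integral of w e^(wt) over [0, 1]. *)
Lemma Cmod_Cexp_minus_1 (w : C) : Cmod (Cexp w - RtoC 1) <= Cmod w * exp (Cmod w).
Proof.
  assert (H : is_RInt_C (fun t => w * Cexp (w * RtoC t))%C 0 1 (Cexp (w * RtoC 1) - Cexp (w * RtoC 0))%C).
  { apply (is_RInt_C_derive (fun t => Cexp (w * RtoC t))).
    - intros t _. apply is_derive_Cexp_lin.
    - intros t _. apply continuous_C_intro. apply (Ctends_mult (locally t) (fun _ => w)); [apply (Ctends_const (locally t))|].
      eapply Ctends_of_derive, is_derive_Cexp_lin. }
  rewrite Cmult_0_r, Cmult_1_r, Cexp_0 in H.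
  apply (Cmod_RInt_le (fun t => w * Cexp (w * RtoC t))%C (fun _ => Cmod w * exp (Cmod w)) 0 1); [lra| |exact H|].
  - intros t Ht. rewrite Cmod_mult, Cmod_Cexp. apply Rmult_le_compat_l; [apply Cmod_ge_0|].
    apply exp_le_mono. rewrite re_scal_r. pose proof (re_le_Cmod w). pose proof (Rle_abs (Re w)). pose proof (Cmod_ge_0 w). nra.
  - pose proof (is_RInt_const (V := R_NormedModule) 0 1 (Cmod w * exp (Cmod w))) as H1.
    change (is_RInt (fun _ => Cmod w * exp (Cmod w)) 0 1 ((1 - 0) * (Cmod w * exp (Cmod w)))) in H1.
    rewrite Rminus_0_r, Rmult_1_l in H1. exact H1.
Qed.

Lemma exp_scale_le (l u : R) : 0 <= l <= 1 -> 0 <= u -> exp (l * u) - 1 <= l * (exp u - 1).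
Proof.
  intros Hl Hu. enough (0 <= l * (exp u - 1) - (exp (l * u) - 1)) by lra. revert u Hu.
  apply nonneg_of_derive with (df := fun u => l * (exp u - exp (l * u))).
  - rewrite Rmult_0_r, exp_0. ring.
  - intros t Ht. auto_derive; [auto|]. ring.
  - intros t Ht. apply Rmult_le_pos; [lra|]. assert (exp (l * t) <= exp t) by (apply exp_le_mono; nra). lra.
Qed.

Lemma r_tau_eq (tau : R) (mu : C) :
  is_RInt_gen (V := C_R_NormedModule) (mu_integrand 0 tau) (at_point 0) (Rbar_locally p_infty) mu ->
  r_tau tau = (Cexp mu - RtoC 1)%C.
Proof.
  intros H. unfold r_tau. f_equal. f_equal. unfold CRInt_infty.
  apply (is_RInt_gen_unique (V := C_R_CompleteNormedModule)).
  refine (is_RInt_gen_ext _ _ _ _ H). apply filter_forall. intros ab t _.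
  unfold mu_integrand, binet_kernel. do 2 f_equal. apply C_eq; simpl; ring.
Qed.

(** Since log z = log tau + i pi / 2, the factor z^(-1/2) contributes tau^(-1/2) and the phase -pi /
    4, while z^z contributes e^(-pi tau / 2) and the phase tau log tau. *)
Lemma Gamma_imag_phase (tau x : R) (mu : C) : 0 < tau -> 0 < x ->
  (Cexp (- (Cpair 0 tau * RtoC (ln (x / 2)))) * Gamma_imag tau mu)%C =
  (RtoC (sqrt (2 * PI / tau) * exp (- (PI * tau / 2))) * (Cexp (Ci * RtoC (phase tau x)) * Cexp mu))%C.
Proof.
  intros Ht Hx. pose proof PI_RGT_0. unfold Gamma_imag.
  assert (EL : Clog 0 tau = Cpair (ln tau) (PI / 2)).
  { unfold Clog, Cpair. f_equal.
    - replace (0 ^ 2 + tau ^ 2) with (tau * tau) by ring. rewrite ln_mult by exact Ht. field.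
    - replace (0 / tau) with 0 by (field; lra). rewrite atan_0. ring. }
  assert (Es : sqrt (2 * PI / tau) = sqrt (2 * PI) * exp (- / 2 * ln tau)).
  { rewrite sqrt_div by lra. unfold Rdiv. f_equal.
    rewrite <- (Rpower_sqrt tau) by exact Ht. unfold Rpower. rewrite <- exp_Ropp. f_equal. ring. }
  assert (Ep : phase tau x = tau * ln tau - tau - tau * ln (x / 2) - PI / 4).
  { unfold phase. replace (2 * tau / (exp 1 * x)) with (tau / (exp 1 * (x / 2))) by (pose proof (exp_pos 1); field; lra).
    rewrite ln_div, ln_mult, ln_exp; try lra; try apply exp_pos. pose proof (exp_pos 1). nra. }
  rewrite EL, Es, Ep, !RtoC_mult, <- !Cexp_RtoC.
  transitivity (RtoC (sqrt (2 * PI)) * Cexp (- (Cpair 0 tau * RtoC (ln (x / 2))) + (Cpair (- / 2) tau * Cpair (ln tau) (PI / 2) - Cpair 0 tau)) * Cexp mu)%C;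
    [rewrite Cexp_plus; ring|].
  match goal with |- _ = (?s * ?e1 * ?e2 * (?e3 * ?e4))%C => transitivity (s * (e1 * e2 * e3) * e4)%C; [|ring] end.
  rewrite <- !Cexp_plus. f_equal. f_equal. f_equal. apply C_eq; simpl; field.
Qed.

(** With 1 + r = e^mu and S the full series, the bracket r + (1 + r)(S - 1) of the statement
    collapses to e^mu S - 1. *)
Lemma R_rem_eq (N : nat) (x tau : R) (mu : C) : 0 < tau -> 0 < x ->
  is_RInt_gen (V := C_R_NormedModule) (mu_integrand 0 tau) (at_point 0) (Rbar_locally p_infty) mu ->
  R_rem N x tau = Re (Cexp (Ci * RtoC (phase tau x)) *
    (Cexp mu * (Csum (bessel_term tau x) (S N) + bessel_tail tau x N) - RtoC 1))%C.
Proof.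
  intros Ht Hx Hmu. unfold R_rem. rewrite (r_tau_eq tau mu Hmu). f_equal. f_equal.
  replace (RtoC 1 - Ci * RtoC tau)%C with (Cpair 1 (- tau)) by (apply C_eq; simpl; ring).
  assert (ES : (RtoC 1 + sum_n_m (G := C_AbelianMonoid) (fun m : nat =>
         (RtoC ((x / 2) ^ (2 * m)) / (RtoC (INR (fact m)) * pochhammer (Cpair 1 (- tau)) m))%C) 1 N)%C
       = Csum (bessel_term tau x) (S N)).
  { induction N as [|N IH].
    - rewrite sum_n_m_zero by lia. change (@zero C_AbelianMonoid) with (RtoC 0).
      unfold bessel_term; simpl. field.
    - rewrite sum_n_Sm by lia. change (@plus C_AbelianMonoid) with Cplus. rewrite Cplus_assoc, IH. reflexivity. }
  assert (EJ : CRInt (fun y : R => (Rcpow (x ^ 2 - y ^ 2) (RtoC (INR N) - Ci * RtoC tau) *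
       RtoC (besselI (N + 1) y / y ^ N))%C) 0 x = (RtoC (/ 2 ^ S N) * CRInt (tail_integrand tau x N) 0 x)%C).
  { apply CRInt_eq.
    apply is_RInt_C_ext with (3 := is_RInt_C_mult (RtoC (/ 2 ^ S N)) _ _ _ _ (tail_is_RInt tau x N Hx)); [lra|].
    intros y Hy. unfold tail_integrand, Rcpow.
    replace (RtoC (INR N) - Ci * RtoC tau)%C with (Cpair (INR N) (- tau)) by (apply C_eq; simpl; ring).
    rewrite besselI_eq, Nat.add_1_r.
    replace ((y / 2) ^ S N * bessel_core (S N) ((y / 2) ^ 2) / y ^ N) with (/ 2 ^ S N * (y * bessel_core (S N) ((y / 2) ^ 2))).
    - rewrite (RtoC_mult (/ 2 ^ S N)). ring.
    - unfold Rdiv at 3. rewrite Rpow_mult_distr, pow_inv. change (y ^ S N) with (y * y ^ N). field.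
      split; apply pow_nonzero; lra. }
  rewrite EJ, <- ES.
  assert (ET : (Rcpow x (RtoC 2 * Ci * RtoC tau) / (RtoC (2 ^ N) * pochhammer (Cpair 1 (- tau)) N) *
     (RtoC (/ 2 ^ S N) * CRInt (tail_integrand tau x N) 0 x))%C = bessel_tail tau x N).
  { unfold bessel_tail, Rcpow. do 4 f_equal. apply C_eq; simpl; ring. }
  rewrite ET. ring.
Qed.

Theorem theorem1 :
  forall (N : nat) (X x : R), 0 < X -> 0 < x <= X ->
    (forall tau : R, 0 < tau ->
       besselK_imag tau x =
         sqrt (2 * PI / tau) * exp (- (PI * tau / 2)) *
         (cos (tau * ln (2 * tau / (exp 1 * x)) - PI / 4) + R_rem N x tau))
    /\
    (forall tau0 tau : R, 0 < tau0 -> tau0 <= tau ->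
       Rabs (R_rem N x tau) <=
         1 / tau *
         (exp (1 / (6 * tau0)) / 6 +
          (tau0 + exp (1 / (6 * tau0)) / 6) *
          (exp (X ^ 2 / (4 * tau0)) +
           (X ^ 2 / (2 * tau0)) ^ N *
           (besselI N X / X ^ N - 1 / (2 ^ N * INR (fact N)))))).
Proof.
  intros N X x HX [Hx HxX]. split.
  - intros tau Ht. destruct (mu_exists tau Ht) as [mu [Hmu [_ Hsum]]].
    rewrite (R_rem_eq N x tau mu Ht Hx Hmu).
    rewrite (besselK_imag_series tau x mu _ Ht Hx Hsum (bessel_series tau x N Ht Hx)), Gamma_imag_phase by assumption.
    change (tau * ln (2 * tau / (exp 1 * x)) - PI / 4) with (phase tau x).
    set (Sg := (Csum (bessel_term tau x) (S N) + bessel_tail tau x N)%C).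
    assert (Ec : cos (phase tau x) = Re (Cexp (Ci * RtoC (phase tau x)))).
    { unfold Cexp. replace (Ci * RtoC (phase tau x))%C with (Cpair 0 (phase tau x)) by (apply C_eq; simpl; ring).
      simpl. rewrite exp_0. ring. }
    rewrite Ec. set (e := Cexp (Ci * RtoC (phase tau x))).
    rewrite <- Cmult_assoc, re_scal_l. f_equal. unfold Re; simpl; ring.
  - intros tau0 tau H0 Htau. assert (Ht : 0 < tau) by lra.
    destruct (mu_exists tau Ht) as [mu [Hmu [Hbd _]]].
    rewrite (R_rem_eq N x tau mu Ht Hx Hmu).
    set (Sg := (Csum (bessel_term tau x) (S N) + bessel_tail tau x N)%C).
    pose proof (bessel_series_bound tau x Sg Ht Hx (bessel_series tau x N Ht Hx)) as HS.
    set (e0 := exp (1 / (6 * tau0))). set (E := exp (X ^ 2 / (4 * tau0))).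
    assert (He0 : 0 < e0) by apply exp_pos.
    assert (HE : 1 <= E) by (apply exp_ge_1, Rdiv_le_0_compat; nra).
    (* |r| <= |mu| e^|mu|, with |mu| <= 1 / (6 tau) in the first factor and |mu| <= 1 / (6 tau0) in
       the exponent: the origin of e^(1 / (6 tau0)) / 6. *)
    assert (Hr : Cmod (Cexp mu - RtoC 1) <= e0 / (6 * tau)).
    { eapply Rle_trans; [apply Cmod_Cexp_minus_1|].
      replace (e0 / (6 * tau)) with (/ (6 * tau) * e0) by (unfold Rdiv; ring).
      apply Rmult_le_compat; [apply Cmod_ge_0|left; apply exp_pos|exact Hbd|].
      apply exp_le_mono. eapply Rle_trans; [exact Hbd|]. unfold Rdiv. rewrite Rmult_1_l. apply Rinv_le_contravar; lra. }
    assert (HS2 : Cmod (Sg - RtoC 1) <= tau0 / tau * (E - 1)).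
    { eapply Rle_trans; [exact HS|]. eapply Rle_trans; [|apply exp_scale_le].
      - apply Rplus_le_compat_r. apply exp_le_mono.
        replace (tau0 / tau * (X ^ 2 / (4 * tau0))) with (X ^ 2 / (4 * tau)) by (field; lra).
        apply Rmult_le_compat_r; [left; apply Rinv_0_lt_compat; lra|]. nra.
      - split; [apply Rdiv_le_0_compat; lra|apply Rle_div_l; lra].
      - apply Rdiv_le_0_compat; nra. }
    (* 1 / (2^N N!) is the leading term of I_N(X) / X^N, whose other terms are nonnegative. *)
    assert (HB : 0 <= (X ^ 2 / (2 * tau0)) ^ N * (besselI N X / X ^ N - 1 / (2 ^ N * INR (fact N)))).
    { apply Rmult_le_pos; [apply pow_le, Rdiv_le_0_compat; nra|].
      rewrite besselI_eq. unfold Rdiv at 2. rewrite Rpow_mult_distr, pow_inv.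
      assert (H2 : 0 < 2 ^ N) by (apply pow_lt; lra). assert (HXN : 0 < X ^ N) by (apply pow_lt; lra).
      pose proof (INR_fact_lt_0 N).
      replace (X ^ N * / 2 ^ N * bessel_core N ((X / 2) ^ 2) / X ^ N - 1 / (2 ^ N * INR (fact N)))
        with (/ 2 ^ N * (bessel_core N ((X / 2) ^ 2) - / INR (fact N))) by (field; lra).
      apply Rmult_le_pos; [left; apply Rinv_0_lt_compat, H2|].
      pose proof (bessel_core_ge N ((X / 2) ^ 2) (pow2_ge_0 _)). lra. }
    set (B := (X ^ 2 / (2 * tau0)) ^ N * (besselI N X / X ^ N - 1 / (2 ^ N * INR (fact N)))) in *.
    eapply Rle_trans; [apply re_le_Cmod|].
    rewrite Cmod_mult, Cmod_Cexp. replace (Re (Ci * RtoC (phase tau x))) with 0 by (simpl; ring). rewrite exp_0, Rmult_1_l.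
    set (r := (Cexp mu - RtoC 1)%C) in *.
    replace (Cexp mu * Sg - RtoC 1)%C with (r + (RtoC 1 + r) * (Sg - RtoC 1))%C by (unfold r; ring).
    eapply Rle_trans; [apply Cmod_triangle|]. rewrite Cmod_mult.
    pose proof (Cmod_triangle (RtoC 1) r) as H1. rewrite Cmod_1 in H1.
    assert (Hprod : Cmod (RtoC 1 + r) * Cmod (Sg - RtoC 1) <= (1 + e0 / (6 * tau)) * (tau0 / tau * (E - 1))).
    { apply Rmult_le_compat; [apply Cmod_ge_0|apply Cmod_ge_0|lra|exact HS2]. }
    assert (Hl : 0 <= tau0 / tau <= 1) by (split; [apply Rdiv_le_0_compat; lra|apply Rle_div_l; lra]).
    apply Rle_trans with (e0 / (6 * tau) + (1 + e0 / (6 * tau)) * (tau0 / tau * (E - 1))); [lra|].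
    (* In this form the slack is visible: tau0 / tau is replaced by 1 beside e0 / 6, and E - 1 by E
       + B. *)
    replace (e0 / (6 * tau) + (1 + e0 / (6 * tau)) * (tau0 / tau * (E - 1)))
      with (1 / tau * (e0 / 6 + (tau0 + e0 / 6 * (tau0 / tau)) * (E - 1))) by (field; lra).
    apply Rmult_le_compat_l; [apply Rdiv_le_0_compat; lra|].
    apply Rplus_le_compat_l. apply Rmult_le_compat; [nra|lra|nra|lra].
Qed.
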